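(* Let $\Delta=(\Sigma,C,w)$ be a complete simplicial multi-fan in a lattice $N$ of rank $n$, let $\mathcal V=\{v_i\}_{i\in\Sigma^{(1)}}$ be a set of edge vectors, and assume that $\xi\in H_T^2(\Delta,\mathcal V)$ is $T$-Cartier. Write $$\#(\mathcal P(\nu\xi))=\sum_{k=0}^n a_k(\xi)\,\nu^{n-k}$$ as a polynomial in the positive integer $\nu$. Then for $1\le k\le n$ $$a_k(\xi)=\sum_{J\in\Sigma^{(k)}}\mu_k(J)\,\mathrm{vol}\,\mathcal P(\xi)_J$$ in $\mathrm{Rat}(G_{n-k+1}(N_{\mathbb C}))_0$, where $$\mu_k(J)=\frac1{|H_{J,\mathcal V}|}\,\nu^*\Big(\sum_{h\in H_{J,\mathcal V}}\prod_{j\in J}\frac1{1-\chi(u_j^J,h)e^{-f^J(x_j)}}\Big)_0$$ and $\nu^*$ denotes pull-back along the Plücker embedding.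
   Context: **Multi-fans.** $N$ is a lattice of rank $n$, $M=N^*=\mathrm{Hom}(N,\mathbb Z)$; subscripts $\mathbb Q,\mathbb R,\mathbb C$ denote tensoring. A simplicial multi-fan in $N$ is a triple $\Delta=(\Sigma,C,w)$: $\Sigma=\bigsqcup_{k=0}^n\Sigma^{(k)}$ is a finite augmented simplicial complex, $\Sigma^{(k)}$ being the set of simplices with $k$ vertices, $\Sigma^{(0)}=\{o\}$, $o=\emptyset$; $\Sigma^{(n)}\neq\emptyset$ and every $J\in\Sigma$ is contained in some $I\in\Sigma^{(n)}$; $C$ sends each $J\in\Sigma^{(k)}$ to a $k$-dimensional strongly convex rational polyhedral cone in $N_{\mathbb R}$, such that if $J$ is a face of $I$ then $C(J)$ is a face of $C(I)$, and for each $I$ the restriction of $C$ to the faces of $I$ is an isomorphism of ordered sets onto the set of faces of $C(I)$; $w:\Sigma^{(n)}\to\mathbb Z$ is a map. For $K\in\Sigma$, $N_K$ is the minimal primitive sublattice of $N$ containing $N\cap C(K)$, $N^K=N/N_K$, $\Sigma_K=\{J\in\Sigma:K\subset J\}$ (graded by $|J|-|K|$), $C_K(J)$ is the image of $C(J)$ in $N^K_{\mathbb R}$, and $\Delta_K=(\Sigma_K,C_K,w|_{\Sigma_K^{(n-|K|)}})$ is the projected multi-fan in $N^K$. A vector is generic for a multi-fan if it lies on no linear subspace spanned by a cone of the multi-fan of less than maximal dimension. $\Delta$ is pre-complete if $d_v=\sum_{I\in\Sigma^{(n)},\,v\in C(I)}w(I)$ is independent of the generic vector $v$; $\Delta$ is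 complete if $\Delta_K$ is pre-complete for every $K\in\Sigma$. **Face ring.** $\mathcal V=\{v_i\}_{i\in\Sigma^{(1)}}$ consists of non-zero vectors $v_i\in N\cap C(i)$, not necessarily primitive. $H_T^*(\Delta,\mathcal V)$ is the quotient of $\mathbb Z[x_i\mid i\in\Sigma^{(1)}]$, $\deg x_i=2$, by the ideal generated by the $\prod_{i\in K}x_i$ with $K\subset\Sigma^{(1)}$, $K\notin\Sigma$. $H_T^*(pt)=\mathrm{Sym}^*(M)$ with $M$ in degree $2$. For $I\in\Sigma^{(n)}$, $\{u_i^I\}_{i\in I}\subset M_{\mathbb Q}$ is the basis dual to $\{v_i\}_{i\in I}$, and $\iota_I^*:H_T^*(\Delta,\mathcal V)_{\mathbb Q}\to H_T^*(pt)_{\mathbb Q}$ is the ring homomorphism with $\iota_I^*(x_i)=u_i^I$ for $i\in I$, $\iota_I^*(x_i)=0$ for $i\notin I$. For $K\in\Sigma$, $N_{K,\mathcal V}$ is the sublattice of $N_K$ generated by $\{v_i\}_{i\in K}$ and $H_{K,\mathcal V}=N_K/N_{K,\mathcal V}$. $\xi=\sum_i d_ix_i$ is $T$-Cartier if $\iota_I^*(\xi)\in M$ for all $I\in\Sigma^{(n)}$. **Multi-polytopes, volume, lattice point count.** Let $K\in\Sigma^{(k)}$ and let $\Sigma_K'^{(1)}$ be the vertex set of the link of $K$, i.e. the $i\notin K$ with $K\cup\{i\}\in\Sigma$. Given $\xi=\sum_i d_ix_i$ with $d_i\in\mathbb R$, let $A_K^*=\{u\in M_{\mathbb R}:\langle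 u,v_i\rangle=d_i\ \forall i\in K\}$ and $F_i=\{u\in A_K^*:\langle u,v_i\rangle=d_i\}$ for $i\in\Sigma_K'^{(1)}$. The multi-polytope $\mathcal P(\xi)_K$ is the pair $(\Delta_K,\{F_i\})$; for $K=o$ write $\mathcal P(\xi)$. For $I\in\Sigma^{(n)}$ with $I\supset K$ put $u_I=\iota_I^*(\xi)\in A_K^*$. Choose $v\in N^K_{\mathbb R}$ with $\langle u_i^I,v\rangle\ne0$ for all such $I$ and all $i\in I\setminus K$; put $(-1)^I=(-1)^{\#\{j\in I\setminus K:\langle u_j^I,v\rangle>0\}}$, $(u_i^I)^+=u_i^I$ or $-u_i^I$ according as $\langle u_i^I,v\rangle>0$ or $<0$, and let $\phi_I$ be the characteristic function of the cone in $A_K^*$ with apex $u_I$ spanned by the $(u_i^I)^+$, $i\in I\setminus K$. The Duistermaat–Heckman function on $A_K^*\setminus\bigcup_iF_i$ is $\mathrm{DH}_{\mathcal P(\xi)_K}=\sum_{I\supset K,\,I\in\Sigma^{(n)}}(-1)^Iw(I)\phi_I$. Put $\mathrm{vol}\,\mathcal P(\xi)_K=\int_{A_K^*}\mathrm{DH}_{\mathcal P(\xi)_K}\,dV_K$, where $dV_K$ is the volume element on $A_K^*$ defined by the lattice $M\cap A_K^*$. For $T$-Cartier $\xi=\sum_id_ix_i$ put $\#(\mathcal P(\xi))=\sum_{u\in M}\mathrm{DH}_{\mathcal P(\xi_+)}(u)$ with $\xi_+=\sum_i(d_i+\epsilon)x_i$, $0<\epsilon<1$. **The coefficients $\mu_k(J)$.**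 For $J\in\Sigma^{(k)}$, $1\le k\le n$, let $M_J\subset M$ be the annihilator of $N_J$ and $\omega_J=u_1\wedge\dots\wedge u_{n-k}$ for an (oriented) basis $u_1,\dots,u_{n-k}$ of $M_J$. Put $f^J(x_i)=\iota_I^*(x_i)\wedge\omega_J\in\bigwedge^{n-k+1}M_{\mathbb Q}$ for any $I\in\Sigma^{(n)}$ with $J\subset I$ (independent of $I$). $\{u_j^J\}_{j\in J}$ is the basis of $\mathrm{Hom}(N_{J,\mathcal V},\mathbb Z)$ dual to $\{v_j\}_{j\in J}$, extended $\mathbb Q$-linearly to $N_J\otimes\mathbb Q$, and $\chi(u_j^J,h)=e^{2\pi\sqrt{-1}\langle u_j^J,v(h)\rangle}$ where $v(h)\in N_J$ is a lift of $h\in H_{J,\mathcal V}$. In the formula for $\mu_k(J)$, each factor $1/(1-\chi e^{-y})$ is expanded as a Laurent series in $y=f^J(x_j)$, and $(\ )_0$ denotes the homogeneous part of degree $0$ in the $f^J(x_j)$; it is a degree $0$ element of the fraction field of the symmetric algebra of $\bigwedge^{n-k+1}M_{\mathbb C}$, hence a rational function on $\mathbb P(\bigwedge^{n-k+1}N_{\mathbb C})$, and $\nu^*$ is its pull-back by the Plücker embedding $G_{n-k+1}(N_{\mathbb C})\to\mathbb P(\bigwedge^{n-k+1}N_{\mathbb C})$. $\mathrm{Rat}(\cdot)_0$ denotes the field of rational functions of degree $0$. *)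

(* Defs.v *)
From HB Require Import structures.
From mathcomp Require Import all_boot all_order all_algebra fraction.

Set Implicit Arguments.
Unset Strict Implicit.
Unset Printing Implicit Defensive.

Import Order.TTheory GRing.Theory Num.Theory.

Local Open Scope ring_scope.

(* Exterior powers, their symmetric algebras and the Pluecker embedding.      *)
(* Vectors of M are columns, vectors of N are rows. This is a module of its   *)
(* own because the notations of mpoly clash with those of mathcomp-analysis.  *)
Module Plucker.
From mathcomp Require Import mpoly.

Section Plucker.
Variables (p n : nat).

(* The standard basis of the p-th exterior power of an n-dimensional space is *)
(* indexed by the strictly increasing maps s : 'I_p -> 'I_n.                  *)
Definition incr :=
  {s : {ffun 'I_p -> 'I_n} |
    [forall a : 'I_p, forall b : 'I_p, (a < b)%N ==> (s a < s b)%N]}.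

(* Coordinates of m_1 /\ ... /\ m_p, where the m_a are the columns of m.      *)
Definition wedge (F : comPzRingType) (m : 'M[F]_(n, p)) : {ffun incr -> F} :=
  [ffun s : incr => \det (rowsub (sval s) m)].

Variable F : fieldType.

(* SymW is Sym^*(/\^p M_F); its s-th variable is the s-th basis vector of     *)
(* /\^p M_F, i.e. the s-th homogeneous coordinate on P(/\^p N_F). RatP is its *)
(* fraction field.                                                            *)
Definition SymW : idomainType := {mpoly F[#|{: incr}|]}.
Definition RatP : fieldType := {fraction SymW}.
Definition constP (c : F) : RatP := tofrac (c%:MP : SymW).
Definition linearP (eta : {ffun incr -> F}) : RatP :=
  tofrac (\sum_(s : incr) eta s *: 'X_(enum_rank s) : SymW).

(* Rational functions on the Grassmannian G_p(N_F). The map sending a p x n   *)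
(* matrix of rank p to its row space is dominant, so that Rat(G_p(N_F)) is a  *)
(* subfield of the field RatG of rational functions of a generic p x n        *)
(* matrix. The Pluecker embedding sends the row space of z to the point whose *)
(* s-th homogeneous coordinate is the maximal minor of z on the columns s.    *)
Definition PolG : idomainType := {mpoly F[#|{: 'I_p * 'I_n}|]}.
Definition RatG : fieldType := {fraction PolG}.
Definition constG (c : F) : RatG := tofrac (c%:MP : PolG).

Definition generic_mx : 'M[PolG]_(p, n) :=
  \matrix_(a < p, b < n) 'X_(enum_rank (a, b)).

Definition pullback_poly (P : SymW) : PolG :=
  mmap (@mpolyC _ F)
    (fun i => \det (colsub (sval (enum_val i : incr)) generic_mx)) P.

(* r is the pull-back of q: the latter must be regular at the generic point   *)
(* of the Grassmannian, i.e. have a denominator that does not vanish on it.   *)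
Definition is_pullback (q : RatP) (r : RatG) : Prop :=
  exists P Q : SymW,
    [/\ pullback_poly Q != 0, q = tofrac P / tofrac Q
      & r = tofrac (pullback_poly P) / tofrac (pullback_poly Q)].

End Plucker.
End Plucker.

Export Plucker.

From mathcomp Require Import complex finmap.
From mathcomp Require Import all_classical all_reals all_analysis.

Local Open Scope classical_set_scope.
Local Open Scope ring_scope.

Definition pullback (p n : nat) (F : fieldType) (q : RatP p n F) : RatG p n F :=
  xget 0 [set r | is_pullback q r].

(* N is 'rV[int]_n and M is 'cV[int]_n, paired as follows.                    *)
Definition pairing (F : pzSemiRingType) (n : nat) (u : 'cV[F]_n) (x : 'rV[F]_n) : F :=
  (x *m u) 0 0.

Definition ofZ (F : pzRingType) (m n : nat) (x : 'M[int]_(m, n)) : 'M[F]_(m, n) :=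
  map_mx intr x.
Arguments ofZ F {m n} x.

Definition primitive_sublattice (n : nat) (L : set 'rV[int]_n) : Prop :=
  [/\ L 0, (forall x y, L x -> L y -> L (x - y))
    & (forall (m : int) x, m != 0 -> L (m *: x) -> L x)].

Section Cones.
Variables (R : realType) (n : nat).
Implicit Types (C F : set 'rV[R]_n).

Definition rational_polyhedral C : Prop :=
  exists s : seq 'rV[int]_n,
    C = [set x | exists a : nat -> R, (forall i, 0 <= a i) /\
                   x = \sum_(i < size s) a i *: ofZ R s`_i].

Definition strongly_convex C : Prop := forall x, C x -> C (- x) -> x = 0.

Definition lspan C : set 'rV[R]_n :=
  [set x | forall W : {vspace 'rV[R]_n}, C `<=` [set` W] -> x \in W].

Definition has_dim C (k : nat) : Prop :=
  exists W : {vspace 'rV[R]_n}, lspan C = [set` W] /\ \dim W = k.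

Definition is_face F C : Prop :=
  exists u : 'cV[R]_n, (forall x, C x -> 0 <= pairing u x) /\
    F = [set x | C x /\ pairing u x = 0].

End Cones.

(* V is the vertex set Sigma^(1). Only the values of cone on simplices and    *)
(* those of weight on n-element simplices are meaningful.                     *)
Record multifan (R : realType) (n : nat) (V : finType) := MultiFan {
  simplices : {set {set V}};
  cone : {set V} -> set 'rV[R]_n;
  weight : {set V} -> int;
  simplices0 : finset.set0 \in simplices;
  simplices1 : forall i : V, [set i]%SET \in simplices;
  simplices_sub : forall I J : {set V},
    I \in simplices -> J \subset I -> J \in simplices;
  simplices_pure : forall J : {set V}, J \in simplices ->
    exists I : {set V}, [/\ I \in simplices, #|I| = n & J \subset I];
  cone_rational : forall J, J \in simplices -> rational_polyhedral (cone J);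
  cone_strongly_convex : forall J, J \in simplices -> strongly_convex (cone J);
  cone_dim : forall J : {set V}, J \in simplices -> has_dim (cone J) #|J|;
  cone_is_face : forall I J : {set V}, I \in simplices -> J \subset I ->
    is_face (cone J) (cone I);
  cone_face_surj : forall (I : {set V}) F, I \in simplices ->
    is_face F (cone I) -> exists2 J : {set V}, J \subset I & F = cone J;
  cone_face_order : forall I J K : {set V}, I \in simplices ->
    J \subset I -> K \subset I -> (J \subset K <-> cone J `<=` cone K)
}.

Section MultiFan.
Variables (R : realType) (n : nat) (V : finType) (D : multifan R n V).
Implicit Types (I J K : {set V}).

Definition skel (k : nat) : {set {set V}} :=
  [set J in simplices D | #|J| == k]%SET.

Definition facets K : {set {set V}} := [set I in skel n | K \subset I]%SET.

Definition latN K : set 'rV[int]_n :=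
  smallest (@primitive_sublattice n) [set x | cone D K (ofZ R x)].

(* Vectors and subsets of N^K_R are represented by their inverse images in    *)
(* N_R; proj_cone K J is the inverse image of C_K(J).                         *)
Definition latN_R K : set 'rV[R]_n := lspan (ofZ R @` latN K).

Definition proj_cone K J : set 'rV[R]_n :=
  [set x | exists2 y, cone D J y & latN_R K (x - y)].

Definition proj_generic K (x : 'rV[R]_n) : Prop :=
  forall J, J \in simplices D -> K \subset J -> (#|J| < n)%N ->
    ~ lspan (proj_cone K J) x.

Definition proj_degree K (x : 'rV[R]_n) : int :=
  \sum_(I in facets K | `[< proj_cone K I x >]) weight D I.

Definition proj_precomplete K : Prop :=
  forall x y, proj_generic K x -> proj_generic K y ->
    proj_degree K x = proj_degree K y.

Definition complete_multifan : Prop :=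
  forall K, K \in simplices D -> proj_precomplete K.

Definition edge_vectors (v : V -> 'rV[int]_n) : Prop :=
  forall i, v i != 0 /\ cone D [set i]%SET (ofZ R (v i)).

Variable v : V -> 'rV[int]_n.

(* u_i^I. If #|I| < n this is only one of the extensions to N_Q of the        *)
(* i-th coordinate form on N_I (x) Q.                                         *)
Definition dual I (i : V) : 'cV[rat]_n :=
  xget 0 [set u | forall j, j \in I -> pairing u (ofZ rat (v j)) = (i == j)%:R].

Definition dualR I (i : V) : 'cV[R]_n := map_mx ratr (dual I i).

(* A class xi = \sum_i d_i x_i of degree 2 is given by its coefficients d.    *)
Definition T_Cartier (d : V -> int) : Prop :=
  forall I, I \in skel n -> exists m : 'cV[int]_n,
    \sum_(i in I) (d i)%:~R *: dual I i = ofZ rat m.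

Definition affA (d : V -> R) K : set 'cV[R]_n :=
  [set u | forall i, i \in K -> pairing u (ofZ R (v i)) = d i].

(* g stands for the vector of N^K_R (represented by a lift to N_R) used to    *)
(* define the Duistermaat-Heckman function of P(xi)_K.                        *)
Definition DH_direction K (g : 'rV[R]_n) : Prop :=
  forall I i, I \in facets K -> i \in I :\: K -> pairing (dualR I i) g != 0.

Definition dual_plus (g : 'rV[R]_n) I (i : V) : 'cV[R]_n :=
  if 0 < pairing (dualR I i) g then dualR I i else - dualR I i.

Definition DH_cone (g : 'rV[R]_n) (d : V -> R) K I : set 'cV[R]_n :=
  [set u | exists t : V -> R, (forall i, 0 <= t i) /\
     u = \sum_(i in I) d i *: dualR I i
         + \sum_(i in I :\: K) t i *: dual_plus g I i].

Definition DH (g : 'rV[R]_n) (d : V -> R) K (u : 'cV[R]_n) : R :=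
  \sum_(I in facets K)
    (-1) ^+ #|[set j in I :\: K | 0 < pairing (dualR I j) g]%SET|
    * (weight D I)%:~R * \1_(DH_cone g d K I) u.

(* #(P(nu xi)), computed with the shift eps. The sum has finite support when  *)
(* the multi-fan is complete (\sum_(u \in A) is 0 for infinite supports).     *)
Definition lattice_count (g : 'rV[R]_n) (eps : R) (d : V -> int) (nu : nat) : R :=
  \sum_(u \in [set: 'cV[int]_n])
    DH g (fun i => nu%:R * (d i)%:~R + eps) finset.set0 (ofZ R u).

End MultiFan.

(* m1 \x m2 as a sigma-finite measure: the library's instance is shadowed by  *)
(* the one on products of probabilities                                       *)
Definition product_measure_sf (d1 d2 : measure_display)
    (T1 : measurableType d1) (T2 : measurableType d2) (R : realType)
    (m1 : {sigma_finite_measure set T1 -> \bar R})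
    (m2 : {sigma_finite_measure set T2 -> \bar R}) :
    {sigma_finite_measure set (T1 * T2)%type -> \bar R} :=
  HB.pack (m1 \x m2)%E (Measure.on (m1 \x m2)%E)
    (lebesgue_integral_fubini.measure_function_Measure_isSigmaFinite__to__measure_function_isSigmaFinite m1 m2)
    (lebesgue_integral_fubini.measure_function_Measure_isSigmaFinite__to__measure_function_isSFinite m1 m2).

(* R^m with its Lebesgue measure, as an iterated product together with the    *)
(* map to column vectors                                                      *)
Record coord_space (R : realType) (m : nat) := CoordSpace {
  cs_display : measure_display;
  cs_sort : measurableType cs_display;
  cs_measure : {sigma_finite_measure set cs_sort -> \bar R};
  cs_vec : cs_sort -> 'cV[R]_m
}.

Fixpoint euclid (R : realType) (m : nat) : coord_space R m :=
  match m with
  | 0 => CoordSpace (dirac tt : {sigma_finite_measure set unit -> \bar R})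
           (fun=> 0)
  | m'.+1 =>
      CoordSpace
        (product_measure_sf
          (@lebesgue_measure R
            : {sigma_finite_measure set (measurableTypeR R) -> \bar R})
          (cs_measure (euclid R m')))
        (fun x => col_mx (x.1 : R)%:M (cs_vec x.2) : 'cV[R]_(1 + m'))
  end.

Section Volume.
Variables (R : realType) (n : nat) (V : finType) (D : multifan R n V).
Variable v : V -> 'rV[int]_n.
Implicit Types (J K : {set V}).

(* M_J, the annihilator of N_J *)
Definition annM J : set 'cV[int]_n :=
  [set u | forall x, latN D J x -> pairing u x = 0].

(* the columns of b form a Z-basis of L *)
Definition lattice_basis (m : nat) (L : set 'cV[int]_n) (b : 'M[int]_(n, m)) :=
  forall u, L u <-> exists! c : 'cV[int]_m, u = b *m c.

(* vol P(xi)_K. The affine space A_K^* is identified with R^m by means of a   *)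
(* base point and of a Z-basis b of M_K, the group of the translations that   *)
(* preserve the lattice M :&: A_K^*.                                          *)
Definition vol (g : 'rV[R]_n) (d : V -> R) (m : nat) (b : 'M[int]_(n, m)) K : R :=
  \int[cs_measure (euclid R m)]_t
    DH D v g d K (xget 0 (affA v d K) + ofZ R b *m cs_vec t).

Definition latNV J : set 'rV[int]_n :=
  [set x | exists c : V -> int, x = \sum_(i in J) c i *: v i].

(* H_{J,V}, as the set of the cosets of N_{J,V} in N_J *)
Definition quotH J : set (set 'rV[int]_n) :=
  [set h | exists2 x, latN D J x & h = [set x + y | y in latNV J]].

Definition lift_of (h : set 'rV[int]_n) : 'rV[int]_n := xget 0 h.

Definition chi J (j : V) (h : set 'rV[int]_n) : R[i] :=
  let q : R := 2 * pi * ratr (pairing (dual v J j) (ofZ rat (lift_of h))) in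
  (cos q +i* sin q)%C.

(* Laurent expansion of 1 / (1 - c exp(-y)) at y = 0, which has at most a     *)
(* simple pole: it is \sum_m laurent_coef c m * y ^ (m - 1), characterized by *)
(* (1 - c exp(-y)) * \sum_m laurent_coef c m * y ^ m = y.                     *)
Definition denom_coef (c : R[i]) (m : nat) : R[i] :=
  (m == 0%N)%:R - c * (-1) ^+ m / (m`!)%:R.

Definition laurent_coef (c : R[i]) : nat -> R[i] :=
  xget (fun=> 0) [set b | forall m : nat,
    \sum_(l < m.+1) denom_coef c l * b (m - l)%N = (m == 1%N)%:R].

(* homogeneous part of degree 0 in (y_j)_(j in J) of the product over j in J  *)
(* of the Laurent expansions of the 1 / (1 - c_j exp(-y_j)); a monomial       *)
(* \prod_j y_j ^ (e_j - 1) has degree 0 iff \sum_j e_j = #|J|                 *)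
Definition degree0_part (F : fieldType) (inj : R[i] -> F) J (c : V -> R[i])
    (y : V -> F) : F :=
  \sum_(e : {ffun V -> 'I_#|J|.+1} |
          [forall i, (i \notin J) ==> (e i == 0%N :> nat)]
          && (\sum_(j in J) e j == #|J|)%N)
    \prod_(j in J) (inj (laurent_coef (c j) (e j)) * y j ^ ((e j)%:Z - 1)).

(* f^J does not depend on the choice of I. *)
Definition facet_of J : {set V} := odflt finset.set0 [pick I in facets D J].

(* f^J(x_j) for j in J, as an element of Sym(/\^(m+1) M_C), where omega_J is  *)
(* the exterior product of the columns of b                                   *)
Definition fJ (m : nat) (b : 'M[int]_(n, m)) J (j : V) : RatP (1 + m) n R[i] :=
  linearP [ffun s => ratr (wedge (row_mx (dual v (facet_of J) j) (ofZ rat b)) s)].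

Definition mu (m : nat) (b : 'M[int]_(n, m)) J : RatG (1 + m) n R[i] :=
  (#|` fset_set (quotH J)|%fset%:R)^-1 *
  pullback (\sum_(h \in quotH J)
    degree0_part (@constP (1 + m) n R[i]) J (fun j => chi J j h) (fJ b J)).

End Volume.

(* Main.v *)
Require Import Defs.
From HB Require Import structures.
From mathcomp Require Import all_boot all_order all_algebra fraction fingroup perm.
From mathcomp Require Import ring lra zify.

Set Implicit Arguments.
Unset Strict Implicit.
Unset Printing Implicit Defensive.

Import Order.TTheory GRing.Theory Num.Theory.

Local Open Scope ring_scope.

(** Both sides are computed as rational functions in a frame z of a subspace E of
    dimension n - k + 1, and compared at the integral frames in general position,
    which are dense [value_generic0]; the pull-back of f^J(x_j) takes at z the value of
    a determinant of size n - k + 1, by the Cauchy-Binet formula [value_linearP].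

    The lattice point count. Let g in N be an integral generic direction. The
    Duistermaat-Heckman function does not depend on the direction that defines it
    [signed_DH_indep]: when the direction crosses a wall, the change is a multiple
    of the difference of the weights on both sides, which is 0 by completeness
    [wall_balance]. Hence g can serve as the direction, and the function is a
    signed sum of indicators of the simplicial cones of the facets I. In the
    generating function of the lattice points by their pairing with g, the cone of I
    becomes a product of geometric series, averaged over the characters of a finite
    quotient of N in order to select the lattice points [avg_character]. The
    substitution of exp y for the variable gives, by comparison of constant
    terms [count_value],

      #(P(xi)) = sum_I w(I) / prod_(i in I) a_i *
                 avg (exp (y <u_I, g>) * prod_(i in I) (a_i y / (1 - c_i exp (- a_i y))))_n,

    where a_i = <u_i^I, g>, the index n is the degree in y, and c_i runs over the
    values of the i-th character. A dilation by nu multiplies u_I by nu, so that the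
    count is a polynomial in nu, and a_k is the part of the formula with <u_I, g> in
    degree n - k and with the Todd factors in degree k.

    The volumes. The same count in the affine space of a face J has the leading
    coefficient sum_(I containing J) w(I) <u_I, g>^(n-k) |H_J| / (|H_I| (n-k)! prod_(i in I \ J) a_i)
    [slice_coef_top], which is the volume of the face by convergence of Riemann
    sums [volumeE].

    The comparison. Take g in E. The n forms u_i^I, i in I, restricted to E are forms
    in n - k + 1 variables in general position, and the squarefree products of k of
    them span all forms of degree k, since a repeated factor is a combination of
    factors that do not occur. The coefficients are found by evaluation at the
    vectors that span the lines of intersection of E with N_J, J in I, |J| = k,
    where only one squarefree product is non-zero and where u_j^I takes the value
    f^J(x_j) [squarefree_interpolation]. Applied to the Todd factors in degree k,
    this produces the degree 0 parts in the definition of mu_k(J); the average over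
    the characters, restricted to those that are trivial off J, becomes the
    average over H_J [avg_quotH]. Thus the term of I in a_k is the sum of the mu_k(J)
    times the terms of I in the volumes of its faces J [facet_identity], and it
    remains to exchange both sums [coef_identity]. *)

(** * The Cauchy-Binet formula *)

Section CauchyBinet.
Variables (p n : nat).

Lemma incr_lt (s : incr p n) (a b : 'I_p) : (a < b)%N -> (sval s a < sval s b)%N.
Proof. by case: s => s /= /forallP/(_ a)/forallP/(_ b)/implyP; apply. Qed.

Lemma incr_inj (s : incr p n) : injective (sval s).
Proof.
move=> a b e; case: (ltngtP a b) => [ab|ba|/ord_inj //].
  by have := incr_lt s ab; rewrite e ltnn.
by have := incr_lt s ba; rewrite e ltnn.
Qed.

Lemma codom_incr_sorted (s : incr p n) :
  sorted (fun i j : 'I_n => (i < j)%N) (codom (sval s)).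
Proof.
rewrite /codom /image_mem sorted_map.
have : sorted (fun i j : 'I_p => (i < j)%N) (enum 'I_p).
  by have := iota_ltn_sorted 0 p; rewrite -val_enum_ord sorted_map.
by apply: sub_sorted => a b /(incr_lt s).
Qed.

Lemma incr_eq (s s' : incr p n) : codom (sval s) =i codom (sval s') -> s = s'.
Proof.
move=> e; apply/val_inj/ffunP => a /=.
have lt_tr : transitive (fun i j : 'I_n => (i < j)%N) by move=> x y z; apply: ltn_trans.
have lt_irr : irreflexive (fun i j : 'I_n => (i < j)%N) by move=> x; apply: ltnn.
have := irr_sorted_eq lt_tr lt_irr (codom_incr_sorted s) (codom_incr_sorted s') e.
by rewrite /codom /image_mem => /eq_in_map; apply; rewrite mem_enum.
Qed.

(** Sorting the values of f gives the increasing map; the permutation records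
    their ranks. *)
Lemma incr_perm (f : {ffun 'I_p -> 'I_n}) : injective f ->
  exists (s : incr p n) (t : 'S_p), f = [ffun a => sval s (t a)].
Proof.
move=> injf.
pose l := sort (fun i j : 'I_n => (i <= j)%N) (codom f).
have szl : size l = p by rewrite size_sort size_codom card_ord.
have ul : uniq l by rewrite sort_uniq map_inj_uniq // enum_uniq.
have sl : sorted (fun i j : 'I_n => (i < j)%N) l.
  have : sorted ltn (map val l).
    rewrite ltn_sorted_uniq_leq map_inj_uniq ?ul; last exact: val_inj.
    by rewrite sorted_map; apply: sort_sorted => x y; apply: leq_total.
  by rewrite sorted_map.
have fl a : f a \in l by rewrite mem_sort codom_f.
case: (posnP p) => [p0|p_gt0].
  have np (a : 'I_p) : False by case: a => a; rewrite p0.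
  have H : [forall a : 'I_p, forall b : 'I_p, (a < b)%N ==> (f a < f b)%N].
    by apply/forallP => a; case: (np a).
  by exists (exist _ f H), 1%g; apply/ffunP => a; case: (np a).
pose x0 := f (Ordinal p_gt0).
pose s := [ffun a : 'I_p => nth x0 l a].
have Hs : [forall a : 'I_p, forall b : 'I_p, (a < b)%N ==> (s a < s b)%N].
  apply/forallP => a; apply/forallP => b; apply/implyP => ab; rewrite !ffunE.
  have lt_tr : transitive (fun i j : 'I_n => (i < j)%N) by move=> x y z; apply: ltn_trans.
  by apply: (sorted_ltn_nth lt_tr x0 sl); rewrite ?inE ?szl.
have ixl a : (index (f a) l < p)%N by have := fl a; rewrite -index_mem szl.
have tinj : injective (fun a => Ordinal (ixl a)).
  move=> a b [e]; apply: injf.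
  by rewrite -(nth_index x0 (fl a)) e nth_index.
exists (exist _ s Hs), (perm tinj); apply/ffunP => a.
by rewrite ffunE permE ffunE /= nth_index.
Qed.

(** Cauchy-Binet: expand the determinant multilinearly over all maps from rows
    to columns; the non-injective ones have two equal rows, and the injective
    ones are increasing maps composed with permutations. *)
Theorem det_mulmx_incr (F : comPzRingType) (z : 'M[F]_(p, n)) (A : 'M[F]_(n, p)) :
  \det (z *m A) = \sum_(s : incr p n) \det (colsub (sval s) z) * wedge A s.
Proof.
transitivity (\sum_(f : {ffun 'I_p -> 'I_n}) (\prod_a z a (f a)) * \det (rowsub f A)).
  rewrite /determinant.
  under eq_bigr do under eq_bigr do rewrite mxE.
  under eq_bigr => t _ do
    rewrite (bigA_distr_bigA (fun a b => z a b * A b (t a))) big_distrr /=.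
  rewrite exchange_big /=; apply: eq_bigr => f _.
  rewrite big_distrr /=; apply: eq_bigr => t _.
  rewrite big_split /= mulrCA; congr (_ * (_ * _)).
  by apply: eq_bigr => a _; rewrite !mxE.
rewrite (bigID (fun f : {ffun 'I_p -> 'I_n} => injectiveb f)) /= [X in _ + X]big1 ?addr0;
  last first.
  move=> f /injectivePn [a [b ab e]].
  rewrite (determinant_alternate ab) ?mulr0 // => i; by rewrite !mxE e.
pose h (x : incr p n * 'S_p) : {ffun 'I_p -> 'I_n} := [ffun a => sval x.1 (x.2 a)].
have hinj : injective h.
  move=> [s t] [s' t'] /ffunP; rewrite /h /= => e.
  have e' a : sval s (t a) = sval s' (t' a) by have := e a; rewrite !ffunE.
  have es : s = s'.
    apply: incr_eq => i; apply/codomP/codomP => -[a ->].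
      by exists (t' (t^-1%g a)); rewrite -e' permKV.
    by exists (t (t'^-1%g a)); rewrite e' permKV.
  subst s'; congr (_, _); apply/permP => a; exact: (incr_inj (e' a)).
rewrite (eq_bigl (fun f => f \in [set h x | x in [set: incr p n * 'S_p]])); last first.
  move=> f; apply/injectiveP/imsetP => [/incr_perm [s [t ->]]|[[s t] _ ->]].
    by exists (s, t).
  by move=> a b; rewrite !ffunE /= => /incr_inj/perm_inj.
rewrite big_imset /=; last by move=> x y _ _; apply: hinj.
rewrite (eq_bigl xpredT) => [|x]; last by rewrite inE.
rewrite -(pair_bigA _ (fun s t => (\prod_a z a (h (s, t) a)) * \det (rowsub (h (s, t)) A))) /=.
apply: eq_bigr => s _; rewrite /wedge ffunE /determinant mulr_suml.
apply: eq_bigr => t _; rewrite -/(determinant _).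
have -> : rowsub (h (s, t)) A = row_perm t (rowsub (sval s) A).
  by apply/matrixP => i j; rewrite !mxE ffunE.
rewrite row_permE det_mulmx det_perm mulrA [X in X * _]mulrC.
by congr (_ * _ * _); apply: eq_bigr => a _; rewrite mxE ffunE.
Qed.

End CauchyBinet.

(** * Values of rational functions on the Grassmannian *)

From mathcomp Require boolp classical_sets.
Module GrassmannEval.
From mathcomp Require Import mpoly.

Section Density.
Variables (F : fieldType).

Lemma base_expansion_inj (N B : nat) (m m' : 'I_N -> nat) :
  (forall i, (m i < B)%N) -> (forall i, (m' i < B)%N) ->
  (\sum_i m i * B ^ i = \sum_i m' i * B ^ i)%N -> m =1 m'.
Proof.
elim: N m m' => [|N IH] m m' mB m'B; first by move=> _ [].
rewrite !big_ord_recl !expn0 !muln1.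
have E (f : 'I_N.+1 -> nat) :
    (\sum_(i < N) f (lift ord0 i) * B ^ lift ord0 i = (\sum_(i < N) f (lift ord0 i) * B ^ i) * B)%N.
  by rewrite big_distrl /=; apply: eq_bigr => i _; rewrite /bump /= add1n expnSr mulnA.
rewrite !E ![(_ ord0 + _)%N]addnC => e.
have B0 : (0 < B)%N by apply: leq_ltn_trans (mB ord0).
have := congr1 (fun x => (x %% B)%N) e; rewrite !modnMDl !modn_small // => e0.
have := congr1 (fun x => (x %/ B)%N) e; rewrite !divnMDl // !divn_small // !addn0 => e1.
have e2 := IH _ _ (fun i => mB (lift ord0 i)) (fun i => m'B (lift ord0 i)) e1.
by move=> i; case: (unliftP ord0 i) => [j|] ->.
Qed.

(** Substituting [t ^ (B ^ i)] for the i-th variable sends distinct monomials of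
    exponents below [B] to distinct powers of [t], so that it cannot kill a
    polynomial; the univariate case then applies. *)
Lemma mpoly_neq0_eval (N : nat) (P : {mpoly F[N]}) (f : nat -> F) : injective f ->
  P != 0 -> exists x : 'I_N -> F,
    (forall i, exists (t e : nat), x i = f t ^+ e.+1) /\ P.@[x] != 0.
Proof.
move=> injf P0.
pose B := msize P.
have BP (m : 'X_{1.. N}) i : m \in msupp P -> (m i < B.+1)%N.
  move=> mP; rewrite ltnS; apply: leq_trans (ltnW (msize_mdeg_lt mP)).
  by rewrite mdegE (bigD1 i) //= leq_addr.
pose code (m : 'X_{1.. N}) := (\sum_i m i * B.+1 ^ i)%N.
pose h (i : 'I_N) : {poly F} := 'X^(B.+1 ^ i).
pose q := mmap (@polyC F) h P.
have h1 m : mmap1 h m = 'X^(code m).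
  rewrite /mmap1 /h /code expr_sum; apply: eq_bigr => i _.
  by rewrite -exprM mulnC.
have codeI : {in msupp P &, injective code}.
  move=> m m' mP m'P e; apply/mnmP => i.
  by apply: (@base_expansion_inj N B.+1 m m') => // j; apply: BP.
have [m mP] : exists m, m \in msupp P.
  by case E : (msupp P) => [|m s]; [move: P0; rewrite -msupp_eq0 E | exists m; rewrite inE eqxx].
have q0 : q != 0.
  apply/eqP => /(congr1 (fun r : {poly F} => r`_(code m))); rewrite coef0 /q /mmap.
  rewrite coef_sum (bigD1_seq m) ?msupp_uniq //= h1 coefCM coefXn eqxx mulr1 big_seq_cond big1.
    by rewrite addr0; apply/eqP; rewrite -mcoeff_msupp.
  move=> m' /andP[m'P mm']; rewrite h1 coefCM coefXn.
  case: eqP => [e|_]; last by rewrite mulr0.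
  by move: mm'; rewrite (codeI _ _ mP m'P e) eqxx.
have [t qt] : exists t, q.[f t] != 0.
  have /allPn [x /mapP[t _ ->] xr] : ~~ all (root q) (map f (iota 0 (size q))).
    apply/negP => /max_poly_roots; rewrite map_inj_uniq // iota_uniq => /(_ q0 isT).
    by rewrite size_map size_iota ltnn.
  by exists t.
exists (fun i => f t ^+ (B.+1 ^ i)); split.
  by move=> i; exists t, (B.+1 ^ i).-1; rewrite prednK // expn_gt0.
rewrite mevalE; congr (_ != 0): qt.
rewrite /q /mmap horner_sum; apply: eq_bigr => m' _; rewrite hornerM hornerC; congr (_ * _).
by rewrite /mmap1 horner_prod; apply: eq_bigr => i _; rewrite !hornerE.
Qed.

End Density.

Lemma fraction_quotient (R : idomainType) (r : {fraction R}) :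
  exists P Q : R, Q != 0 /\ r = tofrac P / tofrac Q.
Proof.
elim/quotW: r => x; exists (frac x).1, (frac x).2; split; first exact: denom_ratioP.
have d0 : tofrac (frac x).2 != 0 by rewrite tofrac_eq0 denom_ratioP.
apply: (mulIf d0); rewrite mulfVK //.
rewrite -[LHS]/(FracField.mul _ _); unlock FracField.tofrac.
rewrite -FracField.pi_mul; apply/eqmodP; rewrite /= FracField.equivfE /FracField.mulf.
by rewrite !numden_Ratio ?mulf_neq0 ?oner_eq0 ?denom_ratioP // !mulr1 mulrC.
Qed.

Section Value.
Variables (F : fieldType) (N : nat).
Implicit Types (x : 'I_N -> F) (r s : {fraction {mpoly F[N]}}).

(** The value at [x] of a rational function, as a relation since the function
    need not be regular at [x]. *)
Definition value x r (c : F) : Prop :=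
  exists P Q : {mpoly F[N]},
    [/\ Q.@[x] != 0, r = tofrac P / tofrac Q & c = P.@[x] / Q.@[x]].

Lemma tofrac_neq0 x (Q : {mpoly F[N]}) : Q.@[x] != 0 -> tofrac Q != 0.
Proof. by rewrite tofrac_eq0; apply: contra => /eqP ->; rewrite meval0. Qed.

Lemma value_poly x P : value x (tofrac P) P.@[x].
Proof.
exists P, 1; rewrite meval1 tofrac1 !divr1.
by split; [exact: oner_neq0 | reflexivity | reflexivity].
Qed.

Lemma value_const x c : value x (tofrac c%:MP) c.
Proof. by have := value_poly x c%:MP; rewrite mevalC. Qed.

Lemma valueD x r s a b : value x r a -> value x s b -> value x (r + s) (a + b).
Proof.
move=> [P [Q [Q0 -> ->]]] [P' [Q' [Q'0 -> ->]]].
exists (P * Q' + P' * Q), (Q * Q').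
have [tQ tQ'] := (tofrac_neq0 Q0, tofrac_neq0 Q'0).
rewrite mevalM mevalD !mevalM tofracD !tofracM; split.
- exact: mulf_neq0.
- by rewrite (addf_div _ _ tQ tQ').
- by rewrite addf_div.
Qed.

Lemma valueM x r s a b : value x r a -> value x s b -> value x (r * s) (a * b).
Proof.
move=> [P [Q [Q0 -> ->]]] [P' [Q' [Q'0 -> ->]]].
exists (P * P'), (Q * Q').
rewrite !mevalM !tofracM; split; [exact: mulf_neq0 | exact: mulf_div | exact: mulf_div].
Qed.

Lemma valueN x r a : value x r a -> value x (- r) (- a).
Proof.
move=> [P [Q [Q0 -> ->]]]; exists (- P), Q; rewrite mevalN tofracN.
by split; [exact: Q0 | rewrite mulNr | rewrite mulNr].
Qed.

Lemma valueV x r a : a != 0 -> value x r a -> value x r^-1 a^-1.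
Proof.
move=> a0 [P [Q [Q0 -> e]]]; exists Q, P.
split; last by rewrite e invf_div.
  by apply: contra a0; rewrite e => /eqP ->; rewrite mul0r.
exact: invf_div.
Qed.

Lemma value1 x : value x 1 1.
Proof. by have := value_const x 1; rewrite tofrac1. Qed.

Lemma value0 x : value x 0 0.
Proof. by have := value_const x 0; rewrite tofrac0. Qed.

Lemma value_sum (I : Type) (l : seq I) (P : pred I) x (r : I -> {fraction {mpoly F[N]}}) c :
  (forall i, P i -> value x (r i) (c i)) ->
  value x (\sum_(i <- l | P i) r i) (\sum_(i <- l | P i) c i).
Proof.
by move=> H; apply: (big_ind2 (value x)) => //; [exact: value0 | move=> *; exact: valueD].
Qed.

Lemma value_prod (I : Type) (l : seq I) (P : pred I) x (r : I -> {fraction {mpoly F[N]}}) c :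
  (forall i, P i -> value x (r i) (c i)) ->
  value x (\prod_(i <- l | P i) r i) (\prod_(i <- l | P i) c i).
Proof.
by move=> H; apply: (big_ind2 (value x)) => //; [exact: value1 | move=> *; exact: valueM].
Qed.

Lemma valueX x r a k : value x r a -> value x (r ^+ k) (a ^+ k).
Proof.
move=> ra; elim: k => [|k IH]; first by rewrite !expr0; exact: value1.
by rewrite !exprS; exact: valueM.
Qed.

Lemma valueXz x r a (k : int) : a != 0 -> value x r a -> value x (r ^ k) (a ^ k).
Proof.
move=> a0 ra; case: k => k; first exact: valueX.
by rewrite /exprz; apply: valueV; [exact: expf_neq0 | exact: valueX].
Qed.

Lemma value_natr x k : value x k%:R k%:R.
Proof.
elim: k => [|k IH]; first exact: value0.
by rewrite !mulrSr; apply: valueD => //; exact: value1.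
Qed.

Lemma value_inj x r a b : value x r a -> value x r b -> a = b.
Proof.
move=> [P [Q [Q0 -> ->]]] [P' [Q' [Q'0 e ->]]].
have [tQ tQ'] := (tofrac_neq0 Q0, tofrac_neq0 Q'0).
have : P * Q' = P' * Q.
  apply/eqP; rewrite -tofrac_eq !tofracM.
  by move/eqP: e; rewrite (eqr_div _ _ tQ tQ').
by move=> E; apply/eqP; rewrite eqr_div // -!mevalM E.
Qed.

End Value.

Section Grassmannian.
Variables (F : fieldType) (p n : nat).
Implicit Types (z : 'M[F]_(p, n)).

Definition matrix_point z (i : 'I_#|{: 'I_p * 'I_n}|) : F :=
  z (enum_val i).1 (enum_val i).2.

Definition plucker_point z (i : 'I_#|{: incr p n}|) : F :=
  \det (colsub (sval (enum_val i)) z).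

Lemma meval_generic_mx z :
  map_mx (meval (matrix_point z)) (generic_mx p n F) = z.
Proof.
by apply/matrixP => a b; rewrite !mxE mevalXU /matrix_point enum_rankK.
Qed.

Lemma meval_pullback_poly z (P : SymW p n F) :
  (pullback_poly P).@[matrix_point z] = P.@[plucker_point z].
Proof.
rewrite [RHS]mevalE /pullback_poly /mmap rmorph_sum /=; apply: eq_bigr => m _.
rewrite rmorphM /= mevalC; congr (_ * _).
rewrite /mmap1 rmorph_prod /=; apply: eq_bigr => i _; rewrite rmorphXn /=.
congr (_ ^+ _); rewrite -det_map_mx /plucker_point; congr (\det _).
by rewrite map_mxsub /= meval_generic_mx.
Qed.

(** Restriction of polynomials to the Grassmannian is multiplicative, so that
    the quotient does not depend on the fraction chosen to represent q. *)
Lemma is_pullback_inj (q : RatP p n F) r r' :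
  is_pullback q r -> is_pullback q r' -> r = r'.
Proof.
move=> [P [Q [Q0 -> ->]]] [P' [Q' [Q'0 e ->]]].
have neq0 (S : SymW p n F) : pullback_poly S != 0 -> tofrac S != 0.
  by rewrite tofrac_eq0; apply: contra => /eqP ->; rewrite /pullback_poly mmap0.
have [tQ tQ'] := (neq0 _ Q0, neq0 _ Q'0).
have E : P * Q' = P' * Q.
  apply/eqP; rewrite -tofrac_eq !tofracM.
  by move/eqP: e; rewrite (eqr_div _ _ tQ tQ').
have pM (S S' : SymW p n F) : pullback_poly (S * S') = pullback_poly S * pullback_poly S'.
  exact: rmorphM.
have [pQ pQ'] : tofrac (pullback_poly Q) != 0 /\ tofrac (pullback_poly Q') != 0.
  by rewrite !tofrac_eq0.
by apply/eqP; rewrite (eqr_div _ _ pQ pQ') -!tofracM -!pM E.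
Qed.

Lemma value_pullback z (q : RatP p n F) c :
  value (plucker_point z) q c -> value (matrix_point z) (pullback q) c.
Proof.
move=> [P [Q [Q0 e ->]]].
pose r : RatG p n F := tofrac (pullback_poly P) / tofrac (pullback_poly Q).
have Qz : (pullback_poly Q).@[matrix_point z] != 0 by rewrite meval_pullback_poly.
have qr : is_pullback q r.
  exists P, Q; split; [|exact: e | reflexivity].
  by apply: contra Qz => /eqP ->; rewrite meval0.
have -> : pullback q = r.
  have Pq : is_pullback q (pullback q).
    by apply: (classical_sets.xgetPex 0 (P := is_pullback q)); exists r; exact: qr.
  exact: is_pullback_inj Pq qr.
exists (pullback_poly P), (pullback_poly Q); split; first exact: Qz.
  by rewrite /r.
by rewrite !meval_pullback_poly.
Qed.

(** By Cauchy-Binet, the pairing of the decomposable vectors given by z and by A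
    is a determinant. *)
Lemma value_linearP z (A : 'M[F]_(n, p)) :
  value (plucker_point z) (Plucker.linearP (wedge A)) (\det (z *m A)).
Proof.
rewrite det_mulmx_incr.
have -> : \sum_(s : incr p n) \det (colsub (sval s) z) * wedge A s
    = (\sum_(s : incr p n) wedge A s *: 'X_(enum_rank s)).@[plucker_point z].
  rewrite (linear_sum (meval (plucker_point z))) /=; apply: eq_bigr => s _.
  by rewrite mevalZ mevalXU /plucker_point enum_rankK mulrC.
exact: value_poly.
Qed.

(** The numerator, the denominator and the minors are non-zero polynomials in
    the entries of z, so that their product does not vanish at some point with
    entries of the given kind. At such a point r would have a non-zero value. *)
Lemma value_generic0 (f : nat -> F) (As : seq 'M[F]_(n, p)) (r : RatG p n F) :
  injective f ->
  (forall A, A \in As -> exists z : 'M_(p, n), \det (z *m A) != 0) ->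
  (forall z, (forall a b, exists t e : nat, z a b = f t ^+ e.+1) ->
     (forall A, A \in As -> \det (z *m A) != 0) ->
     value (matrix_point z) r 0) ->
  r = 0.
Proof.
move=> injf As0 H; apply/eqP/negPn/negP => r0.
have [P [Q [Q0 rE]]] := fraction_quotient r.
have P0 : P != 0 by apply: contra r0 => /eqP P0; rewrite rE P0 tofrac0 mul0r.
pose minor (A : 'M[F]_(n, p)) : PolG p n F :=
  \det (generic_mx p n F *m map_mx (@mpolyC _ F) A).
have minorE A z : (minor A).@[matrix_point z] = \det (z *m A).
  rewrite /minor -det_map_mx map_mxM /= meval_generic_mx -map_mx_comp.
  by congr (\det (_ *m _)); apply/matrixP => i j; rewrite mxE /= mevalC.
have As1 : \prod_(A <- As) minor A != 0.
  rewrite prodf_seq_neq0; apply/allP => A /As0 [z]; rewrite -minorE.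
  by apply: contra => /eqP ->; rewrite meval0.
have [x [xf]] := mpoly_neq0_eval injf (mulf_neq0 (mulf_neq0 P0 Q0) As1).
pose z : 'M[F]_(p, n) := \matrix_(a, b) x (enum_rank (a, b)).
have -> : x = matrix_point z.
  by apply: boolp.funext => i; rewrite /matrix_point mxE -surjective_pairing enum_valK.
rewrite !mevalM !mulf_eq0 !negb_or => /andP[/andP[Pz Qz]].
rewrite rmorph_prod /= prodf_seq_neq0 => /allP Asz.
have := H z _ _; case.
- by move=> a b; rewrite mxE; apply: xf.
- by move=> A /Asz; rewrite /= minorE.
move=> P' [Q' [Q'0 rE' e]].
have v : value (matrix_point z) r (P.@[matrix_point z] / Q.@[matrix_point z]).
  by exists P, Q; split; [exact: Qz | exact: rE | reflexivity].
have v0 : value (matrix_point z) r 0 by exists P', Q'; split; [exact: Q'0 | exact: rE' | exact: e].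
by have /eqP := value_inj v v0; rewrite mulf_eq0 invr_eq0 (negPf Pz) (negPf Qz).
Qed.

End Grassmannian.
End GrassmannEval.

(** * Convex sets along a line *)

Section Crossing.
Variables (R : realFieldType) (T : eqType) (a b : T -> R).

Definition affine_at (t : R) (i : T) : R := a i + t * b i.
Definition affine_root (i : T) : R := - a i / b i.
Definition is_pos (x : R) : R := ((0 < x)%R : nat)%:R.

Local Notation l := affine_at.
Local Notation tau := affine_root.

Lemma affine_increasing i s t : s < t -> l s i < 0 -> 0 < l t i -> 0 < b i.
Proof.
rewrite /l => st h1 h2; have : 0 < (t - s) * b i by lra.
by rewrite pmulr_rgt0 // subr_gt0.
Qed.

Lemma affine_decreasing i s t : s < t -> 0 < l s i -> l t i < 0 -> b i < 0.
Proof.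
rewrite /l => st h1 h2; have : (t - s) * b i < 0 by lra.
by rewrite pmulr_rlt0 // subr_gt0.
Qed.

Lemma affine_between i s t y : s <= y -> y <= t -> 0 < l s i -> 0 < l t i -> 0 < l y i.
Proof.
rewrite /l => sy yt h1 h2; have [b0|b0] := leP 0 (b i).
  have : s * b i <= y * b i by rewrite ler_wpM2r.
  lra.
have : t * b i <= y * b i by rewrite ler_wnM2r // ltW.
lra.
Qed.

Lemma affine_between_neg i s t y : s <= y -> y <= t -> l s i < 0 -> l t i < 0 -> l y i < 0.
Proof.
rewrite /l => sy yt h1 h2; have [b0|b0] := leP 0 (b i).
  have : y * b i <= t * b i by rewrite ler_wpM2r.
  lra.
have : y * b i <= s * b i by rewrite ler_wnM2r // ltW.
lra.
Qed.

Lemma affine_at_root i j : b i != 0 -> l (tau i) j * b i = a j * b i - a i * b j.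
Proof. by move=> bi; rewrite /l /tau; field. Qed.

Lemma root_between_incr i s t : s < t -> l s i < 0 -> 0 < l t i -> s < tau i < t.
Proof.
move=> st h1 h2; have b0 := affine_increasing st h1 h2.
move: h1 h2; rewrite /l /tau => h1 h2.
by rewrite ltr_pdivlMr // ltr_pdivrMr //; apply/andP; split; lra.
Qed.

Lemma root_between_decr i s t : s < t -> 0 < l s i -> l t i < 0 -> s < tau i < t.
Proof.
move=> st h1 h2; have b0 := affine_decreasing st h1 h2.
move: h1 h2; rewrite /l /tau => h1 h2.
by rewrite ltr_ndivlMr // ltr_ndivrMr //; apply/andP; split; lra.
Qed.

Definition jump s t i : R := is_pos (l t i) - is_pos (l s i).

Lemma pos_neg (x : R) : x != 0 -> (0 < x) \/ (x < 0).
Proof. by move=> x0; have [h|h|h] := ltgtP 0 x; [left | right | rewrite -h eqxx in x0]. Qed.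

Lemma is_posT (x : R) : 0 < x -> is_pos x = 1. Proof. by rewrite /is_pos => ->. Qed.
Lemma is_posF (x : R) : x < 0 -> is_pos x = 0.
Proof. by rewrite /is_pos => x0; rewrite ltNge ltW. Qed.

(** An affine function that crosses zero between [s] and [t] does so at its
    root, whose position relative to the root of [i0] can be read on either of
    the two functions. *)
Lemma jump_before_root i0 i s t : s < t -> l s i0 < 0 -> 0 < l t i0 ->
  l s i != 0 -> l t i != 0 -> a i0 * b i != a i * b i0 ->
  jump s t i * is_pos (l (tau i) i0) = jump (tau i0) t i.
Proof.
move=> st s0 t0 si ti gp.
have b0 := affine_increasing st s0 t0.
have /andP[sr rt] := root_between_incr st s0 t0.
have e0 := affine_at_root i (lt0r_neq0 b0).
have w0 : l (tau i0) i != 0.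
  apply: contraNneq gp => e; move: e0; rewrite e mul0r => /esym/eqP.
  by rewrite subr_eq0 eq_sym.
rewrite /jump.
case: (pos_neg si) (pos_neg ti) => hs [] ht; rewrite ?(is_posT hs) ?(is_posF hs) ?(is_posT ht) ?(is_posF ht).
- by rewrite subrr mul0r is_posT ?subrr // (affine_between (ltW sr) (ltW rt)).
- have bi := affine_decreasing st hs ht.
  have e1 := affine_at_root i0 (ltr0_neq0 bi).
  rewrite !sub0r mulN1r /is_pos -(nmulr_llt0 (l (tau i) i0) bi) e1.
  by rewrite -(pmulr_lgt0 (l (tau i0) i) b0) e0 subr_lt0 subr_gt0.
- have bi := affine_increasing st hs ht.
  have e1 := affine_at_root i0 (lt0r_neq0 bi).
  rewrite subr0 mul1r /is_pos -(pmulr_lgt0 (l (tau i) i0) bi) e1.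
  rewrite -(pmulr_lgt0 (l (tau i0) i) b0) e0 !subr_gt0.
  by have [h|h|h] := ltgtP (a i * b i0) (a i0 * b i); [rewrite subr0 | rewrite subrr | rewrite h eqxx in gp].
- by rewrite subrr mul0r is_posF ?subrr // (affine_between_neg (ltW sr) (ltW rt)).
Qed.

Lemma jump_after_root i0 i s t : s < t -> 0 < l s i0 -> l t i0 < 0 ->
  l s i != 0 -> l t i != 0 -> a i0 * b i != a i * b i0 ->
  jump s t i * is_pos (l (tau i) i0) = jump s (tau i0) i.
Proof.
move=> st s0 t0 si ti gp.
have b0 := affine_decreasing st s0 t0.
have /andP[sr rt] := root_between_decr st s0 t0.
have e0 := affine_at_root i (ltr0_neq0 b0).
have w0 : l (tau i0) i != 0.
  apply: contraNneq gp => e; move: e0; rewrite e mul0r => /esym/eqP.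
  by rewrite subr_eq0 eq_sym.
rewrite /jump.
case: (pos_neg si) (pos_neg ti) => hs [] ht; rewrite ?(is_posT hs) ?(is_posF hs) ?(is_posT ht) ?(is_posF ht).
- by rewrite subrr mul0r is_posT ?subrr // (affine_between (ltW sr) (ltW rt)).
- have bi := affine_decreasing st hs ht.
  have e1 := affine_at_root i0 (ltr0_neq0 bi).
  rewrite sub0r mulN1r /is_pos -(nmulr_llt0 (l (tau i) i0) bi) e1.
  rewrite -(nmulr_llt0 (l (tau i0) i) b0) e0 !subr_lt0.
  by have [h|h|h] := ltgtP (a i * b i0) (a i0 * b i); [rewrite subrr oppr0 | rewrite sub0r | rewrite h eqxx in gp].
- have bi := affine_increasing st hs ht.
  have e1 := affine_at_root i0 (lt0r_neq0 bi).
  rewrite !subr0 mul1r /is_pos -(pmulr_lgt0 (l (tau i) i0) bi) e1.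
  by rewrite -(nmulr_llt0 (l (tau i0) i) b0) e0 subr_lt0 subr_gt0.
- by rewrite subrr mul0r is_posF ?subrr // (affine_between_neg (ltW sr) (ltW rt)).
Qed.

(** The indicator of the convex set where all functions are positive jumps
    exactly where one of them vanishes while the others are positive. The proof
    adds the functions one at a time: if the new one changes sign, the formula
    for the others is used on the part of the segment where it is positive. *)
Lemma crossing_formula (r : seq T) s t : uniq r -> s < t ->
  (forall i, i \in r -> l s i != 0 /\ l t i != 0) ->
  (forall i j, i \in r -> j \in r -> i != j -> a i * b j != a j * b i) ->
  \prod_(i <- r) is_pos (l t i) - \prod_(i <- r) is_pos (l s i)
  = \sum_(i <- r) jump s t i * \prod_(j <- r | j != i) is_pos (l (tau i) j).
Proof.
elim: r s t => [|i0 r IH] s t; first by rewrite !big_nil subrr.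
rewrite cons_uniq => /andP[i0r ur] st nz gp.
have gpr i j : i \in r -> j \in r -> i != j -> a i * b j != a j * b i.
  by move=> ir jr ij; apply: gp; rewrite // inE ?ir ?jr orbT.
have gp0 i : i \in r -> a i0 * b i != a i * b i0.
  move=> ir; have i0i : i0 != i by apply: contraNneq i0r => ->.
  by apply: gp; rewrite // inE ?eqxx ?ir ?orbT.
have nzr i : i \in r -> l s i != 0 /\ l t i != 0.
  by move=> ir; apply: nz; rewrite inE ir orbT.
have [s0 t0] : l s i0 != 0 /\ l t i0 != 0 by apply: nz; rewrite inE eqxx.
have E i : i \in r -> \prod_(j <- i0 :: r | j != i) is_pos (l (tau i) j)
    = is_pos (l (tau i) i0) * \prod_(j <- r | j != i) is_pos (l (tau i) j).
  by move=> ir; rewrite big_cons; case: eqP => // e; rewrite e ir in i0r.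
have E0 : \prod_(j <- i0 :: r | j != i0) is_pos (l (tau i0) j)
    = \prod_(j <- r) is_pos (l (tau i0) j).
  rewrite big_cons eqxx /= big_seq_cond [RHS]big_seq_cond; apply: eq_bigl => j.
  rewrite andbT; case: (boolP (j \in r)) => //= jr.
  by apply: contraNneq i0r => <-.
have E1 : \sum_(i <- r) jump s t i * \prod_(j <- i0 :: r | j != i) is_pos (l (tau i) j)
    = \sum_(i <- r) jump s t i * is_pos (l (tau i) i0)
        * \prod_(j <- r | j != i) is_pos (l (tau i) j).
  by apply: eq_big_seq => i ir; rewrite (E i ir) mulrA.
rewrite [RHS]big_cons E0 E1 !(big_cons _ _ i0) /=.
have root_nz i : b i0 != 0 -> i \in r -> l (tau i0) i != 0.
  move=> b0 ir; apply: contraNneq (gp0 i ir) => e.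
  have := affine_at_root i b0; rewrite e mul0r => /esym/eqP.
  by rewrite subr_eq0 eq_sym.
case: (pos_neg s0) (pos_neg t0) => hs [] ht.
- rewrite (is_posT hs) (is_posT ht) !mul1r /jump (is_posT hs) (is_posT ht) subrr mul0r add0r.
  rewrite IH //; apply: eq_big_seq => i ir; have [si ti] := nzr i ir; congr (_ * _).
  rewrite /jump; case: (pos_neg si) (pos_neg ti) => hi [] ki;
    rewrite ?(is_posT hi) ?(is_posF hi) ?(is_posT ki) ?(is_posF ki) ?subrr ?mul0r //.
    have /andP[h1 h2] := root_between_decr st hi ki.
    by rewrite is_posT ?mulr1 // (affine_between (ltW h1) (ltW h2)).
  have /andP[h1 h2] := root_between_incr st hi ki.
  by rewrite is_posT ?mulr1 // (affine_between (ltW h1) (ltW h2)).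
- have b0 := affine_decreasing st hs ht.
  have /andP[sr rt] := root_between_decr st hs ht.
  rewrite {1}/jump (is_posT hs) (is_posF ht) mul0r mul1r !sub0r mulN1r.
  have := IH s (tau i0) ur sr _ gpr.
  have nz' i : i \in r -> l s i != 0 /\ l (tau i0) i != 0.
    by move=> ir; have [si _] := nzr i ir; split=> //; apply: root_nz; rewrite ?ltr0_neq0.
  move/(_ nz') => H.
  have -> : \sum_(i <- r) jump s t i * is_pos (l (tau i) i0)
        * \prod_(j <- r | j != i) is_pos (l (tau i) j)
      = \sum_(i <- r) jump s (tau i0) i * \prod_(j <- r | j != i) is_pos (l (tau i) j).
    apply: eq_big_seq => i ir; have [si ti] := nzr i ir.
    by rewrite (jump_after_root st hs ht si ti (gp0 i ir)).
  by rewrite -H; ring.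
- have b0 := affine_increasing st hs ht.
  have /andP[sr rt] := root_between_incr st hs ht.
  rewrite {1}/jump (is_posF hs) (is_posT ht) mul0r mul1r !subr0 mul1r.
  have := IH (tau i0) t ur rt _ gpr.
  have nz' i : i \in r -> l (tau i0) i != 0 /\ l t i != 0.
    by move=> ir; have [_ ti] := nzr i ir; split=> //; apply: root_nz; rewrite ?lt0r_neq0.
  move/(_ nz') => H.
  have -> : \sum_(i <- r) jump s t i * is_pos (l (tau i) i0)
        * \prod_(j <- r | j != i) is_pos (l (tau i) j)
      = \sum_(i <- r) jump (tau i0) t i * \prod_(j <- r | j != i) is_pos (l (tau i) j).
    apply: eq_big_seq => i ir; have [si ti] := nzr i ir.
    by rewrite (jump_before_root st hs ht si ti (gp0 i ir)).
  by rewrite -H; ring.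
- rewrite (is_posF hs) (is_posF ht) !mul0r /jump (is_posF hs) (is_posF ht) subrr mul0r add0r.
  rewrite big_seq big1 // => i ir; have [si ti] := nzr i ir.
  case: (pos_neg si) (pos_neg ti) => hi [] ki;
    rewrite ?(is_posT hi) ?(is_posF hi) ?(is_posT ki) ?(is_posF ki) ?subrr ?mul0r //.
    have /andP[h1 h2] := root_between_decr st hi ki.
    by rewrite is_posF ?mulr0 ?mul0r // (affine_between_neg (ltW h1) (ltW h2)).
  have /andP[h1 h2] := root_between_incr st hi ki.
  by rewrite is_posF ?mulr0 ?mul0r // (affine_between_neg (ltW h1) (ltW h2)).
Qed.

End Crossing.

(** * Truncated power series and Todd series *)

Section TruncatedSeries.
Variable F : numFieldType.
Implicit Types (P Q U : {poly F}) (M : nat).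

(** Congruence modulo [X ^ M]: polynomials stand for truncated power series. *)
Definition eqm M P Q : Prop := forall k, (k < M)%N -> P`_k = Q`_k.

Lemma eqm_refl M P : eqm M P P. Proof. by []. Qed.

Lemma eqm_sym M P Q : eqm M P Q -> eqm M Q P.
Proof. by move=> e k kM; rewrite e. Qed.

Lemma eqm_trans M P Q S : eqm M P Q -> eqm M Q S -> eqm M P S.
Proof. by move=> e e' k kM; rewrite e ?e'. Qed.

Lemma eqmD M P Q P' Q' : eqm M P Q -> eqm M P' Q' -> eqm M (P + P') (Q + Q').
Proof. by move=> e e' k kM; rewrite !coefD e ?e'. Qed.

Lemma eqmN M P Q : eqm M P Q -> eqm M (- P) (- Q).
Proof. by move=> e k kM; rewrite !coefN e. Qed.

Lemma eqmB M P Q P' Q' : eqm M P Q -> eqm M P' Q' -> eqm M (P - P') (Q - Q').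
Proof. by move=> e e'; apply: eqmD => //; exact: eqmN. Qed.

Lemma eqmM M P Q P' Q' : eqm M P Q -> eqm M P' Q' -> eqm M (P * P') (Q * Q').
Proof.
move=> e e' k kM; rewrite !coefM; apply: eq_bigr => i _.
by rewrite e ?e' //; apply: leq_ltn_trans kM; rewrite ?leq_subr // -ltnS.
Qed.

Lemma eqm_sum M (T : Type) (r : seq T) (p : pred T) (f g : T -> {poly F}) :
  (forall i, p i -> eqm M (f i) (g i)) ->
  eqm M (\sum_(i <- r | p i) f i) (\sum_(i <- r | p i) g i).
Proof. by move=> H; apply: (big_ind2 (eqm M)) => // *; exact: eqmD. Qed.

Lemma eqm_prod M (T : Type) (r : seq T) (p : pred T) (f g : T -> {poly F}) :
  (forall i, p i -> eqm M (f i) (g i)) ->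
  eqm M (\prod_(i <- r | p i) f i) (\prod_(i <- r | p i) g i).
Proof. by move=> H; apply: (big_ind2 (eqm M)) => // *; exact: eqmM. Qed.

Lemma eqmX M P Q k : eqm M P Q -> eqm M (P ^+ k) (Q ^+ k).
Proof.
by move=> e; elim: k => [|k IH]; rewrite ?expr0 // !exprS; exact: eqmM.
Qed.

Lemma eqm_eq P Q : (forall M, eqm M P Q) -> P = Q.
Proof. by move=> H; apply/polyP => k; apply: (H k.+1). Qed.

(** A power series of order one can be cancelled at the price of one order of
    precision. *)
Lemma eqm_cancel U P M : U`_0 = 0 -> U`_1 != 0 -> eqm M.+1 (U * P) 0 -> eqm M P 0.
Proof.
move=> U0 U1 H k; elim/ltn_ind: k => k IH kM; rewrite coef0.
have := H k.+1 kM; rewrite coefM coef0 big_ord_recl U0 mul0r add0r.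
rewrite big_ord_recl /= big1 ?addr0 => [|i _].
  by rewrite /bump /= !addn0 subSS subn0 => /eqP; rewrite mulf_eq0 (negPf U1) => /eqP.
rewrite /bump /= !add1n subSS IH ?coef0 ?mulr0 //; last by rewrite (leq_ltn_trans (leq_subr _ _)).
by case: k kM {IH} i => [|k] kM [i ik] //=; rewrite ltnS subSS leq_subr.
Qed.

Lemma eqm_cancelX U P M k : U`_0 = 0 -> U`_1 != 0 ->
  eqm (M + k) (U ^+ k * P) 0 -> eqm M P 0.
Proof.
move=> U0 U1; elim: k P => [|k IH] P; first by rewrite addn0 expr0 mul1r.
rewrite addnS exprS -mulrA => /(eqm_cancel U0 U1); exact: IH.
Qed.

Variable M : nat.

(** The truncation of [exp (c X)]. *)
Definition expp (c : F) : {poly F} := \poly_(l < M) (c ^+ l / l`!%:R).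

Lemma coef_expp c k : (k < M)%N -> (expp c)`_k = c ^+ k / k`!%:R.
Proof. by move=> kM; rewrite coef_poly kM. Qed.

Lemma fact_neq0 k : k`!%:R != 0 :> F.
Proof. by rewrite pnatr_eq0 -lt0n fact_gt0. Qed.

Lemma exppD c c' : eqm M (expp c * expp c') (expp (c + c')).
Proof.
move=> k kM; rewrite coefM coef_expp // addrC exprDn mulr_suml; apply: eq_bigr => i _.
have ik : (i <= k)%N by rewrite -ltnS.
rewrite !coef_expp ?(leq_ltn_trans _ kM) ?leq_subr //.
have e : ('C(k, i) * (i`! * (k - i)`!) = k`!)%N by exact: bin_fact.
rewrite -[_ *+ 'C(k, i)]mulr_natr.
have -> : 'C(k, i)%:R = k`!%:R / (i`!%:R * (k - i)`!%:R) :> F.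
  by rewrite -e !natrM mulfK // mulf_neq0 // fact_neq0.
by field; rewrite !fact_neq0.
Qed.

Lemma expp0 : eqm M (expp 0) 1.
Proof.
move=> k kM; rewrite coef_expp // coef1 expr0n.
by case: k kM => [|k] _ /=; rewrite ?fact0 ?divr1 ?mul0r.
Qed.

Lemma exppX k : eqm M (expp 1 ^+ k) (expp k%:R).
Proof.
elim: k => [|k IH]; first by rewrite expr0; apply: eqm_sym; exact: expp0.
rewrite exprSr -natr1; apply: eqm_trans (exppD _ _); exact: eqmM.
Qed.

Variables (b : F -> nat -> F).
Hypothesis bP : forall c k,
  \sum_(l < k.+1) ((l == 0%N :> nat)%:R - c * (-1) ^+ l / l`!%:R) * b c (k - l)%N = (k == 1%N)%:R.

(** The truncation of [a X / (1 - c exp (- a X))]. *)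
Definition todd (c a : F) : {poly F} := \poly_(l < M) (b c l * a ^+ l).

(** The hypothesis on b is the recursion that defines the Taylor coefficients of
    the quotient. *)
Lemma todd_eq c a : eqm M ((1 - c *: expp (- a)) * todd c a) (a *: 'X).
Proof.
move=> k kM; rewrite coefM coefZ coefX.
transitivity (a ^+ k * (k == 1%N)%:R); last by case: eqP => [->|]; rewrite ?mulr0.
rewrite -(bP c k) mulr_sumr; apply: eq_bigr => l _.
have lk : (l <= k)%N by rewrite -ltnS.
rewrite coefB coef1 coefZ coef_expp ?(leq_ltn_trans _ kM) // coef_poly.
rewrite (leq_ltn_trans (leq_subr _ _) kM) [(- a) ^+ l]exprNn.
have -> : a ^+ k = a ^+ l * a ^+ (k - l) by rewrite -exprD subnKC.
have E : ((l == 0%N :> nat)%:R : F) = a ^+ l * (l == 0%N :> nat)%:R.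
  by case: (nat_of_ord l) => [|l']; rewrite ?expr0 ?mul1r //= mulr0.
rewrite {1}E; move: (a ^+ l) (a ^+ (k - l)) ((-1) ^+ l) => x y z.
by ring.
Qed.

End TruncatedSeries.

Section Geometric.
Variable F : numFieldType.

(** Signed truncated generating function of one coordinate of a cone: for
    [0 < a] the coordinate runs over the positive integers, with sign [-1],
    for [a < 0] over the non-positive ones; [r] is its absolute value. *)
Definition ray_range (a : int) (L : nat) (r : nat) : bool :=
  if 0 < a then (0 < r <= L)%N else (r < L)%N.
Definition ray_coef (a : int) (c : F) (r : nat) : F :=
  if 0 < a then - (c ^- r) else c ^+ r.
Definition ray_sum (Z : nat) (a : int) (c : F) (L : nat) : {poly F} :=
  \sum_(r < Z | ray_range a L r) ray_coef a c r *: 'X^(`|a|%N * r).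

Definition ray_den (a : int) (c : F) : {poly F} :=
  if 0 < a then 'X^`|a|%N - c%:P else 1 - c *: 'X^`|a|%N.
Definition ray_num (a : int) : {poly F} := if 0 < a then 'X^`|a|%N else 1.

(** A geometric series whose ratio is c or its inverse times a power of the
    variable; since c is a root of unity of order dividing L, its end term does
    not involve c. *)
Lemma ray_sumE Z a c L : c != 0 -> c ^+ L = 1 -> (L < Z)%N ->
  ray_sum Z a c L * ray_den a c = (1 - 'X^(`|a|%N * L)) * ray_num a.
Proof.
move=> c0 cL LZ; rewrite /ray_sum /ray_range /ray_coef /ray_den /ray_num.
case: ifP => _; last first.
  have -> : \sum_(r < Z | (r < L)%N) c ^+ r *: 'X^(`|a| * r) = \sum_(r < L) (c *: 'X^`|a|) ^+ r :> {poly F}.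
    rewrite (big_ord_narrow (ltnW LZ)) /=; apply: eq_bigr => r _.
    by rewrite exprZn exprM.
  rewrite mulr1 mulrC -opprB mulNr -subrX1 opprB.
  by rewrite exprZn cL scale1r exprM.
case: Z LZ => // Z LZ; rewrite big_mkcond big_ord_recl /= add0r -big_mkcond /=.
have -> : \sum_(i < Z | (0 < bump 0 i <= L)%N) - c ^- bump 0 i *: 'X^(`|a| * bump 0 i)
   = - ((c^-1 *: 'X^`|a|) * \sum_(r < L) (c^-1 *: 'X^`|a|) ^+ r) :> {poly F}.
  rewrite (big_ord_narrow (LZ : (L <= Z)%N)) mulr_sumr -sumrN; apply: eq_bigr => r _ /=.
  by rewrite -exprS exprZn -exprM scaleNr exprVn.
set w := c^-1 *: _; have -> : 'X^`|a| - c%:P = c *: (w - 1).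
  by rewrite scalerBr scalerA divff // scale1r -mul_polyC mulr1.
have -> : 'X^`|a| = c *: w by rewrite scalerA divff // scale1r.
rewrite -scalerAr mulNr -mulrA [(\sum_(r < L) _) * _]mulrC -subrX1.
rewrite -scalerAr; have -> : 'X^(`|a| * L) = w ^+ L.
  by rewrite /w exprZn exprVn cL invr1 scale1r exprM.
by congr (_ *: _); ring.
Qed.

End Geometric.

Section RayEvaluation.
Variables (F : numFieldType) (M : nat) (b : F -> nat -> F).
Hypothesis bP : forall c k,
  \sum_(l < k.+1) ((l == 0%N :> nat)%:R - c * (-1) ^+ l / l`!%:R) * b c (k - l)%N = (k == 1%N)%:R.

Lemma comp_expp1 (P Q : {poly F}) : P = Q -> P \Po expp M (1 : F) = Q \Po expp M (1 : F).
Proof. by move=> ->. Qed.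

(** Substituting [exp X] for the variable turns the generating function of a
    ray, up to the common factor [1 - exp (A X)], into the Todd series. *)
Lemma ray_eval Z (a : int) (c : F) L A : a != 0 -> c != 0 -> c ^+ L = 1 -> (L < Z)%N ->
  (`|a| * L = A)%N ->
  eqm M ((ray_sum Z a c L \Po expp M (1 : F)) * (a%:~R *: 'X))
        ((1 - expp M A%:R) * todd M b c a%:~R).
Proof.
move=> a0 c0 cL LZ aL.
pose P := ray_sum Z a c L \Po expp M (1 : F).
suff H : eqm M (P * (1 - c *: expp M (- a%:~R))) (1 - expp M A%:R).
  have H' := eqmM H (@eqm_refl F M (todd M b c a%:~R)).
  apply: (eqm_trans _ H'); rewrite -mulrA.
  by apply: eqmM => //; apply: eqm_sym; apply: todd_eq.
have := comp_expp1 (ray_sumE a c0 cL LZ); rewrite comp_polyM -/P aL => e.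
have XE k : eqm M ('X^k \Po expp M (1 : F)) (expp M k%:R).
  by rewrite comp_Xn_poly; exact: exppX.
move: e; rewrite /ray_den /ray_num; case: ifP => [ap|/negbT an]; last first.
  have aE : (`|a|%N%:R : F) = - a%:~R.
    by rewrite pmulrn lez0_abs ?leNgt // rmorphN.
  rewrite comp_polyM !comp_polyB comp_polyZ -polyC1 !comp_polyC polyC1 mulr1 => e.
  apply: (@eqm_trans _ _ _ (P * (1 - c *: ('X^`|a| \Po expp M (1 : F))))).
    apply: eqmM => //; apply: eqmB => // k kM; rewrite !coefZ; congr (_ * _).
    by rewrite XE // aE.
  by rewrite e; apply: eqmB.
have aE : (`|a|%N%:R : F) = a%:~R by rewrite pmulrn gez0_abs // ltW.
rewrite comp_polyM !comp_polyB -polyC1 !comp_polyC polyC1 => e.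
have E1 : eqm M (('X^`|a| \Po expp M (1 : F)) * expp M (- a%:~R)) 1.
  apply: eqm_trans (eqmM (XE _) (@eqm_refl F M _)) _; rewrite aE.
  by apply: eqm_trans (exppD _ _) _; rewrite subrr; exact: expp0.
have := congr1 (fun S => S * expp M (- a%:~R)) e; rewrite /= -!mulrA mulrBl => e'.
apply: (@eqm_trans _ _ _ (P * (('X^`|a| \Po expp M (1 : F)) * expp M (- a%:~R)
    - c%:P * expp M (- a%:~R)))).
  by apply: eqmM => //; rewrite mul_polyC; apply: eqmB => //; exact: eqm_sym.
rewrite e' -[X in eqm M _ X]mulr1; apply: eqmM => //.
by apply: eqmB.
Qed.

End RayEvaluation.

(** * Interpolation by squarefree products of linear forms *)

Section Interpolation.
Variables (F : fieldType) (V : finType) (p k : nat).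
Variables (w : V -> 'cV[F]_p) (I : {set V}).
Implicit Types (J : {set V}) (y : 'rV[F]_p).

Definition form i y : F := (y *m w i) 0 0.

Hypothesis sizeI : (k + p)%N = #|I|.+1.
Hypothesis general_position : forall s : 'I_p -> V, injective s -> (forall t, s t \in I) ->
  (\matrix_(a, t) w (s t) a 0) \in unitmx.

(** The complement of J in I has at least p elements, and any p forms are a
    basis of the dual of the p-dimensional space. *)
Lemma form_dependence i J : J \subset I -> (#|J| < k)%N -> exists (s : 'I_p -> V) (c : 'I_p -> F),
  (forall t, s t \in I :\: J) /\ forall y, form i y = \sum_t c t * form (s t) y.
Proof.
move=> JI Jk; have pJ : (p <= #|I :\: J|)%N.
  by rewrite cardsD (setIidPr JI); lia.
pose s (t : 'I_p) := enum_val (widen_ord pJ t).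
have sI t : s t \in I :\: J by apply: enum_valP.
have s_inj : injective s.
  by move=> t t' /enum_val_inj /(congr1 val) /= e; apply: val_inj.
have uW : (\matrix_(a, t) w (s t) a 0) \in unitmx.
  by apply: general_position => // t; have := sI t; rewrite inE => /andP[].
set W := \matrix_(a, t) _ in uW.
exists s, (fun t => (invmx W *m w i) t 0); split=> // y.
transitivity ((y *m W *m (invmx W *m w i)) 0 0).
  by rewrite /form -mulmxA mulKVmx.
rewrite mxE; apply: eq_bigr => t _; rewrite mulrC; congr (_ * _).
by rewrite /form !mxE; apply: eq_bigr => a _; rewrite !mxE.
Qed.

Definition squarefree_span l (f : 'rV[F]_p -> F) : Prop := exists c : {set V} -> F,
  forall y, f y = \sum_(J : {set V} | (J \subset I) && (#|J| == l)) c J * \prod_(j in J) form j y.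

Lemma squarefree_span_ext l f f' : f =1 f' -> squarefree_span l f' -> squarefree_span l f.
Proof. by move=> e [c Hc]; exists c => y; rewrite e. Qed.

Lemma squarefree_spanZ l a f : squarefree_span l f -> squarefree_span l (fun y => a * f y).
Proof.
move=> [c Hc]; exists (fun J => a * c J) => y; rewrite Hc mulr_sumr.
by apply: eq_bigr => J _; rewrite mulrA.
Qed.

Lemma squarefree_span_sum l (T : finType) (P : pred T) (f : T -> 'rV[F]_p -> F) :
  (forall t, P t -> squarefree_span l (f t)) -> squarefree_span l (fun y => \sum_(t | P t) f t y).
Proof.
move=> H; have [c Hc] : exists c : T -> {set V} -> F, forall t, P t -> forall y,
    f t y = \sum_(J : {set V} | (J \subset I) && (#|J| == l)) c t J * \prod_(j in J) form j y.
  apply: (@fin_all_exists _ (fun=> {set V} -> F) (fun t c => P t -> forall y, f t y =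
    \sum_(J : {set V} | (J \subset I) && (#|J| == l)) c J * \prod_(j in J) form j y)) => t.
  by have [/H [c Hc]|Pt] := boolP (P t); [exists c|exists (fun=> 0)].
exists (fun J => \sum_(t | P t) c t J) => y.
under eq_bigr => t Pt do rewrite Hc //.
by rewrite exchange_big; apply: eq_bigr => J _; rewrite mulr_suml.
Qed.

Lemma squarefree_span_prod J : J \subset I ->
  squarefree_span #|J| (fun y => \prod_(j in J) form j y).
Proof.
move=> JI; exists (fun J' => (J' == J)%:R) => y.
rewrite (bigD1 J) ?JI ?eqxx //= mul1r [X in _ = _ + X]big1 ?addr0 // => J' /andP[_ /negPf ->].
by rewrite mul0r.
Qed.

(** If the new factor already occurs, it is first written as a combination of p
    forms that do not occur. *)
Lemma squarefree_span_mul l i f : (l < k)%N -> i \in I ->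
  squarefree_span l f -> squarefree_span l.+1 (fun y => form i y * f y).
Proof.
move=> lk iI [c Hc]; apply: (@squarefree_span_ext _ _ (fun y =>
   \sum_(J : {set V} | (J \subset I) && (#|J| == l)) c J * (form i y * \prod_(j in J) form j y))).
  by move=> y; rewrite Hc mulr_sumr; apply: eq_bigr => J _; rewrite mulrCA.
apply: squarefree_span_sum => J /andP[JI /eqP Jl]; apply: squarefree_spanZ.
have [s [g [sI Hs]]] : exists (s : 'I_p -> V) (c : 'I_p -> F),
  (forall t, s t \in I :\: J) /\ forall y, form i y = \sum_t c t * form (s t) y.
  by apply: form_dependence; rewrite ?Jl.
apply: (@squarefree_span_ext _ _ (fun y =>
   \sum_t g t * \prod_(j in s t |: J) form j y)).
  move=> y; rewrite Hs mulr_suml; apply: eq_bigr => t _.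
  by rewrite big_setU1 ?mulrA //=; have := sI t; rewrite inE => /andP[].
apply: squarefree_span_sum => t _; apply: squarefree_spanZ.
have := sI t; rewrite inE => /andP[nJ tI].
have <- : #|s t |: J| = l.+1 by rewrite cardsU1 nJ Jl.
by apply: squarefree_span_prod; rewrite subUset sub1set tI.
Qed.

Lemma squarefree_span_monomial (e : V -> nat) (s : seq V) :
  {subset s <= I} -> (\sum_(i <- s) e i <= k)%N ->
  squarefree_span (\sum_(i <- s) e i) (fun y => \prod_(i <- s) form i y ^+ e i).
Proof.
elim: s => [|i s IH] sI.
  move=> _; rewrite big_nil; have := squarefree_span_prod (sub0set I); rewrite cards0.
  by apply: squarefree_span_ext => y; rewrite big_nil big_set0.
rewrite big_cons => H.
have iI : i \in I by apply: sI; rewrite mem_head.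
have {}IH : squarefree_span (\sum_(j <- s) e j) (fun y => \prod_(j <- s) form j y ^+ e j).
  by apply: IH => [j js|]; [apply: sI; rewrite inE js orbT|lia].
move: (\sum_(j <- s) e j)%N H IH => l H IH.
apply: (@squarefree_span_ext _ _ (fun y => form i y ^+ e i * \prod_(j <- s) form j y ^+ e j)).
  by move=> y; rewrite big_cons.
elim: (e i) H => [|r IHr] H.
  by apply: squarefree_span_ext IH => y; rewrite expr0 mul1r.
apply: (@squarefree_span_ext _ _ (fun y => form i y * (form i y ^+ r * \prod_(j <- s) form j y ^+ e j))).
  by move=> y; rewrite exprS mulrA.
by rewrite addSn; apply: squarefree_span_mul => //; apply: IHr; lia.
Qed.

Variable pt : {set V} -> 'rV[F]_p.
Hypothesis pt0 : forall J i, J \subset I -> #|J| = k -> i \in I :\: J -> form i (pt J) = 0.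
Hypothesis ptn : forall J i, J \subset I -> #|J| = k -> i \in J -> form i (pt J) != 0.

(** The coefficients of a monomial on the squarefree products are found by
    evaluation at the points pt J, at which all squarefree products but one
    vanish. *)
Lemma squarefree_interpolation (e : V -> nat) y : (\sum_(i in I) e i)%N = k ->
  \prod_(i in I) form i y ^+ e i =
  \sum_(J : {set V} | (J \subset I) && (#|J| == k))
    (if [forall i in I :\: J, e i == 0%N] then \prod_(j in J) form j (pt J) ^ ((e j)%:Z - 1) else 0)
    * \prod_(j in J) form j y.
Proof.
move=> ek.
have : squarefree_span k (fun y => \prod_(i in I) form i y ^+ e i).
  apply: (@squarefree_span_ext _ _ (fun y => \prod_(i <- enum I) form i y ^+ e i)).
    by move=> x; rewrite big_enum.
  rewrite -ek -[X in squarefree_span X]big_enum; apply: squarefree_span_monomial.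
    by move=> i; rewrite mem_enum.
  by rewrite big_enum ek.
move=> [c Hc]; rewrite Hc; apply: eq_bigr => J /andP[JI /eqP Jk]; congr (_ * _).
have := Hc (pt J); rewrite (bigD1 J) ?JI ?Jk ?eqxx //= [X in _ = _ + X]big1 ?addr0; last first.
  move=> J' /andP[/andP[J'I /eqP J'k] J'J].
  have [j jJ' jJ] : exists2 j, j \in J' & j \notin J.
    apply/subsetPn; apply: contra J'J => J'J; rewrite eqEcard J'J.
    by rewrite Jk J'k leqnn.
  rewrite (bigD1 j) //= pt0 ?mul0r ?mulr0 // inE jJ /=.
  exact: (subsetP J'I).
have nz : \prod_(j in J) form j (pt J) != 0.
  by apply/prodf_neq0 => j jJ; exact: ptn.
move=> E; apply: (mulIf nz); rewrite -E.
rewrite (big_setID J) /= (setIidPr JI).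
case: ifP => [/forall_inP H|/negbT].
  rewrite [X in _ * X]big1 ?mulr1; last by move=> i iIJ; rewrite (eqP (H i iIJ)) expr0.
  rewrite -big_split /=; apply: eq_bigr => j jJ.
  by rewrite -[X in _ = _ * X]expr1z -expfzDr ?ptn // subrK.
rewrite negb_forall_in => /exists_inP [i iIJ ei].
by rewrite [X in _ * X](bigD1 i) //= pt0 // expr0n (negPf ei) !(mul0r, mulr0).
Qed.

End Interpolation.

Lemma coef_prod_set (F : numFieldType) (V : finType) (I : {set V}) (k : nat) (P : V -> {poly F}) :
  (\prod_(i in I) P i)`_k = \sum_(e : {ffun V -> 'I_k.+1} |
      [forall i, (i \notin I) ==> (e i == 0%N :> nat)] && (\sum_(i in I) e i == k)%N)
    \prod_(i in I) (P i)`_(e i).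
Proof.
pose Q i : {poly F} := \sum_(l < k.+1) (P i)`_l *: 'X^l.
have -> : (\prod_(i in I) P i)`_k = (\prod_(i in I) Q i)`_k.
  have : eqm k.+1 (\prod_(i in I) P i) (\prod_(i in I) Q i).
    apply: eqm_prod => i _ j jk; rewrite /Q coef_sum (bigD1 (Ordinal jk)) //= coefZ coefXn eqxx mulr1.
    rewrite big1 ?addr0 // => l lj; rewrite coefZ coefXn.
    by rewrite (_ : (j == l) = false) ?mulr0 //; apply/negbTE; rewrite eq_sym.
  by apply.
rewrite /Q (big_distr_big_dep ord0) /= coef_sum big_mkcondr /=.
under [RHS]eq_bigl => e.
  have -> : [forall i, (i \notin I) ==> (e i == 0%N :> nat)] = (e \in pfamily ord0 (mem I) (fun=> predT)).
    apply/forallP/pfamilyP => [H|[/supportP H _] i].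
      split=> // ; apply/supportP => i iI; apply: val_inj; apply/eqP.
      exact: (implyP (H i)).
    by apply/implyP => iI; rewrite (H i iI).
  over.
apply: eq_bigr => e _.
under eq_bigr do rewrite -mul_polyC.
rewrite big_split /= -rmorph_prod prodrXr coefCM coefXn.
by rewrite eq_sym; case: eqP => _; rewrite ?mulr1 ?mulr0.
Qed.

From mathcomp Require Import complex finmap.
From mathcomp Require Import all_classical all_reals all_analysis.
From mathcomp Require Import measurable_realfun measurable_fun_approximation.

Import numFieldTopology.Exports numFieldNormedType.Exports.

Local Open Scope classical_set_scope.
Local Open Scope ring_scope.

(** * The pairing and Weyl's theorem *)

Section Pairing.
Variables (F : comPzRingType) (n : nat).
Implicit Types (u w : 'cV[F]_n) (x y : 'rV[F]_n).

Lemma pairingE u x : pairing u x = \sum_j x 0 j * u j 0.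
Proof. by rewrite /pairing mxE. Qed.

Lemma pairingDr u x y : pairing u (x + y) = pairing u x + pairing u y.
Proof. by rewrite /pairing mulmxDl mxE. Qed.

Lemma pairingBr u x y : pairing u (x - y) = pairing u x - pairing u y.
Proof. by rewrite /pairing mulmxBl !mxE. Qed.

Lemma pairingNr u x : pairing u (- x) = - pairing u x.
Proof. by rewrite /pairing mulNmx mxE. Qed.

Lemma pairingZr u x a : pairing u (a *: x) = a * pairing u x.
Proof. by rewrite /pairing -scalemxAl mxE. Qed.

Lemma pairingDl u w x : pairing (u + w) x = pairing u x + pairing w x.
Proof. by rewrite /pairing mulmxDr mxE. Qed.

Lemma pairingBl u w x : pairing (u - w) x = pairing u x - pairing w x.
Proof. by rewrite /pairing mulmxBr !mxE. Qed.

Lemma pairingNl u x : pairing (- u) x = - pairing u x.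
Proof. by rewrite /pairing mulmxN mxE. Qed.

Lemma pairingZl u x a : pairing (a *: u) x = a * pairing u x.
Proof. by rewrite /pairing -scalemxAr mxE. Qed.

Lemma pairing0l x : pairing 0 x = 0.
Proof. by rewrite /pairing mulmx0 mxE. Qed.

Lemma pairing0r u : pairing u 0 = 0.
Proof. by rewrite /pairing mul0mx mxE. Qed.

Lemma pairing_sumr (I : Type) (r : seq I) (P : pred I) u (x : I -> 'rV[F]_n) :
  pairing u (\sum_(i <- r | P i) x i) = \sum_(i <- r | P i) pairing u (x i).
Proof. by apply: (big_morph (pairing u)); [exact: pairingDr | exact: pairing0r]. Qed.

Lemma pairing_suml (I : Type) (r : seq I) (P : pred I) (u : I -> 'cV[F]_n) x :
  pairing (\sum_(i <- r | P i) u i) x = \sum_(i <- r | P i) pairing (u i) x.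
Proof.
by apply: (big_morph (fun u => pairing u x)); [move=> a b; exact: pairingDl | exact: pairing0l].
Qed.

Lemma pairing_delta u i : pairing u (delta_mx 0 i) = u i 0.
Proof.
by rewrite /pairing -rowE mxE.
Qed.

Lemma pairing_inj u w : (forall x, pairing u x = pairing w x) -> u = w.
Proof.
by move=> e; apply/colP => i; rewrite -!pairing_delta e.
Qed.

Lemma pairing_map (K : comPzRingType) (f : {rmorphism F -> K}) u x :
  pairing (map_mx f u) (map_mx f x) = f (pairing u x).
Proof. by rewrite /pairing -map_mxM mxE. Qed.

End Pairing.

Lemma pairing_ofZ (F : comPzRingType) (n : nat) (u : 'cV[int]_n) (x : 'rV[int]_n) :
  pairing (ofZ F u) (ofZ F x) = (pairing u x)%:~R.
Proof. exact: pairing_map. Qed.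

Lemma ofZ_ratr (F : numFieldType) (m n : nat) (x : 'M[int]_(m, n)) :
  map_mx (ratr : rat -> F) (ofZ rat x) = ofZ F x.
Proof. by apply/matrixP => i j; rewrite !mxE ratr_int. Qed.

Lemma pairing_ratr (F : numFieldType) (n : nat) (u : 'cV[rat]_n) (x : 'rV[int]_n) :
  pairing (map_mx ratr u) (ofZ F x) = ratr (pairing u (ofZ rat x)).
Proof. by rewrite -ofZ_ratr pairing_map. Qed.

Section Weyl.
Variables (R : realFieldType) (n : nat).
Implicit Types (s : seq 'rV[R]_n) (U : seq 'cV[R]_n).

(** Fourier-Motzkin elimination of t: an upper bound for t comes from each form
    that is positive at a, a lower bound from each form that is negative at a,
    and a solution exists when every lower bound is below every upper bound. *)
Lemma halfspaces_projection U (a : 'rV[R]_n) : exists U', forall x,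
  (exists2 t, 0 <= t & forall u, u \in U -> 0 <= pairing u (x - t *: a)) <->
  (forall u, u \in U' -> 0 <= pairing u x).
Proof.
pose nonneg := [seq u <- U | 0 <= pairing u a].
pose neg := [seq u <- U | pairing u a < 0].
exists (nonneg ++ [seq pairing u a *: w - pairing w a *: u | u <- nonneg, w <- neg]).
move=> x; split=> [[t t0 H] u|H].
  have nonnegP w : w \in nonneg -> 0 <= pairing w x.
    rewrite mem_filter => /andP[wa /H]; rewrite pairingBr pairingZr subr_ge0.
    by apply: le_trans; rewrite mulr_ge0.
  rewrite mem_cat => /orP[/nonnegP //|/allpairsP[[w1 w2] /= [w1P]]].
  rewrite mem_filter => /andP[w2a /H w2t] ->; move: w2t.
  have := w1P; rewrite mem_filter => /andP[w1a /H].
  rewrite pairingBl !pairingZl !pairingBr !pairingZr => h1 h2.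
  set p := pairing _ _ in w1a h1 *; set q := pairing _ _ in w2a h2 *.
  have -> : p * pairing w2 x - q * pairing w1 x
      = p * (pairing w2 x - t * q) + (- q) * (pairing w1 x - t * p) by ring.
  by rewrite addr_ge0 // mulr_ge0 // oppr_ge0 ltW.
pose t := \big[Num.max/0]_(w <- neg) (pairing w x / pairing w a).
have Hn u : u \in nonneg -> 0 <= pairing u x by move=> uP; apply: H; rewrite mem_cat uP.
exists t; first exact: bigmax_ge_id.
move=> u uU; rewrite pairingBr pairingZr subr_ge0.
have [ua|ua] := ltP (pairing u a) 0.
  rewrite -ler_ndivrMr //.
  apply: (@le_bigmax_seq _ _ _ neg 0 u xpredT (fun w => pairing w x / pairing w a)) => //.
  by rewrite mem_filter ua.
have un : u \in nonneg by rewrite mem_filter ua.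
move: ua; rewrite le_eqVlt => /orP[/eqP <-|ua]; first by rewrite mulr0 Hn.
rewrite -ler_pdivlMr // /t big_seq; apply: bigmax_le.
  by apply: divr_ge0; [exact: Hn | exact: ltW].
move=> w wn; have wa : pairing w a < 0 by move: wn; rewrite mem_filter => /andP[].
rewrite ler_ndivrMr // mulrAC ler_pdivrMr //.
rewrite -subr_ge0 mulrC [X in _ - X]mulrC -!pairingZl -pairingBl; apply: H.
by rewrite mem_cat; apply/orP; right; apply/allpairsP; exists (u, w).
Qed.

Definition cone_over s : set 'rV[R]_n :=
  [set x | exists a : nat -> R, (forall i, 0 <= a i) /\
           x = \sum_(i < size s) a i *: s`_i].

(** Weyl's theorem: the coefficients of the generators are eliminated one at a
    time. *)
Lemma cone_over_halfspaces s : exists U, forall x,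
  cone_over s x <-> forall u, u \in U -> 0 <= pairing u x.
Proof.
elim: s => [|y s [U HU]].
  exists ([seq delta_mx i 0 | i <- enum 'I_n] ++ [seq - delta_mx i 0 | i <- enum 'I_n]).
  have pd (x : 'rV[R]_n) i : pairing (delta_mx i 0) x = x 0 i.
    by rewrite /pairing -colE mxE.
  move=> x; split=> [[a [_ ->]] u _|H]; first by rewrite big_ord0 pairing0r.
  exists (fun=> 0); split=> //; rewrite big_ord0; apply/rowP => i; rewrite mxE.
  apply/eqP; rewrite eq_le; apply/andP; split.
    rewrite -oppr_ge0 -pd -pairingNl; apply: H; rewrite mem_cat; apply/orP; right.
    by apply: map_f; rewrite mem_enum.
  rewrite -pd; apply: H; rewrite mem_cat; apply/orP; left.
  by apply: map_f; rewrite mem_enum.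
have [U' HU'] := halfspaces_projection U y.
exists U' => x; rewrite -HU'; split=> [[a [a0 ->]]|[t t0 H]].
  exists (a 0%N) => // u uU; apply: (HU _).1 => //.
  exists (fun i => a i.+1); split=> //.
  by rewrite big_ord_recl /= addrAC subrr add0r.
have [a [a0 e]] := (HU _).2 H.
exists (fun i => if i is j.+1 then a j else t); split; first by case.
by rewrite big_ord_recl /= -e addrC subrK.
Qed.

End Weyl.

Lemma ofZ_inj (F : numDomainType) (m n : nat) : injective (@ofZ F m n).
Proof.
move=> x y /matrixP e; apply/matrixP => i j; apply: (@intr_inj F).
by have := e i j; rewrite !mxE.
Qed.

Lemma ofZZ (F : comPzRingType) (m n : nat) (a : int) (x : 'M[int]_(m, n)) :
  ofZ F (a *: x) = a%:~R *: ofZ F x.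
Proof. exact: map_mxZ. Qed.

Lemma ofZ_sum (F : comPzRingType) (m n : nat) (T : Type) (r : seq T) (P : pred T)
    (x : T -> 'M[int]_(m, n)) :
  ofZ F (\sum_(i <- r | P i) x i) = \sum_(i <- r | P i) ofZ F (x i).
Proof. exact: (raddf_sum (map_mx (intr : int -> F))). Qed.

(** * Cones and dual bases of a simplicial multi-fan *)

Section MultifanCones.
Variables (R : realType) (n : nat) (V : finType) (D : multifan R n V).
Variable v : V -> 'rV[int]_n.
Hypothesis Dv : edge_vectors D v.
Implicit Types (I J K : {set V}).

Lemma mem_simplices_sub I J : I \in simplices D -> J \subset I -> J \in simplices D.
Proof. exact: simplices_sub. Qed.

Lemma cone_halfspaces I : I \in simplices D -> exists U : seq 'cV[R]_n,
  forall x, cone D I x <-> forall u, u \in U -> 0 <= pairing u x.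
Proof.
move=> /cone_rational [s sE].
have [U HU] := cone_over_halfspaces (map (ofZ R) s).
exists U => x; rewrite -HU sE /cone_over /= size_map.
split=> -[a [a0 ->]]; exists a; split=> //; apply: eq_bigr => i _;
by rewrite (nth_map 0).
Qed.

Lemma cone_sub I J : I \in simplices D -> J \subset I -> cone D J `<=` cone D I.
Proof. by move=> IS /(cone_is_face IS) [u [_ ->]] x []. Qed.

Lemma cone_edge I i : I \in simplices D -> i \in I -> cone D I (ofZ R (v i)).
Proof.
move=> IS iI; have [_ vi] := Dv i; apply: cone_sub vi => //.
by rewrite finset.sub1set.
Qed.

Lemma cone_edges I (t : V -> R) : I \in simplices D -> (forall i, 0 <= t i) ->
  cone D I (\sum_(i in I) t i *: ofZ R (v i)).
Proof.
move=> IS t0; have [U HU] := cone_halfspaces IS.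
apply/HU => u uU; rewrite pairing_sumr; apply: sumr_ge0 => i iI.
by rewrite pairingZr mulr_ge0 //; apply: (HU _).1 => //; exact: cone_edge.
Qed.

Lemma ofZ_edge_neq0 i : ofZ R (v i) != 0.
Proof.
have [+ _] := Dv i; apply: contra => /eqP e; apply/eqP/rowP => j.
have /rowP/(_ j) := e; rewrite !mxE => /eqP; by rewrite intr_eq0 => /eqP.
Qed.

(** Moving from a point of the cone in the direction opposite to an edge, one
    leaves the cone through a proper face, which is the cone of a smaller
    simplex. *)
Lemma coneP I x : I \in simplices D ->
  cone D I x <-> exists t : V -> R, (forall i, 0 <= t i) /\
                   x = \sum_(i in I) t i *: ofZ R (v i).
Proof.
move=> IS; split; last by move=> [t [t0 ->]]; exact: cone_edges.
elim: {I}_.+1 {-2}I (ltnSn #|I|) IS x => // m IH I; rewrite ltnS => Im IS x Ix.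
have [I0|[i iI]] := set_0Vmem I.
  exists (fun=> 0); split=> //; rewrite big1 => [|i _]; last by rewrite scale0r.
  have [W [WE]] := cone_dim IS; rewrite I0 cards0 => /eqP; rewrite dimv_eq0 => /eqP W0.
  have : [set` W] x by rewrite -WE => W' CW; exact: CW.
  by rewrite W0 /= memv0 => /eqP.
pose a := ofZ R (v i).
have [U HU] := cone_halfspaces IS.
have aI : cone D I a by exact: cone_edge.
(* The edge leaves the cone in the opposite direction since the cone contains no
   line. *)
have [u0 u0U u0a] : exists2 u, u \in U & 0 < pairing u a.
  apply: contrapT => /forall2NP H.
  have : a = 0; last by apply/eqP; exact: ofZ_edge_neq0.
  apply: (cone_strongly_convex IS) => //; apply/HU => u uU.
  rewrite pairingNr oppr_ge0 leNgt; apply/negP => ua.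
  by have [] := H u.
pose pos := [seq u <- U | 0 < pairing u a].
have [w [wp wmin]] : exists w, w \in pos /\
    forall u, u \in pos -> pairing w x / pairing w a <= pairing u x / pairing u a.
  have : pos != [::] by apply/eqP => e; have : u0 \in pos; [rewrite mem_filter u0a | rewrite e].
  elim: (pos) => // u s IHs _; have [->|s0] := eqVneq s [::].
    by exists u; split; [rewrite inE eqxx | move=> u'; rewrite inE => /eqP ->].
  have [w [ws wm]] := IHs s0.
  have [h|h] := leP (pairing w x / pairing w a) (pairing u x / pairing u a).
    exists w; split; [by rewrite inE ws orbT | move=> u'].
    by rewrite inE => /orP[/eqP ->|/wm].
  exists u; split; [by rewrite inE eqxx | move=> u'].
  rewrite inE => /orP[/eqP -> //|/wm]; apply: le_trans; exact: ltW.
have /andP[wa wU] : (0 < pairing w a) && (w \in U) by rewrite mem_filter in wp.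
(* w is the first half-space to be left when moving from x along - a. *)
pose t := pairing w x / pairing w a.
have t0 : 0 <= t by rewrite divr_ge0 ?(ltW wa) //; apply: (HU x).1.
have yI : cone D I (x - t *: a).
  apply/HU => u uU; rewrite pairingBr pairingZr subr_ge0.
  have [ua|ua] := ltP 0 (pairing u a).
    by rewrite -ler_pdivlMr // wmin // mem_filter ua.
  apply: (@le_trans _ _ 0); last by apply: (HU x).1.
  by rewrite mulr_ge0_le0.
have yw : pairing w (x - t *: a) = 0.
  by rewrite pairingBr pairingZr /t divfK ?subrr // gt_eqF.
pose F := [set y | cone D I y /\ pairing w y = 0].
have FI : is_face F (cone D I) by exists w; split=> // y /HU; apply.
have [J JI FE] := cone_face_surj IS FI.
have iJ : i \notin J.
  apply/negP => iJ; have : F a by rewrite FE; apply: cone_edge => //; apply: mem_simplices_sub JI.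
  by case=> _ e; rewrite e ltxx in wa.
have Jm : (#|J| < m)%N.
  apply: leq_trans Im; apply: proper_card; rewrite properE JI; apply/subsetPn.
  by exists i.
have Jx : cone D J (x - t *: a) by rewrite -FE; split.
have [s [s0 e]] := IH J Jm (mem_simplices_sub IS JI) _ Jx.
exists (fun j => (if j \in J then s j else 0) + (if j == i then t else 0)); split.
  by move=> j; rewrite addr_ge0 //; case: ifP.
under eq_bigr do rewrite scalerDl.
rewrite big_split /= -[LHS](subrK (t *: a)) e; congr (_ + _).
  rewrite [RHS](bigID (fun j => j \in J)) /= [X in _ + X]big1 => [|j /andP[_ /negPf ->]].
    rewrite addr0; apply: eq_big => j; last by move=> ->.
    by have [/(fintype.subsetP JI) ->|] := boolP (j \in J); rewrite ?andbF.
  by rewrite scale0r.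
rewrite (bigD1 i) //= eqxx big1 ?addr0 // => j /andP[_ /negPf ->].
by rewrite scale0r.
Qed.

Definition edge_mx I : 'M[rat]_(#|I|, n) := \matrix_a ofZ rat (v (enum_val a)).

Lemma row_edge_mx (F : numFieldType) I (a : 'I_#|I|) :
  row a (map_mx ratr (edge_mx I)) = ofZ F (v (enum_val a)).
Proof. by apply/rowP => j; rewrite !mxE ratr_int. Qed.

(** The edges span a space of the dimension of the cone, which is their number. *)
Lemma edge_mx_free I : I \in simplices D -> row_free (edge_mx I).
Proof.
move=> IS; rewrite -(row_free_map (ratr : {rmorphism rat -> R})).
pose X := [tuple ofZ R (v (enum_val a)) | a < #|I|].
have [W [WE dW]] := cone_dim IS.
have freeX : free X.
  suff H : (#|I| <= \dim <<X>>)%N.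
    by rewrite /free eqn_leq dim_span size_tuple H.
  rewrite -[X in (X <= _)%N]dW; apply: dimvS; apply/subvP => x xW.
  have : lspan (cone D I) x by rewrite WE.
  apply=> y /(coneP _ IS) [t [_ ->]] /=; apply: memv_suml => i iI.
  apply: memvZ; apply: memv_span.
  rewrite -(enum_rankK_in iI iI); apply/mapP.
  by exists (enum_rank_in iI i); rewrite ?mem_enum.
apply: inj_row_free => w w0; apply/rowP => a; rewrite mxE.
apply: (elimT freeP freeX (fun a => w 0 a)).
rewrite -[RHS]w0 mulmx_sum_row; apply: eq_bigr => b _.
by rewrite row_edge_mx -tnth_nth tnth_mktuple.
Qed.

Lemma dualP I i j : I \in simplices D -> j \in I ->
  pairing (dual v I i) (ofZ rat (v j)) = (i == j)%:R.
Proof.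
move=> IS jI; rewrite /dual; set P := [set u | _].
suff /(xgetPex 0) : exists u, P u by apply.
have [iI|iI] := boolP (i \in I); last first.
  exists 0 => k kI; rewrite pairing0l; case: eqP => // e.
  by rewrite e kI in iI.
exists (col (enum_rank_in iI i) (pinvmx (edge_mx I))) => k kI.
have := mulmxVp (edge_mx_free IS).
move=> /matrixP/(_ (enum_rank_in iI k) (enum_rank_in iI i)).
rewrite !mxE => e.
rewrite pairingE; transitivity ((enum_rank_in iI k == enum_rank_in iI i)%:R : rat).
  rewrite -e; apply: eq_bigr => l _; rewrite !mxE.
  by rewrite enum_rankK_in.
rewrite eq_sym; congr (nat_of_bool _)%:R.
by apply/eqP/eqP => [/enum_rank_in_inj -> //|ik]; subst k.
Qed.

Lemma dualRP I i j : I \in simplices D -> j \in I ->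
  pairing (dualR R v I i) (ofZ R (v j)) = (i == j)%:R.
Proof. by move=> IS jI; rewrite /dualR pairing_ratr dualP // ratr_nat. Qed.

Lemma skelP k I : reflect (I \in simplices D /\ #|I| = k) (I \in skel D k).
Proof.
by rewrite !inE; apply: (iffP andP) => -[IS /eqP ?].
Qed.

Lemma facetsP K I : reflect [/\ I \in simplices D, #|I| = n & K \subset I] (I \in facets D K).
Proof.
rewrite !inE; apply: (iffP andP) => [[/andP[IS /eqP ?]]|[IS /eqP -> ->]] //.
by rewrite IS.
Qed.

Lemma expand_edges (F : numFieldType) I (x : 'rV[F]_n) : I \in skel D n ->
  x = \sum_(i in I) pairing (map_mx ratr (dual v I i)) x *: ofZ F (v i).
Proof.
move=> /skelP [IS In].
have : (x <= map_mx ratr (edge_mx I))%MS.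
  apply: submx_full.
  by rewrite /row_full mxrank_map (eqP (edge_mx_free IS)) In.
move=> /submxP [w wE].
have {wE} xE : x = \sum_a w 0 a *: ofZ F (v (enum_val a)).
  by rewrite wE mulmx_sum_row; under eq_bigr do rewrite row_edge_mx.
rewrite big_enum_val /= [LHS]xE; apply: eq_bigr => a _; congr (_ *: _).
rewrite xE pairing_sumr (bigD1 a) //= pairingZr pairing_ratr dualP ?enum_valP //.
rewrite eqxx ratr_nat mulr1 big1 ?addr0 // => b ba.
rewrite pairingZr pairing_ratr dualP ?enum_valP // (inj_eq enum_val_inj) eq_sym.
by rewrite (negPf ba) ratr_nat mulr0.
Qed.

Lemma expand_edgesR I (x : 'rV[R]_n) : I \in skel D n ->
  x = \sum_(i in I) pairing (dualR R v I i) x *: ofZ R (v i).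
Proof. exact: expand_edges. Qed.

Lemma expand_edgesQ I (x : 'rV[rat]_n) : I \in skel D n ->
  x = \sum_(i in I) pairing (dual v I i) x *: ofZ rat (v i).
Proof.
move=> IS; rewrite {1}(expand_edges x IS); apply: eq_bigr => i _.
congr (pairing _ _ *: _); apply/matrixP => a b; rewrite mxE.
by rewrite /ratr divq_num_den.
Qed.

Lemma expand_dual I (u : 'cV[rat]_n) : I \in skel D n ->
  u = \sum_(i in I) pairing u (ofZ rat (v i)) *: dual v I i.
Proof.
move=> IS; apply: pairing_inj => x.
rewrite {1}(expand_edgesQ x IS) pairing_sumr pairing_suml; apply: eq_bigr => i _.
by rewrite pairingZr pairingZl mulrC.
Qed.

Lemma expand_dualR I (u : 'cV[R]_n) : I \in skel D n ->
  u = \sum_(i in I) pairing u (ofZ R (v i)) *: dualR R v I i.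
Proof.
move=> IS; apply: pairing_inj => x.
rewrite {1}(expand_edgesR x IS) pairing_sumr pairing_suml; apply: eq_bigr => i _.
by rewrite pairingZr pairingZl mulrC.
Qed.

Lemma edge_in_latN J i : J \in simplices D -> i \in J -> latN D J (v i).
Proof.
by move=> JS iJ; apply: sub_gen_smallest => /=; exact: cone_edge.
Qed.

Lemma common_denom (T : finType) (q : T -> rat) :
  exists2 m : nat, (0 < m)%N & forall t, exists c : int, m%:R * q t = c%:~R.
Proof.
exists (\prod_t `|denq (q t)|%N)%N; first by apply: prodn_gt0 => t; rewrite absz_gt0 denq_neq0.
move=> t; rewrite (bigD1 t) //= mulnC natrM.
exists ((\prod_(i | i != t) `|denq (q i)|%N)%N%:Z * numq (q t)).
rewrite intrM -mulrA; congr (_ * _).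
by rewrite natr_absz (ger0_norm (denq_ge0 _)) numqE mulrC.
Qed.

Section LatN.
Variables (I J : {set V}).
Hypotheses (IS : I \in skel D n) (JI : J \subset I).

Let ISs : I \in simplices D. Proof. by case/skelP: IS. Qed.
Let JS : J \in simplices D. Proof. exact: mem_simplices_sub ISs JI. Qed.

(** Both sides describe the lattice points in the span of the edges of J: the
    right one is primitive, and a multiple of any of its points is an integral
    combination of edges. *)
Lemma latNP x : latN D J x <->
  forall i, i \in I :\: J -> pairing (dual v I i) (ofZ rat x) = 0.
Proof.
split.
  pose L := [set x : 'rV[int]_n | forall i, i \in I :\: J -> pairing (dual v I i) (ofZ rat x) = 0].
  suff : latN D J `<=` L by apply.
  apply: smallest_sub.
    split.
    - by move=> i _; rewrite /ofZ map_mx0 pairing0r.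
    - by move=> y z yL zL i iIJ; rewrite /ofZ map_mxB pairingBr yL // zL // subr0.
    move=> m y m0 yL i iIJ; have := yL i iIJ.
    rewrite /ofZ map_mxZ pairingZr => /eqP; rewrite mulf_eq0 intr_eq0 (negPf m0) /=.
    by move/eqP.
  move=> y /= /(coneP _ JS) [t [_ e]] i /setDP[iI iJ].
  have : pairing (dualR R v I i) (ofZ R y) = 0.
    rewrite e pairing_sumr big1 // => j jJ; rewrite pairingZr dualRP //.
      by case: eqP => [ij|_]; [rewrite ij jJ in iJ | rewrite mulr0].
    exact: (fintype.subsetP JI).
  by rewrite /dualR pairing_ratr => /eqP; rewrite fmorph_eq0 => /eqP.
move=> x0 L [[L0 LB LZ] LC].
have [m m0 mq] := common_denom (fun i => pairing (dual v I i) (ofZ rat x)).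
have [c cE] := choice mq.
have LD y z : L y -> L z -> L (y + z).
  by move=> Ly Lz; rewrite -[z]opprK -[- z]sub0r; apply: (LB) => //; exact: (LB).
have LMn (k : nat) y : L y -> L (y *+ k).
  by move=> Ly; elim: k => [|k IHk]; rewrite ?mulr0n // mulrS; exact: LD.
have LM (k : int) y : L y -> L (k *: y).
  move=> Ly; rewrite -[k]intz; case: k => k.
    by rewrite scaler_int; exact: LMn.
  rewrite scaler_int NegzE mulrNz -[_ *~ _]/(y *+ _) -sub0r.
  by apply: (LB) => //; exact: LMn.
apply: (LZ m%:Z); first by rewrite eqz_nat -lt0n.
have -> : m%:Z *: x = \sum_(i in J) c i *: v i.
  apply: (@ofZ_inj rat); rewrite ofZZ ofZ_sum {1}(expand_edgesQ (ofZ rat x) IS).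
  rewrite scaler_sumr (bigID (fun i => i \in J)) /= [X in _ + X]big1.
    rewrite addr0; apply: eq_big => i.
      by have [/(fintype.subsetP JI) ->|] := boolP (i \in J); rewrite ?andbF.
    by move=> _; rewrite scalerA -[m%:~R]/(m%:R) cE ofZZ.
  by move=> i /andP[iI iJ]; rewrite x0 ?scale0r ?scaler0 // inE iI iJ.
apply: (big_ind L) => // i iJ; apply: LM; apply: LC; exact: cone_edge.
Qed.

End LatN.

End MultifanCones.

(** * The balancing condition at the walls *)

Section Balance.
Variables (R : realType) (n : nat) (V : finType) (D : multifan R n V).
Variable v : V -> 'rV[int]_n.
Hypothesis Dv : edge_vectors D v.
Implicit Types (I J K L : {set V}).

Local Notation u_ I i := (dualR R v I i).

Definition edge_span J : {vspace 'rV[R]_n} := <<[seq ofZ R (v i) | i <- enum J]>>%VS.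

Lemma edge_spanP I J x : I \in skel D n -> J \subset I ->
  x \in edge_span J <-> forall i, i \in I :\: J -> pairing (u_ I i) x = 0.
Proof.
move=> IS JI; have [ISs _] := skelP _ _ _ IS; split.
  rewrite /edge_span -[X in <<X>>%VS]in_tupleE => /coord_span -> i /finset.setDP[iI iJ].
  rewrite pairing_sumr big1 // => a _; rewrite pairingZr.
  have : (in_tuple [seq ofZ R (v i) | i <- enum J])`_a
      \in [seq ofZ R (v i) | i <- enum J] by apply: mem_nth.
  case/mapP => j; rewrite mem_enum => jJ ->.
  rewrite (dualRP Dv) //; last exact: (fintype.subsetP JI).
  by case: eqP => [ij|_]; [rewrite ij jJ in iJ | rewrite mulr0].
move=> x0; rewrite (expand_edgesR Dv x IS); apply: memv_suml => i iI.
have [iJ|iJ] := boolP (i \in J).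
  by apply: memvZ; apply: memv_span; apply: map_f; rewrite mem_enum.
by rewrite x0 ?scale0r ?mem0v // inE iJ.
Qed.

Lemma latN_RP J x : J \in simplices D -> latN_R D J x <-> x \in edge_span J.
Proof.
move=> JS; have [I [IS In JI]] := simplices_pure JS.
have ISn : I \in skel D n by apply/skelP.
split.
  apply=> _ [y yJ <-] /=; apply/(edge_spanP _ ISn JI) => i iIJ.
  by rewrite /dualR pairing_ratr (latNP Dv ISn JI y).1 // raddf0.
move=> xJ W HW; suff : (edge_span J <= W)%VS by move/subvP; apply.
apply/span_subvP => _ /mapP [i + ->]; rewrite mem_enum => iJ.
by apply: HW; exists (v i) => //; exact: edge_in_latN.
Qed.

Lemma proj_coneP I K x : I \in facets D K ->
  proj_cone D K I x <-> forall i, i \in I :\: K -> 0 <= pairing (u_ I i) x.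
Proof.
move=> /facetsP [IS In KI].
have ISn : I \in skel D n by apply/skelP.
have KS := mem_simplices_sub IS KI.
split.
  move=> [y /(coneP Dv _ IS) [t [t0 yE]] /(latN_RP _ KS)/(edge_spanP _ ISn KI) xy] i iIK.
  have := xy i iIK; rewrite pairingBr => /eqP; rewrite subr_eq0 => /eqP ->.
  rewrite yE pairing_sumr; apply: sumr_ge0 => j jI; rewrite pairingZr.
  by rewrite (dualRP Dv) // mulr_ge0.
move=> x0; pose t i := if i \in I :\: K then pairing (u_ I i) x else 0.
exists (\sum_(i in I) t i *: ofZ R (v i)).
  by apply: cone_edges => // i; rewrite /t; case: ifP => // /x0.
apply/latN_RP => //; apply/(edge_spanP _ ISn KI) => i iIK.
have iI : i \in I by case/finset.setDP: iIK.
rewrite pairingBr pairing_sumr (bigD1 i) //= pairingZr (dualRP Dv) // eqxx mulr1.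
rewrite big1 ?addr0 => [|j /andP[jI ji]]; first by rewrite /t iIK subrr.
by rewrite pairingZr (dualRP Dv) // eq_sym (negPf ji) mulr0.
Qed.

(** Pre-completeness of the rank one multi-fan projected along the wall L, read
    at the two opposite vectors x and - x. *)
Lemma wall_balance L x : complete_multifan D -> #|L|.+1 = n ->
  \sum_(I in facets D L) \sum_(i in I :\: L)
    (weight D I)%:~R * Num.sg (pairing (u_ I i) x) = 0 :> R.
Proof.
move=> cD Ln; have [F0|[I0 I0F]] := set_0Vmem (facets D L).
  by rewrite F0 big1 // => I; rewrite inE.
have [I0S I0n LI0] := facetsP _ _ _ I0F.
have I0Sn : I0 \in skel D n by apply/skelP.
have LS := mem_simplices_sub I0S LI0.
have [xL|xL] := boolP (x \in edge_span L).
  rewrite big1 // => I /facetsP [IS In LI]; rewrite big1 // => i iIL.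
  have ISn : I \in skel D n by apply/skelP.
  by rewrite (edge_spanP x ISn LI).1 // sgr0 mulr0.
have gen y : y \notin edge_span L -> proj_generic D L y.
  move=> yL J JS LJ Jn; have -> : J = L.
    by apply/eqP; rewrite eq_sym eqEcard LJ -ltnS Ln.
  move=> yl; move/negP: yL; apply; apply: yl => z [z0 z0L zz0] /=.
  rewrite -[z](subrK z0); apply: memvD; first exact/latN_RP.
  have [t [_ ->]] := (coneP Dv z0 LS).1 z0L.
  apply: memv_suml => i iL; apply: memvZ; apply: memv_span.
  by apply: map_f; rewrite mem_enum.
have xL' : - x \notin edge_span L by rewrite memvN.
have := cD L LS _ _ (gen _ xL) (gen _ xL'); rewrite /proj_degree => e.
have {}e : \sum_(I in facets D L) (weight D I)%:~R * (`[< proj_cone D L I x >]%:R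
    - `[< proj_cone D L I (- x) >]%:R) = 0 :> R.
  under eq_bigr do rewrite mulrBr.
  rewrite sumrB; apply/eqP; rewrite subr_eq0; apply/eqP.
  have E (y : 'rV[R]_n) : \sum_(I in facets D L) (weight D I)%:~R * `[< proj_cone D L I y >]%:R
      = (\sum_(I in facets D L | `[< proj_cone D L I y >]) weight D I)%:~R :> R.
    rewrite rmorph_sum [RHS]big_mkcondr /=; apply: eq_bigr => I _.
    by case: ifP => _; rewrite ?mulr1 ?mulr0.
  by rewrite !E e.
rewrite -[RHS]e; apply: eq_bigr => I IF.
have [IS In LI] := facetsP _ _ _ IF.
have ISn : I \in skel D n by apply/skelP.
have /eqP/cards1P [i Ei] : #|I :\: L| = 1%N.
  by rewrite cardsD (finset.setIidPr LI) In -Ln subSnn.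
rewrite Ei big_set1; congr (_ * _).
have a0 : pairing (u_ I i) x != 0.
  apply: contra xL => /eqP a0; apply/(edge_spanP x ISn LI) => j.
  by rewrite Ei inE => /eqP ->.
have P y : `[< proj_cone D L I y >] = (0 <= pairing (u_ I i) y).
  apply/asboolP/idP => [/(proj_coneP _ IF) H|H].
    by apply: H; rewrite Ei inE eqxx.
  by apply/(proj_coneP _ IF) => j; rewrite Ei inE => /eqP ->.
rewrite !P pairingNr oppr_ge0.
have [h|h|h] := ltgtP 0 (pairing (u_ I i) x); last by rewrite -h eqxx in a0.
  by rewrite gtr0_sg // subr0.
by rewrite ltr0_sg // sub0r.
Qed.

End Balance.

(** * Independence of the direction *)

Section Avoidance.
Variables (F : numFieldType) (n : nat).

Lemma natr_notin (s : seq F) : exists t : nat, t%:R \notin s.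
Proof.
have : ~~ all (mem s) [seq t%:R : F | t <- iota 0 (size s).+1].
  apply/negP => /allP H.
  have := uniq_leq_size _ H; rewrite map_inj_uniq ?iota_uniq; last first.
    by move=> i j /eqP; rewrite eqr_nat => /eqP.
  by move=> /(_ isT); rewrite size_map size_iota ltnn.
by case/allPn => _ /mapP [t _ ->] ts; exists t.
Qed.

Lemma cV_neq0 (f : 'cV[F]_n) : f != 0 -> exists l, pairing f (delta_mx 0 l) != 0.
Proof.
move=> f0; have [l fl] : exists l, f l 0 != 0.
  apply: contrapT => /forallNP H; move/eqP: f0; apply; apply/colP => l; rewrite !mxE.
  by apply/eqP/negPn/negP => /H.
by exists l; rewrite pairing_delta.
Qed.

(** A point that is good for all forms but one is multiplied by an integer that
    avoids finitely many values, then moved along an axis on which the last form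
    does not vanish. *)
Lemma avoid_hyperplanes (fs : seq 'cV[F]_n) :
  exists x : 'rV[int]_n, forall f, f \in fs -> f != 0 -> pairing f (ofZ F x) != 0.
Proof.
elim: fs => [|f fs [x Hx]]; first by exists 0.
have [f0|f0] := eqVneq f 0.
  by exists x => h; rewrite inE => /orP[/eqP ->|/Hx //]; rewrite f0 eqxx.
have [fx|fx] := eqVneq (pairing f (ofZ F x)) 0; last first.
  by exists x => h; rewrite inE => /orP[/eqP ->|/Hx //].
have [l fl] := cV_neq0 f0.
have [t tE] := natr_notin [seq - pairing h (delta_mx 0 l) / pairing h (ofZ F x) | h <- fs].
have E h : pairing h (ofZ F (t%:Z *: x + delta_mx 0 l))
    = t%:R * pairing h (ofZ F x) + pairing h (delta_mx 0 l).
  rewrite /ofZ map_mxD map_mxZ pairingDr pairingZr; congr (_ + pairing _ _).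
  by rewrite map_delta_mx.
exists (t%:Z *: x + delta_mx 0 l) => h; rewrite E inE => /orP[/eqP -> _|hfs h0].
  by rewrite fx mulr0 add0r.
have hx := Hx h hfs h0.
apply: contraNneq tE => e; apply/mapP; exists h => //.
by apply: (mulIf hx); rewrite divfK //; apply/eqP; rewrite -addr_eq0 e.
Qed.

Lemma avoid_family (T : finType) (f : T -> 'cV[F]_n) :
  exists x : 'rV[int]_n, forall t, f t != 0 -> pairing (f t) (ofZ F x) != 0.
Proof.
have [x Hx] := avoid_hyperplanes [seq f t | t <- enum T].
by exists x => t; apply: Hx; apply: map_f; rewrite mem_enum.
Qed.

End Avoidance.

Section SignedCones.
Variables (R : realType) (n : nat) (V : finType) (D : multifan R n V).
Variable v : V -> 'rV[int]_n.
Hypotheses (Dv : edge_vectors D v) (cD : complete_multifan D).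
Implicit Types (I J K L : {set V}) (g x : 'rV[R]_n).

Local Notation u_ I i := (dualR R v I i).

(** The Duistermaat-Heckman function at a point off the walls only depends on
    the set [s] of the vertices whose wall has the point on its positive side. *)
Definition signed_DH g K (s : V -> bool) : R :=
  \sum_(I in facets D K) (weight D I)%:~R *
    \prod_(i in I :\: K) (if s i then - is_pos (pairing (u_ I i) g)
                          else is_pos (- pairing (u_ I i) g)).

(** The change of the Duistermaat-Heckman function along a segment of directions
    is found facet by facet; it cancels wall by wall, a wall being a facet
    without one of its vertices off K. *)
Lemma sum_walls K (H : {set V} -> V -> R) :
  \sum_(I in facets D K) \sum_(i in I :\: K) H I i =
  \sum_(L : {set V} | (K \subset L) && (#|L|.+1 == n))
    \sum_(I in facets D L) \sum_(i in I :\: L) H I i.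
Proof.
rewrite pair_big_dep /=.
rewrite (partition_big (fun p : {set V} * V => p.1 :\ p.2)
  (fun L => (K \subset L) && (#|L|.+1 == n))) /=; last first.
  move=> [I i] /=. move=> /andP[/facetsP [IS In KI] /finset.setDP[iI iK]].
  rewrite subsetD1 KI iK /=.
  by have := cardsD1 i I; rewrite iI In add1n => <-.
apply: eq_bigr => L /andP[KL /eqP Ln]; rewrite pair_big_dep /=.
apply: eq_bigl => -[I i] /=; apply/andP/andP.
  move=> [/andP[/facetsP [IS In KI] /finset.setDP[iI iK]] /eqP <-].
  split; last by rewrite !inE eqxx iI.
  by apply/facetsP; split; rewrite ?subD1set.
move=> [/facetsP [IS In LI] /finset.setDP[iI iL]].
have -> : I :\ i = L.
  apply/eqP; rewrite eq_sym eqEcard subsetD1 LI iL /=.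
  by have := cardsD1 i I; rewrite iI In add1n -Ln => -[->].
split; last exact: eqxx.
apply/andP; split.
  by apply/facetsP; split=> //; apply: fintype.subset_trans LI.
by rewrite inE iI andbT; apply: contra iL; apply: (fintype.subsetP KL).
Qed.

Section Segment.
Variables (K : {set V}) (g1 g2 : 'rV[R]_n) (s : V -> bool).
Hypotheses (d1 : DH_direction D v K g1) (d2 : DH_direction D v K g2).
Hypothesis gp : forall I i j, I \in facets D K -> i \in I :\: K -> j \in I :\: K ->
  i != j -> pairing (u_ I i) g1 * pairing (u_ I j) g2
         != pairing (u_ I j) g1 * pairing (u_ I i) g2.

Let sg i : R := if s i then 1 else -1.
Let al I i := sg i * pairing (u_ I i) g1.
Let be I i := sg i * pairing (u_ I i) (g2 - g1).

Let sg_neq0 i : sg i != 0.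
Proof. by rewrite /sg; case: ifP => _; rewrite ?oppr_eq0 oner_eq0. Qed.

Let sgK i : sg i * sg i = 1.
Proof. by rewrite /sg; case: ifP => _; rewrite ?mulrNN mulr1. Qed.

Lemma signed_DHE g : signed_DH g K s = \sum_(I in facets D K) (weight D I)%:~R *
   (\prod_(i in I :\: K) - sg i) * \prod_(i in I :\: K) is_pos (sg i * pairing (u_ I i) g).
Proof.
apply: eq_bigr => I _; rewrite -mulrA -big_split /=; congr (_ * _).
apply: eq_bigr => i _; rewrite /sg; case: ifP => _; rewrite ?mul1r ?mulN1r //.
by rewrite opprK mul1r.
Qed.

Let al0 I i : affine_at (al I) (be I) 0 i = sg i * pairing (u_ I i) g1.
Proof. by rewrite /affine_at mul0r addr0. Qed.

Let be1 I i : affine_at (al I) (be I) 1 i = sg i * pairing (u_ I i) g2.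
Proof. by rewrite /affine_at mul1r /al /be pairingBr -mulrDr addrC subrK. Qed.

Let wall_term I i := (weight D I)%:~R * (\prod_(j in I :\: K) - sg j) *
  (jump (al I) (be I) 0 1 i
   * \prod_(j in I :\: K | j != i)
       is_pos (affine_at (al I) (be I) (affine_root (al I) (be I) i) j)).

(** Only the indicators of the conditions on the direction vary along the
    segment, and those of one facet are treated by crossing_formula. *)
Lemma signed_DH_diff : signed_DH g2 K s - signed_DH g1 K s
  = \sum_(I in facets D K) \sum_(i in I :\: K) wall_term I i.
Proof.
rewrite !signed_DHE -sumrB; apply: eq_bigr => I IF; rewrite -mulrBr /wall_term -mulr_sumr.
congr (_ * _).
have := @crossing_formula _ _ (al I) (be I) (enum (I :\: K)) 0 1 (enum_uniq _) ltr01.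
rewrite !big_enum /= => H.
under eq_bigr do rewrite -be1.
under [X in _ - X]eq_bigr do rewrite -al0.
rewrite H; first 2 last.
- move=> i j; rewrite !mem_enum => iI jI ij.
  rewrite /al /be !pairingBr -subr_eq0.
  have -> : sg i * pairing (u_ I i) g1 * (sg j * (pairing (u_ I j) g2 - pairing (u_ I j) g1))
    - sg j * pairing (u_ I j) g1 * (sg i * (pairing (u_ I i) g2 - pairing (u_ I i) g1))
    = (sg i * sg j) * (pairing (u_ I i) g1 * pairing (u_ I j) g2
      - pairing (u_ I j) g1 * pairing (u_ I i) g2) by ring.
  by rewrite !mulf_neq0 // subr_eq0 gp.
- by apply: eq_bigr => i _; rewrite big_enum_cond.
- move=> i; rewrite mem_enum => iI; rewrite al0 be1.
  by rewrite !mulf_neq0 ?(d1 IF iI) ?(d2 IF iI).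
Qed.

(** All facets around the wall L are left at the same point of the segment,
    where the coordinates along L do not depend on the facet. The terms thus
    differ only by the weight and by the side of L on which the facet lies, and
    the balance at the wall applies. *)
Lemma wall_terms_cancel L : K \subset L -> #|L|.+1 = n ->
  \sum_(I in facets D L) \sum_(i in I :\: L) wall_term I i = 0.
Proof.
move=> KL Ln; have [F0|[I0 I0F]] := set_0Vmem (facets D L).
  by rewrite F0 big1 // => I; rewrite inE.
have [I0S I0n LI0] := facetsP _ _ _ I0F.
have I0Sn : I0 \in skel D n by apply/skelP.
have /eqP/cards1P [i0 Ei0] : #|I0 :\: L| = 1%N.
  by rewrite cardsD (finset.setIidPr LI0) I0n -Ln subSnn.
set dl := g2 - g1.
have facetL I : I \in facets D L -> [/\ I \in skel D n, L \subset I & I \in facets D K].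
  move=> /facetsP [IS In LI]; split=> //; first exact/skelP.
  by apply/facetsP; split=> //; apply: fintype.subset_trans LI.
have [dL|dL] := boolP (dl \in edge_span R v L).
  rewrite big1 // => I /facetL [IS LI IK]; rewrite big1 // => i iIL.
  have := (edge_spanP Dv dl IS LI).1 dL i iIL; rewrite /dl pairingBr => /eqP.
  rewrite subr_eq0 => /eqP e.
  by rewrite /wall_term /jump al0 be1 e subrr mul0r mulr0.
have dN I i : I \in facets D L -> i \in I :\: L -> pairing (u_ I i) dl != 0.
  move=> IF iIL; have [IS LI IK] := facetL I IF.
  apply: contra dL => /eqP e; apply/(edge_spanP Dv dl IS LI) => j jIL.
  suff -> : j = i by [].
  have /eqP/cards1P [k Ek] : #|I :\: L| = 1%N.
    by have [_ In _] := facetsP _ _ _ IF; rewrite cardsD (finset.setIidPr LI) In -Ln subSnn.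
  by move: iIL jIL; rewrite Ek !inE => /eqP -> /eqP ->.
have i0L : i0 \in I0 :\: L by rewrite Ei0 inE.
pose ta := - pairing (u_ I0 i0) g1 / pairing (u_ I0 i0) dl.
pose xL := g1 + ta *: dl.
have xLL : xL \in edge_span R v L.
  apply/(edge_spanP Dv xL I0Sn LI0) => j; rewrite Ei0 inE => /eqP ->.
  by rewrite /xL pairingDr pairingZr /ta divfK ?subrr ?dN.
have uxL I i : I \in facets D L -> i \in I :\: L -> pairing (u_ I i) xL = 0.
  by move=> IF; have [IS LI _] := facetL I IF; apply: (edge_spanP Dv xL IS LI).1.
have taE I i : I \in facets D L -> i \in I :\: L -> affine_root (al I) (be I) i = ta.
  move=> IF iIL; have := uxL I i IF iIL; rewrite /xL pairingDr pairingZr.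
  move=> /eqP; rewrite addr_eq0 => /eqP e.
  rewrite /affine_root /al /be -/dl e mulrN opprK.
  by field; rewrite sg_neq0 dN.
have xLE : xL = \sum_(j in L) pairing (u_ I0 j) xL *: ofZ R (v j).
  rewrite {1}(expand_edgesR Dv xL I0Sn) (bigID (fun i => i \in L)) /= [X in _ + X]big1.
    rewrite addr0; apply: eq_bigl => j.
    by have [/(fintype.subsetP LI0) ->|] := boolP (j \in L); rewrite ?andbF.
  by move=> j /andP[jI jL]; rewrite (uxL I0) ?scale0r // inE jI jL.
have uxE I j : I \in facets D L -> j \in L -> pairing (u_ I j) xL = pairing (u_ I0 j) xL.
  move=> IF jL; have [IS In LI] := facetsP _ _ _ IF.
  rewrite {1}xLE pairing_sumr (bigD1 j) //= pairingZr (dualRP Dv) ?(fintype.subsetP LI) //.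
  rewrite eqxx mulr1 big1 ?addr0 // => k /andP[kL kj].
  by rewrite pairingZr (dualRP Dv) ?(fintype.subsetP LI) // eq_sym (negPf kj) mulr0.
pose c : R := if 0 < ta < 1 then 1 else 0.
pose F := \prod_(j in L :\: K) (- sg j * is_pos (sg j * pairing (u_ I0 j) xL)).
suff E I i : I \in facets D L -> i \in I :\: L ->
    wall_term I i = - (c * F) * ((weight D I)%:~R * Num.sg (pairing (u_ I i) dl)).
  rewrite (eq_bigr (fun I => - (c * F) * \sum_(i in I :\: L)
      ((weight D I)%:~R * Num.sg (pairing (u_ I i) dl)))); last first.
    by move=> I IF; rewrite mulr_sumr; apply: eq_bigr => i iI; apply: E.
  by rewrite -mulr_sumr (wall_balance Dv dl cD Ln) mulr0.
move=> IF iIL; have [IS LI IK] := facetL I IF.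
have [iI iL] := finset.setDP iIL.
have iK : i \notin K by apply: contra iL; apply: (fintype.subsetP KL).
have LE : L = I :\ i.
  apply/eqP; rewrite eqEcard subsetD1 LI iL /=.
  have [_ In _] := facetsP _ _ _ IF.
  by have := cardsD1 i I; rewrite iI In add1n -Ln => -[->].
have jumpE : jump (al I) (be I) 0 1 i = c * (sg i * Num.sg (pairing (u_ I i) dl)).
  rewrite /jump al0 be1.
  have g1E : pairing (u_ I i) g1 = - ta * pairing (u_ I i) dl.
    have := uxL I i IF iIL; rewrite /xL pairingDr pairingZr => /eqP.
    by rewrite addr_eq0 mulNr => /eqP.
  have g2E : pairing (u_ I i) g2 = (1 - ta) * pairing (u_ I i) dl.
    by rewrite -[g2](subrK g1) -/dl pairingDr g1E; ring.
  have dn := dN I i IF iIL.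
  have iIK : i \in I :\: K by rewrite inE iK.
  have := d1 IK iIK; have := d2 IK iIK; rewrite g1E g2E.
  rewrite !mulf_eq0 !negb_or oppr_eq0 subr_eq0 => /andP[t1 _] /andP[t0 _].
  have sgl : sg i * Num.sg (pairing (u_ I i) dl) = Num.sg (sg i * pairing (u_ I i) dl).
    by rewrite sgrM /sg; case: ifP => _; rewrite ?sgr1 ?sgrN1.
  rewrite sgl !(mulrCA (sg i)); have := mulf_neq0 (sg_neq0 i) dn.
  move: (sg i * _) => y y0; rewrite /c /is_pos.
  have [h1|h1|h1] := ltgtP 0 ta; last by rewrite -h1 eqxx in t0.
  - have [h2|h2|h2] := ltgtP ta 1; last by rewrite h2 eqxx in t1.
    + rewrite mul1r pmulr_rgt0 ?subr_gt0 // nmulr_rgt0 ?oppr_lt0 //.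
      have [h|h|h] := ltgtP 0 y; last by rewrite -h eqxx in y0.
        by rewrite gtr0_sg // subr0.
      by rewrite ltr0_sg // sub0r.
    + by rewrite mul0r nmulr_rgt0 ?subr_lt0 // nmulr_rgt0 ?oppr_lt0 // subrr.
  - rewrite mul0r pmulr_rgt0 ?subr_gt0 ?(lt_trans h1) // pmulr_rgt0 ?oppr_gt0 // subrr //.
have IKE : I :\: K = i |: (L :\: K).
  rewrite LE; apply/setP => j; rewrite !inE; case: eqP => [->|//] /=.
  by rewrite iK.
have prodE (h : V -> R) : \prod_(j in I :\: K) h j = h i * \prod_(j in L :\: K) h j.
  by rewrite IKE big_setU1 // LE !inE eqxx /= andbF.
have prodE' (h : V -> R) : \prod_(j in I :\: K | j != i) h j = \prod_(j in L :\: K) h j.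
  by apply: eq_bigl => j; rewrite LE !inE; case: (j == i); rewrite ?andbF ?andbT.
rewrite /wall_term jumpE prodE prodE' (taE I i) //.
have -> : \prod_(j in L :\: K) is_pos (affine_at (al I) (be I) ta j)
    = \prod_(j in L :\: K) is_pos (sg j * pairing (u_ I0 j) xL).
  apply: eq_bigr => j /finset.setDP[jL _]; rewrite -(uxE I j IF jL) /xL pairingDr pairingZr.
  by congr is_pos; rewrite /affine_at /al /be -/dl; ring.
rewrite /F big_split /=.
set P := \prod_(j in L :\: K) - sg j; set Q := \prod_(j in L :\: K) is_pos _.
transitivity (- (sg i * sg i) * (c * (P * Q)) * ((weight D I)%:~R * Num.sg (pairing (u_ I i) dl))).
  by ring.
by rewrite sgK; ring.
Qed.

Lemma signed_DH_segment : signed_DH g2 K s = signed_DH g1 K s.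
Proof.
apply/eqP; rewrite -subr_eq0 signed_DH_diff sum_walls big1 // => L /andP[KL /eqP Ln].
exact: wall_terms_cancel.
Qed.

End Segment.

(** Two generic directions are joined through a third one such that both
    segments avoid the intersections of two walls of a same cone. *)
Theorem signed_DH_indep K g1 g2 s : DH_direction D v K g1 -> DH_direction D v K g2 ->
  signed_DH g1 K s = signed_DH g2 K s.
Proof.
move=> d1 d2.
pose f (t : {set V} * V * V * 'I_3) : 'cV[R]_n :=
  let: (I', i, j, k) := t in
  if k == 0 then u_ I' i
  else if k == 1 then pairing (u_ I' i) g1 *: u_ I' j - pairing (u_ I' j) g1 *: u_ I' i
  else pairing (u_ I' i) g2 *: u_ I' j - pairing (u_ I' j) g2 *: u_ I' i.
(* k = 0: the third direction is generic; k = 1 and k = 2: the segments that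
   join it to g1 and g2 do not meet two walls of a facet at once. *)
have [x Hx] := avoid_family f.
have f0 I i : I \in facets D K -> i \in I :\: K -> u_ I i != 0.
  move=> /facetsP [IS _ _] /finset.setDP[iI _]; apply/negP => /eqP e.
  by have := dualRP Dv i IS iI; rewrite e pairing0l eqxx => /eqP; rewrite eq_sym oner_eq0.
have fg g I i j : DH_direction D v K g -> I \in facets D K -> i \in I :\: K ->
    j \in I :\: K -> i != j ->
    pairing (u_ I i) g *: u_ I j - pairing (u_ I j) g *: u_ I i != 0.
  move=> dg IF iI jI ij; have [IS _ _] := facetsP _ _ _ IF.
  have [jI' _] := finset.setDP jI.
  apply/negP => /eqP /(congr1 (fun w => pairing w (ofZ R (v j)))).
  rewrite pairingBl !pairingZl !(dualRP Dv) // eqxx (negPf ij) mulr1 mulr0 subr0 pairing0l.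
  by move/eqP; apply/negP; apply: dg.
have d3 : DH_direction D v K (ofZ R x).
  by move=> I i IF iI; apply: (Hx (I, i, i, 0)); apply: f0.
rewrite -(@signed_DH_segment K g1 (ofZ R x) s) //; last first.
  move=> I i j IF iI jI ij; have := Hx (I, i, j, 1) (fg _ _ _ _ d1 IF iI jI ij).
  by rewrite /= pairingBl !pairingZl subr_eq0.
rewrite -(@signed_DH_segment K g2 (ofZ R x) s) // => I i j IF iI jI ij.
have := Hx (I, i, j, ord_max) (fg _ _ _ _ d2 IF iI jI ij).
by rewrite /= pairingBl !pairingZl subr_eq0.
Qed.

End SignedCones.

(** * Values and support of the Duistermaat-Heckman function *)

Section DHsigns.
Variables (R : realType) (n : nat) (V : finType) (D : multifan R n V).
Variable v : V -> 'rV[int]_n.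
Hypotheses (Dv : edge_vectors D v).
Implicit Types (I J K L : {set V}) (g x : 'rV[R]_n) (d : V -> R) (u : 'cV[R]_n).

Local Notation u_ I i := (dualR R v I i).

Lemma facets_skel I K : I \in facets D K -> I \in skel D n.
Proof. by move=> /facetsP [IS In _]; apply/skelP. Qed.

Lemma pairing_affine_comb I K d (t : V -> R) g i : I \in facets D K -> i \in I ->
  pairing (\sum_(j in I) d j *: u_ I j + \sum_(j in I :\: K) t j *: dual_plus v g I j)
    (ofZ R (v i))
  = d i + (if i \in I :\: K then (if 0 < pairing (u_ I i) g then t i else - t i) else 0).
Proof.
move=> /facetsP [IS In KI] iI; rewrite pairingDl !pairing_suml; congr (_ + _).
  rewrite (bigD1 i) //= pairingZl (dualRP Dv) // eqxx mulr1 big1 ?addr0 // => j /andP[jI ji].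
  by rewrite pairingZl (dualRP Dv) // (negPf ji) mulr0.
have E j : pairing (t j *: dual_plus v g I j) (ofZ R (v i))
    = if j == i then (if 0 < pairing (u_ I i) g then t i else - t i) else 0.
  rewrite pairingZl /dual_plus; case: eqP => [->|/eqP ji].
    by case: ifP => _; rewrite ?pairingNl (dualRP Dv) // eqxx ?mulrN1 ?mulr1.
  by case: ifP => _; rewrite ?pairingNl (dualRP Dv) // (negPf ji) ?oppr0 mulr0.
under eq_bigr do rewrite E.
rewrite -big_mkcondr /=; have [iIK|iIK] := boolP (i \in I :\: K).
  by rewrite (big_pred1 i) // => j; rewrite /= andbC; case: eqP => // ->.
by rewrite big_pred0 // => j; rewrite andbC; case: eqP => //= ->; apply: negbTE.
Qed.

Lemma DH_coneP g d K I u : I \in facets D K -> affA v d K u ->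
  DH_cone v g d K I u <-> forall i, i \in I :\: K ->
    if 0 < pairing (u_ I i) g then d i <= pairing u (ofZ R (v i))
    else pairing u (ofZ R (v i)) <= d i.
Proof.
move=> IF uK; have ISn := facets_skel IF; have [IS In KI] := facetsP _ _ _ IF.
split.
  move=> [t [t0 ->]] i iIK; have iI : i \in I by case/finset.setDP: iIK.
  rewrite (pairing_affine_comb d t g IF iI) iIK; case: (0 < _).
    by rewrite lerDl; apply: t0.
  by rewrite gerDl oppr_le0; apply: t0.
move=> H.
exists (fun i => `|pairing u (ofZ R (v i)) - d i|); split=> //.
rewrite {1}(expand_dualR Dv u ISn).
have -> : \sum_(i in I :\: K) `|pairing u (ofZ R (v i)) - d i| *: dual_plus v g I i
    = \sum_(i in I) (pairing u (ofZ R (v i)) - d i) *: u_ I i.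
  rewrite [RHS](bigID (fun i => i \in K)) /= [X in _ = X + _]big1 ?add0r.
    apply: eq_big => [i|i iIK]; first by rewrite inE andbC.
    have := H i iIK; rewrite /dual_plus; case: ifP => _ h.
      by rewrite ger0_norm ?subr_ge0.
    by rewrite ler0_norm ?subr_le0 // scaleNr scalerN opprK.
  by move=> i /andP[iI iK]; rewrite uK // subrr scale0r.
by rewrite -big_split /=; apply: eq_bigr => i _; rewrite -scalerDl addrC subrK.
Qed.

Lemma sign_prod g K I : (-1) ^+ #|[set j in I :\: K | 0 < pairing (u_ I j) g]%SET|
  = \prod_(i in I :\: K) (if 0 < pairing (u_ I i) g then -1 else 1) :> R.
Proof.
rewrite -prodr_const [RHS]big_mkcond [LHS]big_mkcond /=; apply: eq_bigr => i _.
by rewrite !inE; case: (i \in K); case: (i \in I) => //=.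
Qed.

Lemma DH_prod g d K u : affA v d K u -> DH D v g d K u =
  \sum_(I in facets D K) (weight D I)%:~R * \prod_(i in I :\: K)
    (if 0 < pairing (u_ I i) g then - (d i <= pairing u (ofZ R (v i)))%R%:R
     else (pairing u (ofZ R (v i)) <= d i)%R%:R).
Proof.
move=> uK; rewrite /DH; apply: eq_bigr => I IF.
rewrite sign_prod mulrAC mulrC; congr (_ * _).
have -> : \1_(DH_cone v g d K I) u = \prod_(i in I :\: K)
    (if 0 < pairing (u_ I i) g then (d i <= pairing u (ofZ R (v i)))%R%:R
     else (pairing u (ofZ R (v i)) <= d i)%R%:R) :> R.
  rewrite indicE; have [H|H] := boolP (u \in _).
    rewrite big1 // => i iIK; move: H; rewrite inE => /(DH_coneP _ IF uK)/(_ i iIK).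
    by case: ifP => _ ->.
  have /existsNP [i /not_implyP [iIK Hi]] : ~ forall i, i \in I :\: K ->
    if 0 < pairing (u_ I i) g then d i <= pairing u (ofZ R (v i))
    else pairing u (ofZ R (v i)) <= d i.
    by move/(DH_coneP _ IF uK) => h; rewrite mem_set in H.
  rewrite (bigD1 i) //=; move: Hi; case: ifP => _ /negP/negPf ->;
  by rewrite mul0r.
rewrite -big_split /=; apply: eq_bigr => i _.
by case: ifP => _; rewrite ?mulN1r ?mul1r.
Qed.

(** Off the walls, strict and large inequalities agree, and membership in each
    cone is read from the sides of its walls. *)
Lemma DH_signed g d K u : DH_direction D v K g -> affA v d K u ->
  (forall I i, I \in facets D K -> i \in I :\: K -> pairing u (ofZ R (v i)) != d i) ->
  DH D v g d K u = signed_DH D v g K (fun i => d i < pairing u (ofZ R (v i))).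
Proof.
move=> dg uK uw; rewrite DH_prod //; apply: eq_bigr => I IF; congr (_ * _).
apply: eq_bigr => i iIK; have := uw I i IF iIK; have := dg I i IF iIK.
rewrite /is_pos; case: (ltgtP 0 (pairing _ g)) => h // _;
  rewrite ?oppr_gt0 ?(lt_gtF h) ?h;
  by case: (ltgtP (pairing u _) (d i)) => // _ _; rewrite ?oppr0.
Qed.

Lemma signed_DH_neq0 g K s : signed_DH D v g K s != 0 ->
  exists2 I, I \in facets D K & forall i, i \in I :\: K ->
    if s i then 0 < pairing (u_ I i) g else pairing (u_ I i) g < 0.
Proof.
move=> H; apply: contrapT => N; move/eqP: H; apply; apply: big1 => I IF.
have [i iIK Hi] : exists2 i, i \in I :\: K &
    ~ (if s i then 0 < pairing (u_ I i) g else pairing (u_ I i) g < 0).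
  apply: contrapT => /forall2NP M; apply: N; exists I => // i iIK.
  by have [//|/contrapT] := M i.
rewrite (bigD1 i) //=; move: Hi; rewrite /is_pos oppr_gt0; case: ifP => _ /negP/negPf ->;
by rewrite ?oppr0 mul0r mulr0.
Qed.

Lemma dual_neq0 I K i : I \in facets D K -> i \in I -> u_ I i != 0.
Proof.
move=> /facetsP [IS _ _] iI; apply/negP => /eqP e.
by have := dualRP Dv i IS iI; rewrite e pairing0l eqxx => /eqP; rewrite eq_sym oner_eq0.
Qed.

Section Support.
Hypothesis cD : complete_multifan D.
Variables (K : {set V}) (g : 'rV[R]_n).
Hypothesis dg : DH_direction D v K g.

Let size_at x : R := \sum_(I in facets D K) \sum_(i in I) `|pairing (u_ I i) x|.

(** By independence, x itself may serve as the direction; the cones then open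
    towards positive values of x, which is bounded below by its value at an
    apex. *)
Lemma support_halfspace x d u (B : R) : DH_direction D v K x ->
  affA v d K u -> 0 <= B -> (forall i, `|d i| <= B) ->
  signed_DH D v g K (fun i => d i < pairing u (ofZ R (v i))) != 0 ->
  - (B * size_at x) <= pairing u x.
Proof.
move=> dx uK B0 dB; rewrite (signed_DH_indep Dv cD _ dg dx) => /signed_DH_neq0 [I IF Hs].
have ISn := facets_skel IF.
have -> : pairing u x = \sum_(i in I) d i * pairing (u_ I i) x
    + \sum_(i in I) (pairing u (ofZ R (v i)) - d i) * pairing (u_ I i) x.
  rewrite -big_split /= {1}(expand_dualR Dv u ISn) pairing_suml; apply: eq_bigr => i _.
  by rewrite pairingZl -mulrDl addrC subrK.
rewrite -[X in X <= _]addr0; apply: lerD; last first.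
  apply: sumr_ge0 => i iI; have [iK|iK] := boolP (i \in K).
    by rewrite uK // subrr mul0r.
  have := Hs i; rewrite inE iK iI => /(_ isT); case: ifP => [h1 h2|/negbT].
    by rewrite mulr_ge0 ?subr_ge0 ?ltW.
  by rewrite -leNgt => h1 h2; apply: mulr_le0; rewrite ?subr_le0 // ltW.
apply: (@le_trans _ _ (- (B * \sum_(i in I) `|pairing (u_ I i) x|))).
  rewrite lerN2 ler_wpM2l // /size_at (bigD1 I) //= lerDl sumr_ge0 // => J _.
  by apply: sumr_ge0.
rewrite mulr_sumr -sumrN; apply: ler_sum => i _.
rewrite lerNl; apply: le_trans (ler_norm _) _.
by rewrite normrN normrM ler_wpM2r.
Qed.

Lemma DH_directionN x : DH_direction D v K x -> DH_direction D v K (- x).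
Proof. by move=> dx I i IF iI; rewrite pairingNr oppr_eq0 dx. Qed.

Lemma support_slab x d u (B : R) : DH_direction D v K x ->
  affA v d K u -> 0 <= B -> (forall i, `|d i| <= B) ->
  signed_DH D v g K (fun i => d i < pairing u (ofZ R (v i))) != 0 ->
  `|pairing u x| <= B * size_at x.
Proof.
move=> dx uK B0 dB H; rewrite ler_norml (support_halfspace dx uK B0 dB H) /=.
have := support_halfspace (DH_directionN dx) uK B0 dB H.
rewrite pairingNr lerN2; congr (_ <= _ * _).
by apply: eq_bigr => I _; apply: eq_bigr => i _; rewrite pairingNr normrN.
Qed.

(** The support lies in a slab for every generic direction, and generic
    directions span. The bound is linear in the size of d, as is needed for
    dilations. *)
Lemma support_bounded : exists2 C : R, 0 <= C & forall d u (B : R),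
  affA v d K u -> 0 <= B -> (forall i, `|d i| <= B) ->
  signed_DH D v g K (fun i => d i < pairing u (ofZ R (v i))) != 0 ->
  forall l, `|u l 0| <= B * C.
Proof.
have [x0 Hx0] := avoid_family (fun t : {set V} * V => u_ t.1 t.2).
have d0 : DH_direction D v K (ofZ R x0).
  move=> I i IF iIK; apply: (Hx0 (I, i)); apply: (dual_neq0 IF).
  by case/finset.setDP: iIK.
(* Perturbations of x0 along the axes, which remain generic. *)
have /choice [t Ht] : forall l : 'I_n, exists t : nat, (0 < t)%N /\
    DH_direction D v K (ofZ R x0 + t%:R *: delta_mx 0 l).
  move=> l.
  have [t] := natr_notin (0 :: [seq - pairing (u_ p.1 p.2) (ofZ R x0) /
    pairing (u_ p.1 p.2) (delta_mx 0 l) | p <- enum {: {set V} * V}]).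
  rewrite inE negb_or pnatr_eq0 -lt0n => /andP[t0 tN]; exists t; split=> // I i IF iIK.
  rewrite pairingDr pairingZr.
  have u0 := d0 I i IF iIK.
  have [e|ul] := eqVneq (pairing (u_ I i) (delta_mx 0 l)) 0; first by rewrite e mulr0 addr0.
  apply: contraNneq tN => e; apply/mapP; exists (I, i); rewrite ?mem_enum //=.
  by apply: (mulIf ul); rewrite divfK //; apply/eqP; rewrite -addr_eq0 addrC e.
exists (size_at (ofZ R x0) + \sum_l size_at (ofZ R x0 + (t l)%:R *: delta_mx 0 l)).
  have s0 x : 0 <= size_at x by apply: sumr_ge0 => I _; apply: sumr_ge0.
  by rewrite addr_ge0 // sumr_ge0.
move=> d u B uK B0 dB H l; have [tl dl] := Ht l.
have h0 := support_slab d0 uK B0 dB H.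
have hl := support_slab dl uK B0 dB H.
apply: (@le_trans _ _ `|(t l)%:R * u l 0|).
  by rewrite normrM normr_nat ler_peMl // ler1n.
have -> : (t l)%:R * u l 0 = pairing u (ofZ R x0 + (t l)%:R *: delta_mx 0 l)
    - pairing u (ofZ R x0).
  by rewrite pairingDr pairingZr pairing_delta addrC addKr.
apply: le_trans (ler_normB _ _) _; rewrite addrC mulrDr; apply: lerD => //.
apply: le_trans hl _; apply: ler_wpM2l => //.
rewrite [X in _ <= X](bigD1 l) //= lerDl; apply: sumr_ge0 => i _.
by apply: sumr_ge0 => I _; apply: sumr_ge0.
Qed.

End Support.
End DHsigns.

(** * Averages over a finite quotient of the lattice *)

Section RootsOfUnity.
Variable R : realType.
Implicit Types (p q : rat).

(** The rational points of the circle: exp (2 pi i q). *)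
Definition ex q : R[i] :=
  let r : R := 2 * pi * ratr q in (cos r +i* sin r)%C.

Lemma exD p q : ex (p + q) = ex p * ex q.
Proof.
rewrite /ex rmorphD /= mulrDr cosD sinD; apply/eqP; rewrite eq_complex /=.
by rewrite eqxx /= addrC.
Qed.

Lemma ex0 : ex 0 = 1.
Proof. by rewrite /ex rmorph0 mulr0 cos0 sin0. Qed.

Lemma exN q : ex (- q) = (ex q)^-1.
Proof.
have := exD q (- q); rewrite subrr ex0 => /esym e.
have e0 : ex q != 0 by apply: contraTneq (oner_neq0 R[i]) => h; rewrite -e h mul0r eqxx.
by apply: (mulfI e0); rewrite e divff.
Qed.

Lemma ex_neq0 q : ex q != 0.
Proof.
by have := exD q (- q); rewrite subrr ex0; apply: contra_eq_neq => ->; rewrite mul0r oner_eq0.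
Qed.

Lemma ex1 : ex 1 = 1.
Proof. by rewrite /ex rmorph1 mulr1 mulrC mulr_natr cos2pi sin2pi. Qed.

Lemma exMn q k : ex (k%:R * q) = ex q ^+ k.
Proof.
elim: k => [|k IH]; first by rewrite mul0r ex0 expr0.
by rewrite -natr1 mulrDl mul1r exD IH exprSr.
Qed.

Lemma exMz q (k : int) : ex (k%:~R * q) = ex q ^ k.
Proof.
case: k => k; first by rewrite -pmulrn exMn.
by rewrite NegzE mulrNz mulNr exN -pmulrn exMn -exprnN.
Qed.

Lemma ex_int q : q \is a Num.int -> ex q = 1.
Proof.
by move=> /intrP [k ->]; rewrite -[k%:~R]mulr1 exMz ex1 exp1rz.
Qed.

Lemma ex_eq1 q : (ex q == 1) = (q \is a Num.int).
Proof.
apply/eqP/idP => [|/ex_int //].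
pose f := q - (Num.floor q)%:~R.
have f0 : 0 <= f by rewrite subr_ge0 Num.Theory.floor_le.
have f1 : f < 1 by have := Num.Theory.floorD1_gt q; rewrite /f intrD ltrBlDl.
rewrite -[q](subrK (Num.floor q)%:~R) -/f exD [X in _ * X]ex_int ?mulr1 => [e|]; last first.
  by apply/intrP; exists (Num.floor q).
suff -> : f = 0 by rewrite add0r; apply/intrP; exists (Num.floor q).
have {e} : cos (2 * pi * ratr f : R) = 1 by move/eqP: e; rewrite eq_complex /= => /andP[/eqP].
have -> : 2 * pi * ratr f = (pi * ratr f) *+ 2 :> R by rewrite -mulrA mulr_natl.
rewrite cos_mulr2n => /eqP; rewrite -subr_eq0.
have -> : cos (pi * ratr f) ^+ 2 *+ 2 - 1 - 1 = - (2 * sin (pi * ratr f) ^+ 2) :> R.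
  by have := cos2Dsin2 (pi * ratr f : R); rewrite -mulr_natl; set a := cos _ ^+ 2; set b := sin _ ^+ 2; lra.
rewrite oppr_eq0 mulf_eq0 pnatr_eq0 /= sqrf_eq0 => /eqP s0.
move: f0; rewrite le_eqVlt => /orP[/eqP //|fp].
suff : 0 < sin (pi * ratr f : R) by rewrite s0 ltxx.
have fR : 0 < (ratr f : R) by rewrite ltr0q.
apply: sin_gt0_pi; rewrite (mulr_gt0 (pi_gt0 R) fR) /=.
by rewrite gtr_pMr ?pi_gt0 // -(rmorph1 (ratr : rat -> R)) ltr_rat.
Qed.

End RootsOfUnity.

Section Box.
Variables (R : realType) (n m : nat).
Local Notation N := m.+2.
Local Notation Box := 'rV['I_N]_n.
Implicit Types (xi zeta : Box) (u : 'cV[rat]_n).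

(** Representatives of the lattice modulo m.+2 times the lattice. The modulus is
    meant to be a multiple of the denominators of the dual vectors. *)
Definition box_lift xi : 'rV[int]_n := map_mx (fun a : 'I_N => (a : nat)%:Z) xi.

Lemma box_liftD xi zeta : exists w : 'rV[int]_n, box_lift (xi + zeta) = box_lift xi + box_lift zeta - N%:Z *: w.
Proof.
exists (\row_j ((xi 0%R j + zeta 0%R j)%N %/ N)%N%:Z).
apply/rowP => j; rewrite !mxE /=.
rewrite -PoszD {2}(divn_eq (xi 0%R j + zeta 0%R j) N) PoszD PoszM mulrC addrAC subrr add0r.
by [].
Qed.

Lemma box_lift_surj (x : 'rV[int]_n) : exists xi, exists w : 'rV[int]_n, x = box_lift xi + N%:Z *: w.
Proof.
have H j : (`|(x 0%R j %% N)%Z|%N < N)%N.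
  by rewrite -ltz_nat gez0_abs ?modz_ge0 // ltz_pmod.
exists (\row_j Ordinal (H j)), (\row_j (x 0%R j %/ N)%Z).
apply/rowP => j; rewrite !mxE /= gez0_abs ?modz_ge0 // addrC mulrC.
exact: divz_eq.
Qed.

Definition denom_dvd u := forall w : 'rV[int]_n, pairing u (ofZ rat (N%:Z *: w)) \is a Num.int.

Definition coord u xi : rat := pairing u (ofZ rat (box_lift xi)).

Lemma coordD u xi zeta : denom_dvd u ->
  coord u (xi + zeta) - (coord u xi + coord u zeta) \is a Num.int.
Proof.
move=> uN; have [w e] := box_liftD xi zeta.
rewrite /coord e /ofZ !(map_mxB, map_mxD) pairingBr pairingDr addrAC subrr sub0r rpredN.
exact: uN.
Qed.

Lemma ex_coordD u xi zeta : denom_dvd u ->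
  ex R (coord u (xi + zeta)) = ex R (coord u xi) * ex R (coord u zeta).
Proof.
move=> uN; rewrite -exD; have := coordD xi zeta uN; rewrite -(ex_eq1 R) exD exN => /eqP e.
have := ex_neq0 R (coord u xi + coord u zeta) => h.
by apply: (mulIf (invr_neq0 h)); rewrite e divff.
Qed.

Definition avg (f : Box -> R[i]) : R[i] := #|{: Box}|%:R^-1 * \sum_xi f xi.

Lemma card_box_neq0 : #|{: Box}|%:R != 0 :> R[i].
Proof. by rewrite pnatr_eq0 -lt0n; apply/card_gt0P; exists 0. Qed.

Lemma avg_const c : avg (fun=> c) = c.
Proof. by rewrite /avg sumr_const -[c *+ _]mulr_natl mulKf // card_box_neq0. Qed.

Lemma avgM c f : avg (fun xi => c * f xi) = c * avg f.
Proof. by rewrite /avg -mulr_sumr mulrCA. Qed.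

Lemma avg_sum (T : Type) (r : seq T) (P : pred T) (f : T -> Box -> R[i]) :
  avg (fun xi => \sum_(t <- r | P t) f t xi) = \sum_(t <- r | P t) avg (f t).
Proof. by rewrite /avg exchange_big /= mulr_sumr. Qed.

Lemma sum_box_translate (f : Box -> R[i]) zeta : \sum_xi f (xi + zeta) = \sum_xi f xi.
Proof. by rewrite [RHS](reindex_inj (addIr zeta)). Qed.

Definition integral_form u : bool := [forall l, u l 0 \is a Num.int].

Lemma integral_formP u : reflect (exists w : 'cV[int]_n, u = ofZ rat w) (integral_form u).
Proof.
apply: (iffP forallP) => [H|[w ->] l]; last by rewrite mxE; apply/intrP; exists (w l 0).
have /choice [w Hw] : forall l, exists k : int, u l 0 = k%:~R by move=> l; exact/intrP.
by exists (\col_l w l); apply/colP => l; rewrite !mxE.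
Qed.

Lemma box_lift_delta l : box_lift (delta_mx 0 l) = delta_mx 0 l.
Proof. by apply/rowP => j; rewrite !mxE /=; case: eqP. Qed.

(** Orthogonality of the characters of a finite quotient of the lattice. *)
Lemma avg_character u : denom_dvd u ->
  avg (fun xi => ex R (coord u xi)) = (integral_form u)%:R.
Proof.
move=> uN; have [ui|ui] := boolP (integral_form u).
  rewrite -[RHS](avg_const 1); congr (_ * _); apply: eq_bigr => xi _.
  apply: ex_int; have /integral_formP [w ->] := ui.
  by rewrite /coord pairing_ofZ; apply/intrP; eexists.
have /forallPn [l ul] := ui.
have c1 : ex R (coord u (delta_mx 0 l)) != 1.
  by rewrite ex_eq1 /coord box_lift_delta /ofZ map_delta_mx pairing_delta.
set S := \sum_xi ex R (coord u xi).
have : S * ex R (coord u (delta_mx 0 l)) = S.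
  rewrite /S -[RHS](sum_box_translate _ (delta_mx 0 l)) mulr_suml.
  by apply: eq_bigr => xi _; rewrite ex_coordD.
rewrite /avg -/S => /eqP; rewrite -{2}[S]mulr1 -subr_eq0 -mulrBr mulf_eq0 subr_eq0 (negPf c1) orbF.
by move=> /eqP ->; rewrite mulr0.
Qed.

End Box.

Section Denominators.
Variables (n : nat).

Lemma denom_dvdP (m : nat) (u : 'cV[rat]_n) :
  (forall l, m.+2%:R * u l 0 \is a Num.int) -> denom_dvd m u.
Proof.
move=> H w; rewrite pairingE; apply: rpred_sum => j _.
rewrite !mxE intrM -mulrA mulrCA; apply: rpredM; first by apply/intrP; eexists.
exact: H.
Qed.

Lemma exists_denom (V : finType) (v : V -> 'rV[int]_n) :
  exists m, forall I i, denom_dvd m (dual v I i).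
Proof.
have [k k0 Hk] := common_denom (fun t : {set V} * V * 'I_n => dual v t.1.1 t.1.2 t.2 0).
(* Doubling gives a denominator of the form m.+2. *)
exists (k.*2.-2) => I i; apply: denom_dvdP => l.
have -> : k.*2.-2.+2 = k.*2 by case: k k0 {Hk} => // k _; rewrite doubleS.
have [c Hc] := Hk (I, i, l).
rewrite -mul2n natrM -mulrA Hc; apply: rpredM; last by apply/intrP; eexists.
by apply/intrP; exists 2.
Qed.

End Denominators.

(** * The groups H_{J,V} in the torsion points *)

Section BoxCosets.
Variables (R : realType) (n : nat) (V : finType) (D : multifan R n V).
Variables (v : V -> 'rV[int]_n) (m : nat).
Hypotheses (Dv : edge_vectors D v).
Variables (I J : {set V}).
Hypotheses (IS : I \in skel D n) (JI : J \subset I).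
Hypothesis dm : forall i, denom_dvd m (dual v I i).
Local Notation Box := 'rV['I_m.+2]_n.
Implicit Types (xi zeta : Box).

Let ISs : I \in simplices D. Proof. by case/skelP: IS. Qed.
Let JS : J \in simplices D. Proof. exact: mem_simplices_sub ISs JI. Qed.

(** The points of N whose coordinates off J are integers are those congruent to
    points of N_J modulo edge vectors, hence have a class in H_{J,V}. *)
Definition off_integral xi : bool :=
  [forall i in I :\: J, coord (dual v I i) xi \is a Num.int].

Let proj xi : 'rV[int]_n :=
  box_lift xi - \sum_(i in I :\: J) Num.floor (coord (dual v I i) xi) *: v i.

Let class xi : set 'rV[int]_n := [set proj xi + y | y in latNV v J].

Let pairing_edges (c : V -> int) (A : {set V}) i : A \subset I -> i \in I ->
  pairing (dual v I i) (ofZ rat (\sum_(j in A) c j *: v j)) = if i \in A then (c i)%:~R else 0.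
Proof.
move=> AI iI; rewrite ofZ_sum pairing_sumr; under eq_bigr do rewrite ofZZ pairingZr.
have [iA|iA] := boolP (i \in A).
  rewrite (bigD1 i) //= (dualP Dv) // eqxx mulr1 big1 ?addr0 // => j /andP[jA ji].
  by rewrite (dualP Dv) ?(fintype.subsetP AI) // eq_sym (negPf ji) mulr0.
rewrite big1 // => j jA; rewrite (dualP Dv) ?(fintype.subsetP AI) //.
by case: eqP => [ij|_]; [rewrite ij jA in iA | rewrite mulr0].
Qed.

Let pairing_proj xi i : off_integral xi -> i \in I ->
  pairing (dual v I i) (ofZ rat (proj xi)) = if i \in J then coord (dual v I i) xi else 0.
Proof.
move=> /forall_inP xiS iI.
rewrite /proj /ofZ map_mxB -/(ofZ _ _) -/(ofZ _ _) pairingBr pairing_edges ?finset.subsetDl //.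
rewrite !inE iI andbT -/(coord _ _); case: (boolP (i \in J)) => iJ; rewrite ?subr0 //=.
by rewrite floorK ?subrr // xiS // inE iI iJ.
Qed.

Let latN_proj xi : off_integral xi -> latN D J (proj xi).
Proof.
move=> xiS; apply/(latNP Dv IS JI) => i /finset.setDP[iI iJ].
by rewrite pairing_proj // (negPf iJ).
Qed.

Let latN_eq x y : latN D J x -> latN D J y ->
  (forall j, j \in J -> pairing (dual v I j) (ofZ rat x) = pairing (dual v I j) (ofZ rat y)) -> x = y.
Proof.
move=> /(latNP Dv IS JI) x0 /(latNP Dv IS JI) y0 e; apply: (@ofZ_inj rat).
rewrite (expand_edgesQ Dv (ofZ rat x) IS) (expand_edgesQ Dv (ofZ rat y) IS).
apply: eq_bigr => i iI; congr (_ *: _).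
by have [/e //|iJ] := boolP (i \in J); rewrite x0 ?y0 // inE iI iJ.
Qed.

Let latN_edges (c : V -> int) : latN D J (\sum_(j in J) c j *: v j).
Proof.
apply/(latNP Dv IS JI) => i /finset.setDP[iI iJ].
by rewrite pairing_edges // (negPf iJ).
Qed.

Let latND x y : latN D J x -> latN D J y -> latN D J (x + y).
Proof.
move=> /(latNP Dv IS JI) x0 /(latNP Dv IS JI) y0; apply/(latNP Dv IS JI) => i iIJ.
by rewrite /ofZ map_mxD pairingDr x0 // y0 // addr0.
Qed.

Let latNV0 : latNV v J 0.
Proof. by exists (fun=> 0); rewrite big1 // => i _; rewrite scale0r. Qed.

Let latNVD x y : latNV v J x -> latNV v J y -> latNV v J (x + y).
Proof.
move=> [c ->] [c' ->]; exists (fun i => c i + c' i).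
by rewrite -big_split /=; apply: eq_bigr => i _; rewrite scalerDl.
Qed.

Let latNVN x : latNV v J x -> latNV v J (- x).
Proof.
move=> [c ->]; exists (fun i => - c i).
by rewrite -sumrN; apply: eq_bigr => i _; rewrite scaleNr.
Qed.

Let coset_eq x y : latNV v J (x - y) ->
  [set x + z | z in latNV v J] = [set y + z | z in latNV v J].
Proof.
move=> xy; apply/seteqP; split=> _ [z zN <-].
  by exists (x - y + z); [exact: latNVD | rewrite addrA [y + _]addrC subrK].
exists (- (x - y) + z); first by apply: latNVD => //; exact: latNVN.
by rewrite addrA opprB [x + _]addrC subrK.
Qed.

Let diff_integral xi zeta : bool :=
  [forall i in I, coord (dual v I i) xi - coord (dual v I i) zeta \is a Num.int].

Let latN_diff x y : latN D J x -> latN D J y ->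
  (forall j, j \in J -> pairing (dual v I j) (ofZ rat x) - pairing (dual v I j) (ofZ rat y)
     \is a Num.int) -> latNV v J (x - y).
Proof.
move=> xN yN H.
have /choice [c Hc] : forall j, exists k : int, j \in J ->
    pairing (dual v I j) (ofZ rat x) - pairing (dual v I j) (ofZ rat y) = k%:~R.
  move=> j; have [/H/intrP [k e]|_] := boolP (j \in J); last by exists 0.
  by exists k.
exists c; apply/eqP; rewrite subr_eq; apply/eqP; apply: latN_eq => //.
  by apply: latND => //; exact: latN_edges.
move=> j jJ; rewrite /ofZ map_mxD -/(ofZ _ _) -/(ofZ _ _) pairingDr.
rewrite pairing_edges // ?(fintype.subsetP JI) // jJ.
by rewrite -Hc // subrK.
Qed.

(** Rounding the coordinates off J is compatible with congruence modulo the
    edges. *)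
Let class_eq xi zeta : off_integral zeta ->
  (off_integral xi && (class xi == class zeta)) = diff_integral xi zeta.
Proof.
move=> zS; apply/andP/forall_inP.
  move=> [xS /eqP e] i iI.
  have [iJ|iJ] := boolP (i \in J); last first.
    have iIJ : i \in I :\: J by rewrite inE iI iJ.
    exact: rpredB (forall_inP xS i iIJ) (forall_inP zS i iIJ).
  have : class zeta (proj xi) by rewrite -e; exists 0; rewrite ?addr0.
  move=> [_ [c ->] e'].
  have := pairing_proj xS iI; rewrite iJ => <-.
  have := pairing_proj zS iI; rewrite iJ => <-.
  rewrite -e' /ofZ map_mxD -/(ofZ _ _) -/(ofZ _ _) pairingDr pairing_edges // iJ addrAC subrr add0r.
  by apply/intrP; eexists.
move=> H.
have xS : off_integral xi.
  apply/forall_inP => i iIJ; have [iI _] := finset.setDP iIJ.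
  rewrite -[coord _ xi](subrK (coord (dual v I i) zeta)); apply: rpredD; first exact: H.
  by move/forall_inP: zS; apply.
split; first exact: xS.
apply/eqP; apply: coset_eq; apply: latN_diff (latN_proj xS) (latN_proj zS) _.
move=> j jJ; have jI := fintype.subsetP JI _ jJ.
by rewrite !pairing_proj // jJ; exact: H.
Qed.

Let class_surj h : quotH D v J h -> exists2 xi, off_integral xi & h = class xi.
Proof.
move=> [x xN ->]; have [xi [w e]] := box_lift_surj m x.
have E i : pairing (dual v I i) (ofZ rat x)
    = coord (dual v I i) xi + pairing (dual v I i) (ofZ rat (m.+2%:Z *: w)).
  by rewrite {1}e /ofZ map_mxD pairingDr.
have xS : off_integral xi.
  apply/forall_inP => i iIJ.
  have /eqP := (latNP Dv IS JI x).1 xN i iIJ; rewrite E addr_eq0 => /eqP ->.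
  by rewrite rpredN; exact: dm.
exists xi => //; apply: coset_eq; apply: latN_diff => //; first exact: latN_proj.
move=> j jJ; have jI := fintype.subsetP JI _ jJ.
by rewrite pairing_proj // jJ E addrAC subrr add0r; exact: dm.
Qed.

Lemma quotH_image : quotH D v J = class @` [set xi | off_integral xi].
Proof.
apply/seteqP; split=> h.
  by move=> /class_surj [xi xS ->]; exists xi.
by move=> [xi xS <-]; exists (proj xi) => //; exact: latN_proj.
Qed.

Lemma quotH_finite : finite_set (quotH D v J).
Proof. by rewrite quotH_image; apply: finite_image; exact: finite_finset. Qed.

Let quotHP h : reflect (quotH D v J h) (h \in enum_fset (fset_set (quotH D v J))).
Proof.
have := in_fset_set quotH_finite h; rewrite -[h \in enum_fset _]/(h \in fset_set _) => ->.
by apply: (iffP idP) => [/set_mem|/mem_set].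
Qed.

Let chi_class xi j : off_integral xi -> j \in J ->
  chi R v J j (class xi) = ex R (coord (dual v I j) xi).
Proof.
move=> xS jJ; have jI := fintype.subsetP JI _ jJ.
rewrite /chi -/(ex R _).
have [_ [c ->] <-] : class xi (lift_of (class xi)).
  apply: xgetPex; exists (proj xi + 0); by exists 0.
have E : ofZ rat (proj xi + \sum_(i in J) c i *: v i)
    = \sum_(i in J) (coord (dual v I i) xi + (c i)%:~R) *: ofZ rat (v i).
  rewrite (expand_edgesQ Dv (ofZ rat _) IS) (bigID (fun i => i \in J)) /= [X in _ + X]big1.
    rewrite addr0; apply: eq_big => i.
      by have [/(fintype.subsetP JI) ->|] := boolP (i \in J); rewrite ?andbF.
    move=> /andP[iI iJ]; rewrite /ofZ map_mxD -/(ofZ _ _) -/(ofZ _ _) pairingDr.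
    by rewrite pairing_proj // pairing_edges // iJ.
  move=> i /andP[iI iJ]; rewrite /ofZ map_mxD -/(ofZ _ _) -/(ofZ _ _) pairingDr.
  by rewrite pairing_proj // pairing_edges // (negPf iJ) addr0 scale0r.
rewrite E pairing_sumr (bigD1 j) //= pairingZr (dualP Dv) // eqxx mulr1 big1 ?addr0.
  by rewrite exD [X in _ * X]ex_int ?mulr1 //; apply/intrP; eexists.
by move=> i /andP[iJ ij]; rewrite pairingZr (dualP Dv) // eq_sym (negPf ij) mulr0.
Qed.

Let diff_translate xi zeta : diff_integral (xi + zeta) zeta = diff_integral xi 0.
Proof.
have c0 i : coord (dual v I i) (0 : Box) \is a Num.int.
  have := coordD 0 0 (dm i); rewrite addr0 opprD addrA subrr sub0r rpredN.
  by [].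
apply: eq_forallb_in => i iI.
have := coordD xi zeta (dm i); have := c0 i.
set x := coord _ xi; set y := coord _ zeta; set t := coord _ (xi + zeta); set z := coord _ 0.
move=> zi ti; apply/idP/idP => h.
  have -> : x - z = (t - y) - (t - (x + y)) - z by ring.
  exact: rpredB (rpredB h ti) zi.
have -> : t - y = (t - (x + y)) + ((x - z) + z) by ring.
exact: rpredD ti (rpredD h zi).
Qed.

Let fiber_card xi : off_integral xi ->
  #|[pred zeta | off_integral zeta && (class zeta == class xi)]| = #|[pred zeta | diff_integral zeta 0]|.
Proof.
move=> xS; rewrite -!sum1_card /=.
rewrite (reindex_inj (addIr xi)) /=; apply: eq_bigl => zeta.
by rewrite !inE class_eq // diff_translate.
Qed.

(** The rounding map onto H_{J,V} has fibres of equal cardinality. *)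
Lemma sum_off_integral (G : set 'rV[int]_n -> R[i]) :
  \sum_(xi | off_integral xi) G (class xi)
  = #|[pred zeta | diff_integral zeta 0]|%:R * \sum_(h \in quotH D v J) G h.
Proof.
rewrite fsbig_finite /=; last exact: quotH_finite.
rewrite big_distrr /=.
transitivity (\sum_(xi | off_integral xi) \sum_(h <- fset_set (quotH D v J) | h == class xi) G h).
  apply: eq_bigr => xi xS; rewrite -big_filter.
  have -> : [seq h <- fset_set (quotH D v J) | h == class xi] = [:: class xi].
    apply: filter_pred1_uniq; first exact: fset_uniq.
    by apply/quotHP; rewrite quotH_image; exists xi.
  by rewrite big_seq1.
rewrite (exchange_big_dep xpredT) //= big_seq [RHS]big_seq; apply: eq_bigr => h.
move=> /quotHP /class_surj [xi xS ->].
rewrite -(fiber_card xS) mulr_natl -sumr_const; apply: eq_bigl => zeta.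
rewrite inE; move: (class xi) (class zeta) (off_integral zeta) => c c' b.
by rewrite eq_sym.
Qed.

(** This is |H_{J,V}| / |H_{I,V}|. *)
Definition off_density : R[i] := avg (fun xi : Box => (off_integral xi)%:R).

(** Rounding the coordinates off J is a surjection onto H_{J,V} with equal
    fibres, and it does not change the characters of the coordinates on J. *)
Theorem avg_quotH (G : (V -> R[i]) -> R[i]) :
  (forall c c', (forall j, j \in J -> c j = c' j) -> G c = G c') ->
  avg (fun xi : Box => (off_integral xi)%:R * G (fun j => ex R (coord (dual v I j) xi)))
  = off_density * (#|` fset_set (quotH D v J)|%fset%:R^-1
      * \sum_(h \in quotH D v J) G (fun j => chi R v J j h)).
Proof.
move=> GJ; rewrite /avg.
have S1 (H : Box -> R[i]) : \sum_xi (off_integral xi)%:R * H xi = \sum_(xi | off_integral xi) H xi.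
  rewrite [RHS]big_mkcond; apply: eq_bigr => xi _.
  by case: ifP => _; rewrite ?mul1r ?mul0r.
have -> : \sum_xi (off_integral xi)%:R * G (fun j => ex R (coord (dual v I j) xi))
    = #|[pred zeta | diff_integral zeta 0]|%:R * \sum_(h \in quotH D v J) G (fun j => chi R v J j h).
  rewrite S1 -(sum_off_integral (fun h => G (fun j => chi R v J j h))); apply: eq_bigr => xi xS.
  by apply: GJ => j jJ; rewrite chi_class.
have E : \sum_xi (off_integral xi)%:R
    = #|[pred zeta | diff_integral zeta 0]|%:R * #|` fset_set (quotH D v J)|%fset%:R :> R[i].
  have := sum_off_integral (fun=> 1); rewrite -S1.
  under eq_bigr do rewrite mulr1.
  move=> ->; congr (_ * _); rewrite fsbig_finite /=; last exact: quotH_finite.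
  by rewrite big_const_seq count_predT iter_addr addr0.
rewrite /off_density /avg E.
set c := #|[pred zeta | _]|%:R; set H := #|` _|%fset%:R; set S := \sum_(h \in _) _.
have H0 : H != 0.
  rewrite /H pnatr_eq0 cardfs_eq0; apply/negP => /eqP e.
  have : class 0 \in enum_fset (fset_set (quotH D v J)).
    apply/quotHP; rewrite quotH_image; exists 0 => //=.
    apply/forall_inP => i _; rewrite -[coord _ 0]subr0.
    have := coordD (0 : Box) 0 (dm i); rewrite addr0 opprD addrA subrr sub0r rpredN subr0 //.
  by rewrite e.
by rewrite -!mulrA (mulrA H) divff // mul1r.
Qed.

End BoxCosets.

(** * The Laurent coefficients *)

Section Laurent.
Variable R : realType.

(** Division of power series, one coefficient at a time. *)
Lemma convolution_solve (F : fieldType) (f t : nat -> F) : f 0%N != 0 ->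
  exists b, forall m, \sum_(l < m.+1) f l * b (m - l)%N = t m.
Proof.
move=> f0.
pose step (s : seq F) := rcons s
  ((t (size s) - \sum_(l < size s) f l.+1 * s`_(size s - l.+1)) / f 0%N).
pose bs m := iter m step [::].
have sz m : size (bs m) = m by elim: m => //= m IH; rewrite size_rcons IH.
have stable m k : (m <= k)%N -> forall i, (i < m)%N -> (bs k)`_i = (bs m)`_i.
  elim: k => [|k IH]; first by rewrite leqn0 => /eqP ->.
  rewrite leq_eqVlt => /orP[/eqP -> //|mk] i im.
  by rewrite /= /step nth_rcons sz (leq_trans im mk) IH.
exists (fun m => (bs m.+1)`_m) => m.
rewrite big_ord_recl subn0 {1}/bs /= -/(bs m) /step nth_rcons sz ltnn eqxx.
rewrite mulrC divfK //.
have -> : \sum_(l < m) f l.+1 * (bs m)`_(m - l.+1) =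
    \sum_(i < m) f (lift ord0 i) * (bs (m - lift ord0 i).+1)`_(m - lift ord0 i).
  apply: eq_bigr => i _; congr (_ * _); rewrite /= /bump /= add1n.
  have im : (m - i.+1 < m)%N by rewrite ltn_subrL (leq_ltn_trans _ (ltn_ord i)).
  by apply: (stable (m - i.+1).+1 m).
by rewrite subrK.
Qed.

(** For c = 1 the denominator vanishes at 0 to the first order, so that the
    equations are solved after a shift by one. *)
Lemma laurent_coefP (c : R[i]) m :
  \sum_(l < m.+1) denom_coef c l * laurent_coef c (m - l)%N = (m == 1%N)%:R.
Proof.
suff H : exists b : nat -> R[i], forall m : nat,
    \sum_(l < m.+1) denom_coef c l * b (m - l)%N = (m == 1%N)%:R.
  exact: (xgetPex (fun=> 0) H m).
have [c1|c1] := eqVneq c 1; last first.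
  apply: convolution_solve; rewrite /denom_coef expr0 fact0 divr1 mulr1.
  by rewrite subr_eq0 eq_sym.
have [b Hb] := @convolution_solve _ (fun l => denom_coef c l.+1) (fun m => (m == 0%N)%:R)
  ltac:(by rewrite /denom_coef c1 expr1 divr1 sub0r mul1r opprK oner_eq0).
exists b => -[|{}m].
  by rewrite big_ord1 /denom_coef c1 expr0 divr1 mulr1 subrr mul0r.
rewrite big_ord_recl {1}/denom_coef c1 expr0 fact0 divr1 mulr1 subrr mul0r add0r.
rewrite eqSS -(Hb m) c1; apply: eq_bigr => i _.
by rewrite /= /bump /= add1n subSS.
Qed.

(** There is a pole only at the trivial character. *)
Lemma laurent_coef0 (c : R[i]) : laurent_coef c 0 = (c == 1)%:R.
Proof.
have := laurent_coefP c 0; rewrite big_ord1 /denom_coef expr0 fact0 divr1 mulr1.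
have [-> _|c1] := eqVneq c 1.
  have := laurent_coefP 1 1; rewrite big_ord_recl big_ord1 /= /denom_coef.
  rewrite expr0 fact0 !divr1 mulr1 subrr mul0r add0r /bump /= sub0r expr1 mul1r opprK mul1r.
  by rewrite subnn.
by move/eqP; rewrite mulf_eq0 subr_eq0 eq_sym (negPf c1) => /eqP.
Qed.

End Laurent.

(** * The lattice point count *)

Section LatticeCount.
Variables (R : realType) (n : nat) (V : finType) (D : multifan R n V).
Variables (v : V -> 'rV[int]_n) (m : nat).
Hypotheses (Dv : edge_vectors D v).
Hypothesis dm : forall I i, denom_dvd m (dual v I i).
Variables (K : {set V}) (g : 'rV[int]_n) (az : {set V} -> V -> int).
Hypothesis azE : forall I i, I \in facets D K -> i \in I :\: K ->
  pairing (dual v I i) (ofZ rat g) = (az I i)%:~R.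
Hypothesis az0 : forall I i, I \in facets D K -> i \in I :\: K -> az I i != 0.
Variables (d : V -> int) (uI : {set V} -> 'cV[int]_n).
Hypothesis uIE : forall I, I \in skel D n ->
  ofZ rat (uI I) = \sum_(i in I) (d i)%:~R *: dual v I i.
Implicit Types (I J L : {set V}) (u : 'cV[int]_n).
Local Notation C := R[i].
Local Notation Box := 'rV['I_m.+2]_n.

Definition vertex_root I i (xi : Box) : C := ex R (coord (dual v I i) xi).

Definition lattice_slice : set 'cV[int]_n := [set u | forall i, i \in K -> pairing u (v i) = d i].
Definition side u (i : V) : bool := d i < pairing u (v i).

Definition in_cone I u : bool := [forall i in I :\: K,
  if 0 < az I i then side u i else pairing u (v i) <= d i].
Definition cone_sign I : C := \prod_(i in I :\: K) (if 0 < az I i then -1 else 1).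

Lemma signed_DH_cones u : ((signed_DH D v (ofZ R g) K (side u))%:C)%C =
  \sum_(I in facets D K) (weight D I)%:~R * (if in_cone I u then cone_sign I else 0).
Proof.
rewrite /signed_DH rmorph_sum /=; apply: eq_bigr => I IF.
rewrite rmorphM /= rmorph_int; congr (_ * _).
rewrite rmorph_prod /=.
have gE i : i \in I :\: K -> pairing (dualR R v I i) (ofZ R g) = (az I i)%:~R.
  by move=> iIK; rewrite /dualR pairing_ratr azE // ratr_int.
have [ic|ic] := boolP (in_cone I u).
  apply: eq_bigr => i iIK; rewrite (gE i iIK); have := forall_inP ic i iIK.
  rewrite /is_pos -rmorphN /= !ltr0z oppr_gt0.
  have [ap|an|az_0] := ltgtP 0 (az I i); last by have := az0 IF iIK; rewrite -az_0 eqxx.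
    by move=> ->; rewrite rmorphN.
  by rewrite /side ltNge => -> //=.
move: ic; rewrite /in_cone negb_forall_in => /exists_inP [i iIK Hi].
rewrite (bigD1 i) //= (gE i iIK); move: Hi.
rewrite /is_pos -rmorphN /= !ltr0z oppr_gt0.
have [ap|an|az_0] := ltgtP 0 (az I i); last by have := az0 IF iIK; rewrite -az_0 eqxx.
  by move=> /negPf ->; rewrite mul0r.
by rewrite -ltNge -/(side u i) => ->; rewrite oppr0 mul0r.
Qed.

Variables (C0 A : nat).
Hypothesis C0P : forall I, I \in facets D K -> 0 <= pairing (uI I) g + C0%:Z.
Hypothesis A0 : (0 < A)%N.
Hypothesis AP : forall I i, I \in facets D K -> i \in I :\: K -> (m.+2 * `|az I i| %| A)%N.

Let quo I i : nat := (A %/ `|az I i|)%N.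

Let az_gt0 I i : I \in facets D K -> i \in I :\: K -> (0 < `|az I i|)%N.
Proof. by move=> IF iIK; rewrite absz_gt0 az0. Qed.

Let quoE I i : I \in facets D K -> i \in I :\: K -> (`|az I i| * quo I i = A)%N.
Proof.
move=> IF iIK; rewrite mulnC divnK //.
by apply: dvdn_trans (AP IF iIK); rewrite dvdn_mull.
Qed.

Let quo_gt0 I i : I \in facets D K -> i \in I :\: K -> (0 < quo I i)%N.
Proof.
move=> IF iIK; rewrite divn_gt0 ?az_gt0 // dvdn_leq //.
by apply: dvdn_trans (AP IF iIK); rewrite dvdn_mull.
Qed.

Lemma vertex_root_neq0 I i xi : vertex_root I i xi != 0.
Proof. exact: ex_neq0. Qed.

(** Sums along the rays of all facets are cut at the common multiple T * A of
    the steps, where all characters have come back to 1. *)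
Lemma vertex_root_period I i xi T : I \in facets D K -> i \in I :\: K ->
  vertex_root I i xi ^+ (T * quo I i) = 1.
Proof.
move=> IF iIK; rewrite /vertex_root -exMn; apply: ex_int.
have /dvdnP [q qE] : (m.+2 %| quo I i)%N.
  have := AP IF iIK; rewrite -(quoE IF iIK) [(m.+2 * _)%N]mulnC dvdn_pmul2l //.
  exact: az_gt0.
rewrite qE !natrM -!mulrA; apply: rpredM; first by apply/intrP; exists (T%:Z).
apply: rpredM; first by apply/intrP; exists (q%:Z).
have := dm I i (box_lift xi); rewrite ofZZ pairingZr; exact.
Qed.

(** The pairing with g, shifted by C0 so that the vertices have non-negative
    height. *)
Definition height u : nat := absz (pairing u g + C0%:Z).

Definition avg_poly (f : Box -> {poly C}) : {poly C} := #|{: Box}|%:R^-1 *: \sum_xi f xi.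

Lemma coef_avg_poly f k : (avg_poly f)`_k = avg (fun xi => (f xi)`_k).
Proof. by rewrite coefZ coef_sum. Qed.

Lemma avg_polyMl f P : avg_poly f * P = avg_poly (fun xi => f xi * P).
Proof. by rewrite /avg_poly -scalerAl mulr_suml. Qed.

Let Z T := (T * A).+1.

(** A truncation of the generating function by height of the points of the cone
    of I, before averaging: the coordinates on the rays run over all integers,
    and the average over xi keeps the lattice points. *)
Definition cone_series T I (xi : Box) : {poly C} := 'X^(height (uI I)) *
  \prod_(i in I :\: K) ray_sum (Z T) (az I i) (vertex_root I i xi) (T * quo I i).

Lemma lattice_decomp I u : I \in facets D K -> lattice_slice u ->
  ofZ rat u = ofZ rat (uI I) + \sum_(i in I :\: K) (pairing u (v i) - d i)%:~R *: dual v I i.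
Proof.
move=> IF uK; have IS := facets_skel IF.
rewrite (expand_dual Dv (ofZ rat u) IS) (uIE IS).
have -> : \sum_(i in I :\: K) (pairing u (v i) - d i)%:~R *: dual v I i
    = \sum_(i in I) (pairing u (v i) - d i)%:~R *: dual v I i.
  rewrite [RHS](bigID (fun i => i \in K)) /= [X in _ = X + _]big1 ?add0r.
    by apply: eq_bigl => i; rewrite inE andbC.
  by move=> i /andP[iI iK]; rewrite uK // subrr scale0r.
rewrite -big_split /=; apply: eq_bigr => i _.
by rewrite -scalerDl pairing_ofZ rmorphB /= addrC subrK.
Qed.

Lemma pairing_lattice_decomp I u : I \in facets D K -> lattice_slice u ->
  pairing u g = pairing (uI I) g + \sum_(i in I :\: K) (pairing u (v i) - d i) * az I i.
Proof.
move=> IF uK; apply: (@intr_inj rat); rewrite rmorphD rmorph_sum /= -!pairing_ofZ.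
rewrite (lattice_decomp IF uK) pairingDl pairing_suml; congr (_ + _).
by apply: eq_bigr => i iIK; rewrite pairingZl azE // rmorphM.
Qed.

Let dist u i : nat := absz (pairing u (v i) - d i).

Let dist_sign I u i : I \in facets D K -> i \in I :\: K -> in_cone I u ->
  pairing u (v i) - d i = if 0 < az I i then (dist u i)%:Z else - (dist u i)%:Z.
Proof.
move=> IF iIK ic; have := forall_inP ic i iIK; rewrite /side /dist; case: ifP => _ h.
  by rewrite gez0_abs // subr_ge0 ltW.
by rewrite lez0_abs ?opprK // subr_le0.
Qed.

Lemma height_cone I u : I \in facets D K -> lattice_slice u -> in_cone I u ->
  height u = (height (uI I) + \sum_(i in I :\: K) `|az I i| * dist u i)%N.
Proof.
move=> IF uK ic; rewrite /height (pairing_lattice_decomp IF uK) addrAC.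
have -> : \sum_(i in I :\: K) (pairing u (v i) - d i) * az I i
    = (\sum_(i in I :\: K) `|az I i| * dist u i)%N%:Z.
  rewrite -[RHS]natz natr_sum; apply: eq_bigr => i iIK; rewrite (dist_sign IF iIK ic).
  rewrite natz PoszM mulrC; case: ifP => [ap|/negbT an].
    by rewrite gtz0_abs.
  by rewrite lez0_abs ?leNgt // mulrN mulNr.
have h := C0P IF.
by rewrite -[in LHS](gez0_abs h) -PoszD.
Qed.

Section Cone.
Variables (T : nat) (I : {set V}).
Hypothesis IF : I \in facets D K.

Let disp (f : {ffun V -> 'I_(Z T)}) i : int := if 0 < az I i then (f i)%:Z else - (f i)%:Z.
Let pt (f : {ffun V -> 'I_(Z T)}) : 'cV[rat]_n := \sum_(i in I :\: K) (disp f i)%:~R *: dual v I i.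
Let range i : pred 'I_(Z T) := fun r => ray_range (az I i) (T * quo I i) r.
Let fam := pfamily ord0 (mem (I :\: K)) range.

Let coord_suml (P : pred V) (c : V -> rat) (w : V -> 'cV[rat]_n) (xi : Box) :
  coord (\sum_(i | P i) c i *: w i) xi = \sum_(i | P i) c i * coord (w i) xi.
Proof. by rewrite /coord pairing_suml; apply: eq_bigr => i _; rewrite pairingZl. Qed.

Let prod_ray_coef (f : {ffun V -> 'I_(Z T)}) xi : \prod_(i in I :\: K) ray_coef (az I i) (vertex_root I i xi) (f i)
  = cone_sign I * ex R (coord (- pt f) xi).
Proof.
have -> : coord (- pt f) xi = \sum_(i in I :\: K) (- (disp f i))%:~R * coord (dual v I i) xi.
  rewrite /pt -sumrN -coord_suml; congr coord; apply: eq_bigr => i _.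
  by rewrite rmorphN scaleNr.
rewrite (big_morph (ex R) (exD R) (ex0 R)) -big_split /=; apply: eq_bigr => i _.
rewrite exMz /ray_coef /disp; case: ifP => _.
  by rewrite mulN1r -exprnN.
by rewrite opprK mul1r.
Qed.

Let integral_formN (w : 'cV[rat]_n) : integral_form (- w) = integral_form w.
Proof. by apply: eq_forallb => l; rewrite mxE rpredN. Qed.

Let denom_pt (f : {ffun V -> 'I_(Z T)}) : denom_dvd m (- pt f).
Proof.
move=> w; rewrite pairingNl rpredN pairing_suml; apply: rpred_sum => i _.
by rewrite pairingZl; apply: rpredM; [apply/intrP; eexists | exact: dm].
Qed.

Let weighted (f : {ffun V -> 'I_(Z T)}) : nat :=
  (height (uI I) + \sum_(i in I :\: K) `|az I i| * f i)%N.

(** The roots of unity multiply to a character of the point, whose average is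
    the indicator of integrality. *)
Lemma coef_cone_series r : avg (fun xi => (cone_series T I xi)`_r)
  = \sum_(f in fam | (weighted f == r) && integral_form (pt f)) cone_sign I.
Proof.
transitivity (avg (fun xi : Box => \sum_(f in fam | weighted f == r)
    cone_sign I * ex R (coord (- pt f) xi))).
  congr (_ * _); apply: eq_bigr => xi _.
  rewrite /cone_series /ray_sum (big_distr_big_dep ord0) /= mulr_sumr coef_sum.
  rewrite [RHS]big_mkcondr /=; apply: eq_bigr => f _.
  have -> : \prod_(i in I :\: K) (ray_coef (az I i) (vertex_root I i xi) (f i) *: 'X^(`|az I i| * f i))
     = (\prod_(i in I :\: K) ray_coef (az I i) (vertex_root I i xi) (f i))
        *: 'X^(\sum_(i in I :\: K) `|az I i| * f i) :> {poly C}.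
    by rewrite expr_sum scaler_prod.
  rewrite prod_ray_coef -scalerAr -exprD coefZ coefXn -/(weighted f) eq_sym.
  by case: eqP => _; rewrite ?mulr1 ?mulr0.
rewrite avg_sum; under [RHS]eq_bigl do rewrite andbA.
rewrite [RHS]big_mkcondr; apply: eq_bigr => f _.
rewrite avgM avg_character; last exact: denom_pt.
by rewrite integral_formN; case: (integral_form _); rewrite ?mulr1 ?mulr0.
Qed.

Let good (f : {ffun V -> 'I_(Z T)}) r : bool :=
  (f \in fam) && ((weighted f == r) && integral_form (pt f)).

Let point (f : {ffun V -> 'I_(Z T)}) : 'cV[int]_n :=
  uI I + \col_l Num.floor (pt f l 0).

Let pointE f : integral_form (pt f) -> ofZ rat (point f) = ofZ rat (uI I) + pt f.
Proof.
move=> /forallP; rewrite /point /ofZ map_mxD; move: (pt f) => w H; congr (_ + _).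
by apply/colP => l; rewrite !mxE; apply: floorK; exact: H.
Qed.

Let IS : I \in simplices D. Proof. by case/facetsP: IF. Qed.
Let KI : K \subset I. Proof. by case/facetsP: IF. Qed.

Let pairing_point f i : integral_form (pt f) -> i \in I ->
  pairing (point f) (v i) = d i + (if i \in I :\: K then disp f i else 0).
Proof.
move=> fi iI; apply: (@intr_inj rat); rewrite -pairing_ofZ pointE // pairingDl.
rewrite (uIE (facets_skel IF)) !pairing_suml rmorphD /=; congr (_ + _).
  rewrite (bigD1 i) //= pairingZl (dualP Dv) // eqxx mulr1 big1 ?addr0 // => j /andP[jI ji].
  by rewrite pairingZl (dualP Dv) // (negPf ji) mulr0.
have [iIK|iIK] := boolP (i \in I :\: K).
  rewrite (bigD1 i) //= pairingZl (dualP Dv) // eqxx mulr1 big1 ?addr0 // => j /andP[jI ji].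
  by rewrite pairingZl (dualP Dv) // (negPf ji) mulr0.
rewrite big1 // => j jIK; rewrite pairingZl (dualP Dv) //.
by case: eqP => [ij|_]; [move: iIK; rewrite -ij jIK | rewrite mulr0].
Qed.

Let good_point f r : good f r ->
  [/\ lattice_slice (point f), in_cone I (point f) & height (point f) = r].
Proof.
move=> /andP[/pfamilyP [fsupp frange] /andP[/eqP wf fi]].
have ps : lattice_slice (point f).
  move=> i iK; rewrite pairing_point // ?(fintype.subsetP KI) //.
  by rewrite inE iK addr0.
have pc : in_cone I (point f).
  apply/forall_inP => i iIK; have iI : i \in I by case/finset.setDP: iIK.
  rewrite /side pairing_point // iIK /disp; have : range i (f i) by exact: frange.
  rewrite /range /ray_range; case: ifP => _.
    by move=> /andP[f0 _]; rewrite ltrDl ltz_nat.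
  by move=> _; rewrite gerDl oppr_le0.
split=> //; rewrite (height_cone IF ps pc) -wf; congr (_ + _)%N.
apply: eq_bigr => i iIK; have iI : i \in I by case/finset.setDP: iIK.
congr (_ * _)%N; rewrite /dist pairing_point // iIK addrAC subrr add0r /disp.
by case: ifP => _; rewrite ?abszN absz_nat.
Qed.

Let good_surj u r : (r < T)%N -> lattice_slice u -> in_cone I u -> height u = r ->
  exists2 f, good f r & u = point f.
Proof.
move=> rT us uc ur.
have hE := height_cone IF us uc.
have dist_lt i : i \in I :\: K -> (dist u i < T)%N.
  move=> iIK; apply: leq_ltn_trans rT; rewrite -ur hE (bigD1 i) //= addnA.
  apply: leq_trans (leq_addr _ _); apply: leq_trans (leq_addl _ _).
  by rewrite leq_pmull // az_gt0.
have T_le i : i \in I :\: K -> (T <= T * quo I i)%N.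
  by move=> iIK; rewrite leq_pmulr // quo_gt0.
pose f : {ffun V -> 'I_(Z T)} := [ffun i => if i \in I :\: K then inord (dist u i) else ord0].
have fE i : i \in I :\: K -> f i = dist u i :> nat.
  move=> iIK; rewrite ffunE iIK inordK // /Z ltnS.
  by apply: leq_trans (ltnW (dist_lt i iIK)) _; rewrite leq_pmulr.
have ptE : pt f = ofZ rat (u - uI I).
  rewrite /ofZ map_mxB -/(ofZ _ _) -/(ofZ _ _) (lattice_decomp IF us) addrAC subrr add0r.
  apply: eq_bigr => i iIK; congr (_%:~R *: _).
  by rewrite (dist_sign IF iIK uc) /disp fE.
have fi : integral_form (pt f) by apply/integral_formP; exists (u - uI I).
exists f; last first.
  by apply: (@ofZ_inj rat); rewrite pointE // ptE /ofZ map_mxB addrC subrK.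
apply/andP; split; last first.
  rewrite fi andbT /weighted -ur hE; apply/eqP; congr (_ + _)%N.
  by apply: eq_bigr => i iIK; rewrite fE.
apply/pfamilyP; split.
  by apply/supportP => i iIK; rewrite ffunE (negPf iIK).
move=> i iIK; change (is_true (range i (f i))); rewrite /range /ray_range fE //.
have := forall_inP uc i iIK; rewrite /side; case: ifP => _ h.
  rewrite absz_gt0 subr_eq0 gt_eqF //=; apply: leq_trans (ltnW (dist_lt i iIK)) _.
  exact: T_le.
by apply: leq_trans (dist_lt i iIK) _; exact: T_le.
Qed.

Let point_inj r : {in [pred f | good f r] &, injective point}.
Proof.
move=> f f' fg f'g e; apply/ffunP => i; apply/val_inj => /=.
have /andP[/pfamilyP [fs _] /andP[_ fi]] : good f r by [].
have /andP[/pfamilyP [fs' _] /andP[_ fi']] : good f' r by [].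
have [iIK|iIK] := boolP (i \in I :\: K); last first.
  by rewrite (elimT supportP fs i iIK) (elimT supportP fs' i iIK).
have iI : i \in I by case/finset.setDP: iIK.
have := pairing_point fi iI; rewrite e (pairing_point fi' iI) iIK => /addrI.
by rewrite /disp; case: ifP => _ => [|/oppr_inj] [].
Qed.

(** Lattice points of a cone at height r correspond to the integral monomials of
    degree r of its generating function. *)
Lemma sum_cone_points r (S : seq 'cV[int]_n) : (r < T)%N -> uniq S ->
  (forall u, lattice_slice u -> in_cone I u -> height u = r -> u \in S) ->
  \sum_(u <- S | `[< lattice_slice u >] && (height u == r))
     (if in_cone I u then cone_sign I else 0)
  = avg (fun xi => (cone_series T I xi)`_r).
Proof.
move=> rT Su SP; rewrite coef_cone_series -big_mkcondr /=.
rewrite -big_filter -[RHS]big_filter.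
set s1 := (X in \sum_(u <- X) _ = _); set s2 := (X in _ = \sum_(f <- X) _).
have -> : \sum_(f <- s2) cone_sign I = \sum_(u <- map point s2) cone_sign I.
  by rewrite big_map.
apply: perm_big; apply: uniq_perm; first exact: filter_uniq.
  rewrite map_inj_in_uniq ?filter_uniq // ?index_enum_uniq // => f f'.
  rewrite !mem_filter => /andP[fg _] /andP[f'g _]; exact: (@point_inj r f f' fg f'g).
move=> u; rewrite mem_filter; apply/idP/mapP.
  move=> /andP[/andP[/andP[/asboolP us /eqP ur] uc] _].
  have [f fg ->] := good_surj rT us uc ur.
  by exists f => //; rewrite mem_filter mem_index_enum andbT.
move=> [f]; rewrite mem_filter => /andP[/good_point [fs fc fr] _] ->.
rewrite fc fr eqxx !andbT; apply/andP; split; first exact/asboolP.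
exact: SP.
Qed.

Lemma cone_points_finite : exists S : seq 'cV[int]_n,
  forall u, lattice_slice u -> in_cone I u -> (height u < T)%N -> u \in S.
Proof.
exists [seq point f | f <- enum {: {ffun V -> 'I_(Z T)}}] => u us uc uT.
have [f _ ->] := good_surj uT us uc (erefl _).
by apply: map_f; rewrite mem_enum.
Qed.

End Cone.

Definition total_series T : {poly C} :=
  \sum_(I in facets D K) (weight D I)%:~R *: avg_poly (cone_series T I).

Local Notation k := (n - #|K|)%N.

Let card_facet I : I \in facets D K -> #|I :\: K| = k.
Proof. by move=> /facetsP [IS In KI]; rewrite cardsD (finset.setIidPr KI) In. Qed.

Let ray_den_neq0 a (c : C) : a != 0 -> ray_den a c != 0.
Proof.
move=> a0; have a1 : (0 < `|a|)%N by rewrite absz_gt0.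
rewrite /ray_den; case: ifP => _.
  by rewrite -size_poly_eq0 size_XnsubC.
apply/negP => /eqP /(congr1 (fun P : {poly C} => P.[0])).
rewrite hornerD hornerN hornerZ hornerXn !hornerC expr0n.
have -> : (absz a == 0%N) = false by apply: gtn_eqF.
by rewrite mulr0 subr0; apply/eqP; exact: oner_neq0.
Qed.

Let ray_num_neq0 a : ray_num C a != 0.
Proof. by rewrite /ray_num; case: ifP => _; rewrite ?oner_neq0 // monic_neq0 // monicXn. Qed.

(** Multiplication by the k-th power of 1 - X^A closes all geometric series at
    once; the cutting order T then enters only through a common factor. *)
Lemma total_series_closed T :
  total_series T * (1 - 'X^A) ^+ k = total_series 1 * (1 - 'X^(A * T)) ^+ k.
Proof.
rewrite /total_series !mulr_suml; apply: eq_bigr => I IF.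
rewrite -[LHS]scalerAl -[RHS]scalerAl; congr (_ *: _); rewrite !avg_polyMl; congr avg_poly.
apply/funext => xi; rewrite /cone_series -!mulrA; congr (_ * _).
rewrite -(card_facet IF) -!prodr_const -!big_split /=; apply: eq_bigr => i iIK.
have ne0 : ray_den (az I i) (vertex_root I i xi) * ray_num C (az I i) != 0.
  by rewrite mulf_neq0 ?ray_num_neq0 // ray_den_neq0 // az0.
have E T' := @ray_sumE _ (Z T') (az I i) _ (T' * quo I i) (vertex_root_neq0 I i xi)
  (vertex_root_period xi T' IF iIK).
have quo_leA : (quo I i <= A)%N by exact: leq_div.
have ltZ T' : (T' * quo I i < Z T')%N by rewrite /Z ltnS leq_mul2l quo_leA orbT.
have AE T' : (`|az I i| * (T' * quo I i) = A * T')%N by rewrite mulnCA (quoE IF iIK) mulnC.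
have ET := E T (ltZ T); have E1 := E 1%N (ltZ 1%N).
rewrite AE in ET; rewrite AE muln1 in E1.
apply: (mulIf ne0).
move: ET E1; set P := ray_sum _ _ _ _; set Q := ray_sum _ _ _ _.
set dn := ray_den _ _; set nm := ray_num _ _ => ET E1.
transitivity ((P * dn) * ((1 - 'X^A) * nm)); first by ring.
by rewrite ET -E1; ring.
Qed.

Section Support.
Variable S : seq 'cV[int]_n.
Hypotheses (Su : uniq S) (Sl : forall u, u \in S -> lattice_slice u).
Hypothesis SP : forall u, lattice_slice u ->
  signed_DH D v (ofZ R g) K (side u) != 0 -> u \in S.

Let DHu u : C := ((signed_DH D v (ofZ R g) K (side u))%:C)%C.

Definition count_poly : {poly C} := \sum_(u <- S) DHu u *: 'X^(height u).

(** Below the cutting order, the support of the Duistermaat-Heckman function and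
    the supports of the cones can be enlarged to a common finite set, on which
    both sides are the same double sum. *)
Lemma count_poly_series T : eqm T count_poly (total_series T).
Proof.
move=> r rT.
have /choice [P HP] : forall I, exists P : seq 'cV[int]_n, I \in facets D K ->
    forall u, lattice_slice u -> in_cone I u -> (height u < T)%N -> u \in P.
  move=> I; have [IF|_] := boolP (I \in facets D K); last by exists [::].
  by have [P HP] := cone_points_finite T IF; exists P.
pose S' := undup (S ++ flatten [seq P J | J <- enum (facets D K)]).
have S'u : uniq S' by exact: undup_uniq.
have SS' u : u \in S -> u \in S' by move=> uS; rewrite mem_undup mem_cat uS.
have PS' I u : I \in facets D K -> u \in P I -> u \in S'.
  move=> IF uP; rewrite mem_undup mem_cat; apply/orP; right; apply/flattenP.
  by exists (P I) => //; apply: map_f; rewrite mem_enum.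
rewrite coef_sum.
have -> : (total_series T)`_r = \sum_(I in facets D K) (weight D I)%:~R *
    \sum_(u <- S' | `[< lattice_slice u >] && (height u == r))
     (if in_cone I u then cone_sign I else 0).
  rewrite coef_sum; apply: eq_bigr => I IF; rewrite coefZ coef_avg_poly.
  rewrite (sum_cone_points IF rT S'u) // => u us uc ur.
  by apply: (PS' I) => //; apply: HP => //; rewrite ur.
under [RHS]eq_bigr do rewrite mulr_sumr.
rewrite exchange_big /=.
under [RHS]eq_bigr do rewrite -signed_DH_cones -/(DHu _).
transitivity (\sum_(u <- S | height u == r) DHu u).
  rewrite [RHS]big_mkcond; apply: eq_bigr => u _.
  by rewrite coefZ coefXn eq_sym; case: eqP => _; rewrite ?mulr1 ?mulr0.
rewrite -[LHS]big_filter -[RHS]big_filter.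
rewrite [RHS](bigID (fun u => u \in S)) /= [X in _ + X]big_seq_cond [X in _ + X]big1 ?addr0.
  rewrite -[RHS]big_filter; apply: perm_big; apply: uniq_perm; rewrite ?filter_uniq //.
  move=> u; rewrite !mem_filter; have [uS|] := boolP (u \in S); rewrite ?andbF //= andbT.
  by rewrite SS' // andbT; case: asboolP => // /(_ (Sl uS)).
move=> u /andP[]; rewrite mem_filter => /andP[/andP[/asboolP us _] _] uS.
rewrite /DHu; have [-> //|/(SP us)] := eqVneq (signed_DH D v (ofZ R g) K (side u)) 0.
by rewrite (negPf uS).
Qed.

(** The two sides agree modulo every power of X, since the common factor of the
    cut series tends to 1. *)
Lemma count_poly_closed : count_poly * (1 - 'X^A) ^+ k = total_series 1.
Proof.
apply: eqm_eq => T.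
apply: (@eqm_trans _ _ _ (total_series T * (1 - 'X^A) ^+ k)).
  by apply: eqmM => //; exact: count_poly_series.
rewrite total_series_closed -[X in eqm _ _ X]mulr1; apply: eqmM => //.
rewrite -[X in eqm _ _ X](expr1n _ k); apply: eqmX => i iT.
rewrite coefB coefXn ltn_eqF ?subr0 //; apply: leq_trans iT _.
by rewrite leq_pmull.
Qed.

(* The cancellation of U ^+ k costs k orders, the coefficient of degree k is
   needed, and the linear term of U has to be visible. *)
Local Notation M := (k + k).+2.
Local Notation td := (todd M (@laurent_coef R)).

Let bP (c : C) j : \sum_(l < j.+1) ((l == 0%N :> nat)%:R - c * (-1) ^+ l / l`!%:R)
  * laurent_coef c (j - l)%N = (j == 1%N)%:R.
Proof. exact: laurent_coefP. Qed.

(** The contribution of the facet I, as a power series in y: exp (<u_I, g> y)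
    times the product of the Todd series of the edges off K. *)
Definition local_term I (xi : Box) : {poly C} :=
  expp M (pairing (uI I) g)%:~R * \prod_(i in I :\: K) td (vertex_root I i xi) (az I i)%:~R.

Let wt I : C := (weight D I)%:~R / \prod_(i in I :\: K) (az I i)%:~R.

Let EV (P : {poly C}) := P \Po expp M (1 : C).
Let U : {poly C} := 1 - expp M A%:R.

Let EVX j : eqm M (EV 'X^j) (expp M j%:R).
Proof. by rewrite /EV comp_Xn_poly; exact: exppX. Qed.

Let cone_eval I xi : I \in facets D K ->
  eqm M (EV (cone_series 1 I xi) * expp M (- C0%:R) * 'X^k)
        (U ^+ k * ((\prod_(i in I :\: K) (az I i)%:~R)^-1 *: local_term I xi)).
Proof.
move=> IF; rewrite /EV /cone_series comp_polyM.
have hE : (height (uI I))%:R - C0%:R = (pairing (uI I) g)%:~R :> C.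
  rewrite /height pmulrn gez0_abs ?C0P // rmorphD /= -[C0%:R]pmulrn.
  by rewrite [_ C0%:Z]/= addrK.
have H1 : eqm M (EV 'X^(height (uI I)) * expp M (- C0%:R)) (expp M (pairing (uI I) g)%:~R).
  by rewrite -hE; apply: eqm_trans (eqmM (EVX _) (@eqm_refl _ _ _)) _; exact: exppD.
have H2 : eqm M (((\prod_(i in I :\: K) ray_sum (Z 1) (az I i) (vertex_root I i xi) (1 * quo I i))
      \Po expp M (1 : C)) * 'X^k)
    (U ^+ k * ((\prod_(i in I :\: K) (az I i)%:~R)^-1 *:
      \prod_(i in I :\: K) td (vertex_root I i xi) (az I i)%:~R)).
  have pw (P : {poly C}) : P ^+ k = \prod_(i in I :\: K) P by rewrite prodr_const card_facet.
  rewrite !pw rmorph_prod /= -prodfV -scaler_prod -!big_split /=.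
  apply: eqm_prod => i iIK; rewrite mul1n.
  have a0 : (az I i)%:~R != 0 :> C by rewrite intr_eq0 az0.
  have ltZ : (1 * quo I i < Z 1)%N by rewrite /Z ltnS !mul1n leq_div.
  have := @ray_eval _ M _ bP (Z 1) (az I i) (vertex_root I i xi) (1 * quo I i) A
    (az0 IF iIK) (vertex_root_neq0 I i xi) (vertex_root_period xi 1 IF iIK) ltZ.
  rewrite mul1n (quoE IF iIK) => /(_ (erefl _)) H.
  apply: (@eqm_trans _ _ _ ((az I i)%:~R^-1%:P * ((ray_sum (Z 1) (az I i) (vertex_root I i xi)
     (quo I i) \Po expp M 1) * ((az I i)%:~R *: 'X)))).
    by rewrite -scalerAr mul_polyC scalerA mulVf // scale1r.
  apply: (@eqm_trans _ _ _ ((az I i)%:~R^-1%:P * (U * td (vertex_root I i xi) (az I i)%:~R))).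
    exact: eqmM.
  by rewrite mul_polyC scalerAr.
apply: (@eqm_trans _ _ _ ((EV 'X^(height (uI I)) * expp M (- C0%:R)) *
   (((\prod_(i in I :\: K) ray_sum (Z 1) (az I i) (vertex_root I i xi) (1 * quo I i))
      \Po expp M (1 : C)) * 'X^k))).
  by rewrite /EV mulrACA -!mulrA [expp M (- _) * _]mulrC !mulrA.
apply: eqm_trans (eqmM H1 H2) _.
by rewrite /local_term mulrCA -scalerAr.
Qed.

(** Substitute exp y for the variable of the generating function, multiply by
    the powers of y and of 1 - exp (A y) that clear the poles, and compare the
    coefficients of lowest degree. *)
Theorem count_value : \sum_(u <- S) DHu u =
  \sum_(I in facets D K) wt I * avg (fun xi => (local_term I xi)`_k).
Proof.
pose RHS' := \sum_(I in facets D K) wt I *: avg_poly (local_term I).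
have key : eqm M (EV count_poly * U ^+ k * expp M (- C0%:R) * 'X^k) (U ^+ k * RHS').
  have e : eqm M (EV count_poly * U ^+ k) (EV (total_series 1)).
    rewrite -count_poly_closed /EV comp_polyM; apply: eqmM => //.
    rewrite rmorphXn /=; apply: eqmX; rewrite rmorphB /= rmorph1.
    by apply: eqmB => //; apply: eqm_sym; exact: EVX.
  apply: (@eqm_trans _ _ _ (EV (total_series 1) * expp M (- C0%:R) * 'X^k)).
    exact: eqmM (eqmM e (@eqm_refl _ _ _)) (@eqm_refl _ _ _).
  rewrite /EV /total_series rmorph_sum /= !mulr_suml /RHS' mulr_sumr.
  apply: eqm_sum => I IF; rewrite /avg_poly !linearZ /= rmorph_sum /= -!scalerAl -!scalerAr.
  rewrite !scalerA !mulr_suml mulr_sumr !scaler_sumr.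
  apply: eqm_sum => xi _.
  have H := cone_eval xi IF => j jM; rewrite !coefZ H // -scalerAr coefZ /wt.
  by rewrite !mulrA; congr (_ * _ * _); rewrite mulrC.
have cancel : eqm k.+2 (EV count_poly * expp M (- C0%:R) * 'X^k - RHS') 0.
  have U0 : U`_0 = 0 by rewrite coefB coef1 coef_expp // expr0 fact0 divr1 subrr.
  have U1 : U`_1 != 0.
    rewrite coefB coef1 coef_expp // expr1 sub0r oppr_eq0 divr1 pnatr_eq0.
    by rewrite -lt0n.
  apply: (eqm_cancelX U0 U1 (k := k)); rewrite addSn addSn mulrBr.
  move=> j jM; rewrite coefB -key // coef0; apply/eqP; rewrite subr_eq0; apply/eqP.
  by rewrite !mulrA [U ^+ k * EV count_poly]mulrC.
have := cancel k (leqnSn _); rewrite coefB coef0 => /eqP; rewrite subr_eq0 => /eqP.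
rewrite coefMXn ltnn subnn => e0.
have c0 : (EV count_poly * expp M (- C0%:R))`_0 = \sum_(u <- S) DHu u.
  rewrite coef0M coef_expp // expr0 fact0 divr1 mulr1 -horner_coef0 /EV horner_comp.
  rewrite horner_coef0 coef_expp // expr0 fact0 divr1 /count_poly horner_sum.
  by apply: eq_bigr => u _; rewrite hornerZ hornerXn expr1n mulr1.
rewrite -c0 e0 coef_sum; apply: eq_bigr => I _.
by rewrite coefZ coef_avg_poly.
Qed.

End Support.
End LatticeCount.

(** * Faces and the expansion in the dilation factor *)

Section SliceCount.
Variables (R : realType) (n : nat) (V : finType) (D : multifan R n V).
Variables (v : V -> 'rV[int]_n).
Hypotheses (Dv : edge_vectors D v) (cD : complete_multifan D).
Implicit Types (I J K : {set V}) (u : 'cV[int]_n) (d : V -> int).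
Local Notation C := R[i].

Lemma ltr_int_eps (a b : int) (eps : R) : 0 < eps < 1 ->
  (a%:~R + eps < b%:~R) = (a < b).
Proof.
move=> /andP[e0 e1]; apply/idP/idP => [h|].
  by rewrite -(ltr_int R); apply: lt_trans h; rewrite ltrDl.
rewrite -lezD1 -(ler_int R) rmorphD /= => h; apply: lt_le_trans h.
by rewrite ltrD2l.
Qed.

Lemma finite_int_box (b : nat) : finite_set [set u : 'cV[int]_n | forall l, (absz (u l 0%R) <= b)%N].
Proof.
apply: (@sub_finite_set _ _ [set (\col_l ((f l : nat)%:Z - b%:Z)) | f in
    [set: {ffun 'I_n -> 'I_(b + b).+1}]]).
  move=> u Hu; exists [ffun l => inord (absz (u l 0 + b%:Z))] => //.
  apply/colP => l; rewrite !mxE ffunE.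
  have [h0 h1] : 0 <= u l 0 + b%:Z /\ (absz (u l 0%R + b%:Z)%R < (b + b).+1)%N.
    by move: (Hu l) => /=; move: (u l 0) => x; clear; lia.
  by rewrite (inordK h1) gez0_abs // addrK.
by apply: finite_image; exact: finite_finset.
Qed.

Definition slice_term (g : 'rV[R]_n) K d u : R := signed_DH D v g K (side v d u).

Definition slice_count (g : 'rV[R]_n) K d : R :=
  \sum_(u \in lattice_slice v K d) slice_term g K d u.

Lemma slice_term_real g K d u : slice_term g K d u
  = signed_DH D v g K (fun i => (d i)%:~R < pairing (ofZ R u) (ofZ R (v i))).
Proof.
by rewrite /slice_term; congr signed_DH; apply/funext => i; rewrite pairing_ofZ ltr_int.
Qed.

Lemma slice_affA K d u : lattice_slice v K d u -> affA v (fun i => (d i)%:~R : R) K (ofZ R u).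
Proof. by move=> uK i iK; rewrite pairing_ofZ uK. Qed.

Lemma slice_support_finite g K d : DH_direction D v K g ->
  finite_set (lattice_slice v K d `&` [set u : 'cV[int]_n | slice_term g K d u != 0]).
Proof.
move=> dg; have [c c0 Hc] := support_bounded Dv cD dg.
pose B : R := \sum_i `|(d i)%:~R|.
have B0 : 0 <= B by apply: sumr_ge0.
have dB i : `|(d i)%:~R| <= B by rewrite /B (bigD1 i) //= lerDl sumr_ge0.
apply: (sub_finite_set _ (finite_int_box (Num.truncn (B * c)).+1)) => u [us u0] l.
move: u0; rewrite /= slice_term_real => u0.
have := Hc _ _ B (slice_affA us) B0 dB u0 l; rewrite mxE => h.
have {}h := le_lt_trans h (truncnS_gt (B * c)).
rewrite -(ler_nat R) natr_absz intr_norm.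
exact: ltW.
Qed.

Lemma slice_countE g K d : DH_direction D v K g -> exists S : seq 'cV[int]_n,
  [/\ uniq S, (forall u, u \in S -> lattice_slice v K d u),
     (forall u, lattice_slice v K d u -> slice_term g K d u != 0 -> u \in S)
   & slice_count g K d = \sum_(u <- S) slice_term g K d u].
Proof.
move=> dg; have fin := slice_support_finite d dg.
exists (fset_set (lattice_slice v K d `&` [set u : 'cV[int]_n | slice_term g K d u != 0])).
have memP u : reflect ((lattice_slice v K d `&` [set u : 'cV[int]_n | slice_term g K d u != 0]) u)
    (u \in enum_fset (fset_set (lattice_slice v K d `&` [set u : 'cV[int]_n | slice_term g K d u != 0]))).
  have := in_fset_set fin u; rewrite -[u \in enum_fset _]/(u \in fset_set _) => ->.
  by apply: (iffP idP) => [/set_mem|/mem_set].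
split.
- exact: fset_uniq.
- by move=> u /memP [].
- by move=> u us u0; apply/memP.
rewrite /slice_count fsbig_supp -fsbig_finite //=; congr (\big[_/_]_(u \in _) _).
by apply/seteqP; split=> u /= [us u0]; split=> //; apply/eqP.
Qed.

(** Integral values make the generating functions by height power series. *)
Definition good_direction (g : 'rV[int]_n) : Prop := forall I i, I \in skel D n -> i \in I ->
  pairing (dual v I i) (ofZ rat g) \is a Num.int /\ pairing (dual v I i) (ofZ rat g) != 0.

Definition dual_value (g : 'rV[int]_n) I i : int := Num.floor (pairing (dual v I i) (ofZ rat g)).

Lemma dual_valueE g I i : good_direction g -> I \in skel D n -> i \in I ->
  pairing (dual v I i) (ofZ rat g) = (dual_value g I i)%:~R.
Proof. by move=> gg IS iI; rewrite /dual_value floorK //; have [] := gg I i IS iI. Qed.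

Lemma dual_value_neq0 g I i : good_direction g -> I \in skel D n -> i \in I ->
  dual_value g I i != 0.
Proof.
move=> gg IS iI; have [_] := gg I i IS iI; rewrite dual_valueE //.
by apply: contra => /eqP ->.
Qed.

Lemma good_DH_direction g K : good_direction g -> DH_direction D v K (ofZ R g).
Proof.
move=> gg I i IF /finset.setDP[iI _]; rewrite /dualR pairing_ratr fmorph_eq0.
by have [] := gg I i (facets_skel IF) iI.
Qed.

Variable m : nat.
Hypothesis dm : forall I i, denom_dvd m (dual v I i).
Local Notation Box := 'rV['I_m.+2]_n.

Definition facet_weight g K I : C :=
  (weight D I)%:~R / \prod_(i in I :\: K) (dual_value g I i)%:~R.

Definition todd_product (k : nat) g K I (xi : Box) : {poly C} :=
  \prod_(i in I :\: K) todd (k + k).+2 (@laurent_coef R) (vertex_root R v I i xi)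
     (dual_value g I i)%:~R.

(** The coefficient of nu^l in the count of the nu-th dilation of the face K. *)
Definition slice_coef g K (uI : {set V} -> 'cV[int]_n) (l : nat) : C :=
  \sum_(I in facets D K) facet_weight g K I * (pairing (uI I) g)%:~R ^+ l / l`!%:R
    * avg (fun xi => (todd_product (n - #|K|) g K I xi)`_(n - #|K| - l)).

Lemma slice_count_value (h : 'rV[R]_n) g K d (uI : {set V} -> 'cV[int]_n) :
  DH_direction D v K h -> good_direction g ->
  (forall I, I \in skel D n -> ofZ rat (uI I) = \sum_(i in I) (d i)%:~R *: dual v I i) ->
  ((slice_count h K d)%:C)%C = \sum_(l < (n - #|K|).+1) slice_coef g K uI l.
Proof.
move=> dh gg uIE; have dg := good_DH_direction (K := K) gg.
have -> : slice_count h K d = slice_count (ofZ R g) K d.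
  by apply: eq_fsbigr => u _; exact: signed_DH_indep.
have [S [Su Sl SP ->]] := slice_countE d dg.
have azE I i : I \in facets D K -> i \in I :\: K ->
    pairing (dual v I i) (ofZ rat g) = (dual_value g I i)%:~R.
  by move=> IF /finset.setDP[iI _]; apply: dual_valueE => //; exact: facets_skel IF.
have az0 I i : I \in facets D K -> i \in I :\: K -> dual_value g I i != 0.
  by move=> IF /finset.setDP[iI _]; apply: dual_value_neq0 => //; exact: facets_skel IF.
pose C0 := (\sum_(I : {set V}) absz (pairing (uI I) g))%N.
have C0P I : I \in facets D K -> 0 <= pairing (uI I) g + C0%:Z.
  by move=> IF; rewrite /C0 (bigD1 I) //=; lia.
pose A := (\prod_(p : {set V} * V | (p.1 \in facets D K) && (p.2 \in p.1 :\: K))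
   (m.+2 * absz (dual_value g p.1 p.2)))%N.
have A0 : (0 < A)%N.
  rewrite /A prodn_cond_gt0 // => -[I i] /= /andP[IF iIK].
  by rewrite muln_gt0 /= absz_gt0 az0.
have AP I i : I \in facets D K -> i \in I :\: K -> (m.+2 * absz (dual_value g I i) %| A)%N.
  by move=> IF iIK; rewrite /A (bigD1 (I, i)) /= ?IF // dvdn_mulr.
rewrite rmorph_sum /=.
rewrite (count_value Dv dm azE az0 uIE C0P A0 AP Su Sl SP).
have E I : avg (fun xi : Box => (local_term R v K g (dual_value g) uI I xi)`_(n - #|K|))
    = \sum_(l < (n - #|K|).+1) (pairing (uI I) g)%:~R ^+ l / l`!%:R *
       avg (fun xi : Box => (todd_product (n - #|K|) g K I xi)`_(n - #|K| - l)).
  under [RHS]eq_bigr do rewrite -avgM.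
  rewrite -avg_sum; congr (_ * _); apply: eq_bigr => xi _.
  rewrite /local_term coefM; apply: eq_bigr => l _; rewrite coef_expp //.
  by apply: leq_trans (ltn_ord l) _; rewrite ltnS leqW // leq_addr.
under [LHS]eq_bigr do rewrite E mulr_sumr.
rewrite exchange_big /=; apply: eq_bigr => l _; apply: eq_bigr => I _.
by rewrite !mulrA.
Qed.

(** Only the vertices depend on the dilation factor, and a vertex enters through
    the exponential of its pairing with g. *)
Lemma slice_count_expansion (h : 'rV[R]_n) g K d (uI : {set V} -> 'cV[int]_n) (nu : nat) :
  DH_direction D v K h -> good_direction g ->
  (forall I, I \in skel D n -> ofZ rat (uI I) = \sum_(i in I) (d i)%:~R *: dual v I i) ->
  ((slice_count h K (fun i => nu%:Z * d i))%:C)%C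
  = \sum_(l < (n - #|K|).+1) nu%:R ^+ l * slice_coef g K uI l.
Proof.
move=> dh gg uIE; rewrite (slice_count_value (uI := fun I => nu%:Z *: uI I) dh gg).
  apply: eq_bigr => l _; rewrite /slice_coef mulr_sumr; apply: eq_bigr => I _.
  rewrite pairingZl rmorphM exprMn /=.
  have -> : (nu%:Z)%:~R = nu%:R :> C by rewrite -pmulrn.
  move: (facet_weight g K I) (avg _) => w c.
  by rewrite !mulrA; congr (_ * _ * _ * _); exact: mulrC.
move=> I IS; rewrite ofZZ uIE // scaler_sumr; apply: eq_bigr => i _.
by rewrite scalerA rmorphM.
Qed.

(** The constant term of a Todd product is the indicator that all its characters
    are trivial. *)
Lemma slice_coef_top g K (uI : {set V} -> 'cV[int]_n) :
  slice_coef g K uI (n - #|K|) = \sum_(I in facets D K)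
    facet_weight g K I * (pairing (uI I) g)%:~R ^+ (n - #|K|) / ((n - #|K|)`!)%:R
    * off_density R v m I K.
Proof.
apply: eq_bigr => I _; congr (_ * _); rewrite /off_density; congr (_ * _).
apply: eq_bigr => xi _; rewrite subnn /todd_product coef0_prod.
have -> : \prod_(i in I :\: K) (todd (n - #|K| + (n - #|K|)).+2 (@laurent_coef R)
      (vertex_root R v I i xi) (dual_value g I i)%:~R)`_0
    = \prod_(i in I :\: K) (coord (dual v I i) xi \is a Num.int)%:R.
  apply: eq_bigr => i _; rewrite coef_poly /= expr0 mulr1 laurent_coef0.
  by rewrite /vertex_root ex_eq1.
have [H|H] := boolP (off_integral v I K xi).
  by rewrite big1 // => i iIK; rewrite (forall_inP H i iIK).
move: H; rewrite /off_integral negb_forall_in => /exists_inP [i iIK /negPf Hi].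
by rewrite (bigD1 i) //= Hi mul0r.
Qed.

(** The shift by eps moves the lattice points of a wall to its negative side and
    no other lattice point across it. *)
Lemma lattice_count_slice (g : 'rV[R]_n) eps d (nu : nat) :
  DH_direction D v finset.set0 g -> 0 < eps < 1 ->
  lattice_count D v g eps d nu = slice_count g finset.set0 (fun i => nu%:Z * d i).
Proof.
move=> dg e01; rewrite /lattice_count /slice_count.
have -> : lattice_slice v finset.set0 (fun i => nu%:Z * d i) = setT.
  by apply/seteqP; split=> // u _ i; rewrite inE.
apply: eq_fsbigr => u _; rewrite DH_signed //.
- congr signed_DH; apply/funext => i; rewrite /side pairing_ofZ.
  by rewrite -(ltr_int_eps _ _ e01) rmorphM.
- by move=> i; rewrite inE.
move=> I i _ _; rewrite pairing_ofZ.
have [e0 e1] := andP e01.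
apply/negP => /eqP e.
have E : nu%:R * (d i)%:~R = (nu%:Z * d i)%:~R :> R by rewrite rmorphM.
move: e; rewrite E => e.
have : (nu%:Z * d i < pairing u (v i)) by rewrite -(ltr_int R) e ltrDl.
by rewrite -(ltr_int_eps _ _ e01) e ltxx.
Qed.

End SliceCount.

(** * Riemann sums *)

Section Euclid.
Variable R : realType.

Local Notation E k := (cs_sort (euclid R k)).
Local Notation mu k := (cs_measure (euclid R k)).

Lemma measurable_coord k (j : 'I_k) :
  measurable_fun setT (fun t : E k => (cs_vec t) j 0 : R).
Proof.
elim: k j => [|k IH] j; first by case: j.
have -> : (fun t : E k.+1 => (cs_vec t) j 0 : R)
  = (fun t : E k.+1 => match fintype.split (j : 'I_(1 + k)) with
       | inl _ => t.1 | inr j' => (cs_vec t.2) j' 0 end).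
  apply/funext => t /=; rewrite mxE; case: fintype.splitP => // i _.
  by rewrite ord1 mxE eqxx.
case: (fintype.split _) => i; first exact: measurable_fst.
exact: measurableT_comp (IH i) measurable_snd.
Qed.

Lemma measurable_affine k (al : R) (be : 'I_k -> R) :
  measurable_fun setT (fun t : E k => al + \sum_j be j * (cs_vec t) j 0).
Proof.
apply: measurable_funD; first exact: measurable_cst.
apply: measurable_sum => j; apply: measurable_funM; first exact: measurable_cst.
exact: measurable_coord.
Qed.

Lemma euclid_measureE k (A : set (E k.+1)) :
  mu k.+1 A = ((@lebesgue_measure R) \x mu k)%E A.
Proof. by []. Qed.

Definition box k (lo hi : 'I_k -> R) : set (E k) :=
  [set t | forall j, lo j <= (cs_vec t) j 0 < hi j].

Lemma cs_vec0 k (t : E k.+1) : (cs_vec t) ord0 0 = t.1.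
Proof. by rewrite /= mxE; case: fintype.splitP => // i _; rewrite ord1 mxE eqxx. Qed.

Lemma cs_vecS k (t : E k.+1) j : (cs_vec t) (lift ord0 j) 0 = (cs_vec t.2) j 0.
Proof.
rewrite /= mxE; case: fintype.splitP => i /=; first by case: i => [[]].
by rewrite /bump /= !add1n => -[/ord_inj ->].
Qed.

Lemma boxS k (lo hi : 'I_k.+1 -> R) : box lo hi =
  ([set` `[lo ord0, hi ord0[] : set (measurableTypeR R))
    `*` @box k (fun j => lo (lift ord0 j)) (fun j => hi (lift ord0 j)).
Proof.
apply/seteqP; split=> t.
  move=> H; split=> /=; first by rewrite in_itv /= -cs_vec0; exact: H.
  by move=> j; rewrite -cs_vecS; exact: H.
move=> [/=]; rewrite in_itv /= => H0 HS j; case: (unliftP ord0 j) => [i|] ->.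
  by rewrite cs_vecS; exact: HS.
by rewrite cs_vec0.
Qed.

Lemma measurable_box k (lo hi : 'I_k -> R) : measurable (box lo hi).
Proof.
elim: k lo hi => [|k IH] lo hi.
  have -> : box lo hi = setT by apply/seteqP; split=> // t _ [].
  exact: measurableT.
by rewrite boxS; apply: measurableX => //; exact: measurable_itv.
Qed.

Lemma measure_box k (lo hi : 'I_k -> R) : (forall j, lo j <= hi j) ->
  mu k (box lo hi) = (\prod_j (hi j - lo j))%:E.
Proof.
elim: k lo hi => [|k IH] lo hi H.
  have -> : box lo hi = setT by apply/seteqP; split=> // t _ [].
  by rewrite big_ord0 /= diracT.
rewrite boxS euclid_measureE product_measure1E //; last exact: measurable_box.
rewrite IH // big_ord_recl EFinM; congr (_ * _)%E.
transitivity ((@lebesgue_measure R) [set` `[lo ord0, hi ord0[]) => //.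
rewrite lebesgue_measure_itv /= lte_fin.
by move: (H ord0); rewrite le_eqVlt => /orP[/eqP ->|->]; rewrite ?ltxx ?subrr // EFinB.
Qed.

Lemma measurable_hyperplane k (al : R) (be : 'I_k -> R) :
  measurable [set t : E k | al + \sum_j be j * (cs_vec t) j 0 = 0].
Proof.
rewrite (_ : [set _ | _] = setT `&` (fun t : E k => al + \sum_j be j * (cs_vec t) j 0) @^-1` [set 0]).
  by apply: measurable_affine => //; exact: measurable_set1.
by rewrite setTI.
Qed.

(** By Fubini: if a later coefficient is non-zero, all sections are null;
    otherwise the hyperplane is a product with a point. *)
Lemma hyperplane_null k (al : R) (be : 'I_k -> R) : (exists j, be j != 0) ->
  mu k [set t | al + \sum_j be j * (cs_vec t) j 0 = 0] = 0.
Proof.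
elim: k al be => [|k IH] al be [j bj]; first by case: j bj.
set A := [set _ | _].
have mA : measurable A by exact: measurable_hyperplane.
have AE (t : E k.+1) : A t <->
    (al + be ord0 * t.1) + \sum_j be (lift ord0 j) * (cs_vec t.2) j 0 = 0.
  rewrite -[A t]/(al + \sum_j be j * (cs_vec t) j 0 = 0) big_ord_recl addrA cs_vec0.
  by under eq_bigr do rewrite cs_vecS.
have [[i bi]|H] := pselect (exists i, be (lift ord0 i) != 0).
  rewrite euclid_measureE /product_measure1.
  apply: integral0_eq => x _.
  rewrite -[RHS](IH (al + be ord0 * x) (fun i => be (lift ord0 i))); last by exists i.
  congr (mu k _); apply/seteqP; split=> t /=.
    by rewrite /xsection /= inE => /AE.
  by move=> h; rewrite /xsection /= inE; apply/AE.
have b0 i : be (lift ord0 i) = 0.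
  by apply/eqP; apply/negPn/negP => h; apply: H; exists i.
have bn : be ord0 != 0.
  by case: (unliftP ord0 j) bj => [i|] ->; rewrite ?b0 ?eqxx.
have -> : A = [set - al / be ord0] `*` setT.
  apply/seteqP; split=> t.
    move=> /AE; rewrite big1 ?addr0; last by move=> i _; rewrite b0 mul0r.
    move=> h; split=> //=; apply: (mulfI bn); rewrite mulrCA divff // mulr1.
    by apply/eqP; rewrite -addr_eq0 addrC h.
  move=> [/= h _]; apply/AE; rewrite big1 ?addr0; last by move=> i _; rewrite b0 mul0r.
  by rewrite h mulrCA divff // mulr1 subrr.
have ms : measurable ([set - al / be ord0] : set (measurableTypeR R)).
  exact: (@measurable_set1 R).
rewrite euclid_measureE product_measure1E //.
transitivity ((@lebesgue_measure R) [set - al / be ord0]%R * mu k setT)%E => //.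
by rewrite lebesgue_measure_set1 mul0e.
Qed.


Lemma euclid_integrable_indic k (A : set (E k)) : measurable A -> (mu k A < +oo)%E ->
  (mu k).-integrable setT (fun t => (\1_A t : R)%:E).
Proof.
move=> mA fA; apply/integrableP; split.
  by apply/measurable_EFinP; exact: measurable_indic.
under eq_integral do rewrite /= ger0_norm //.
by rewrite integral_indic // setIT.
Qed.

Definition cell_index k (c0 : 'I_k -> R) (N : nat) (t : E k) : 'cV[int]_k :=
  \col_j Num.floor (N%:R * ((cs_vec t) j 0 + c0 j)).

(** The half-open cube of side 1 / N that corresponds to the lattice point c
    when the lattice is scaled by 1 / N and translated by - c0. *)
Definition cell k (c0 : 'I_k -> R) (N : nat) (c : 'cV[int]_k) : set (E k) :=
  box (fun j => (c j 0)%:~R / N%:R - c0 j) (fun j => (c j 0 + 1)%:~R / N%:R - c0 j).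

Lemma cellP k (c0 : 'I_k -> R) N c (t : E k) :
  (0 < N)%N -> cell c0 N c t <-> c = cell_index c0 N t.
Proof.
move=> N0; have N0' : 0 < N%:R :> R by rewrite ltr0n.
have H j : ((c j 0)%:~R / N%:R - c0 j <= (cs_vec t) j 0 < (c j 0 + 1)%:~R / N%:R - c0 j)
    = (c j 0 == Num.floor (N%:R * ((cs_vec t) j 0 + c0 j))).
  rewrite lerBlDr ltrBrDr ler_pdivrMr // ltr_pdivlMr // [_ * N%:R]mulrC.
  by apply/idP/eqP => [h|->]; [apply/esym; exact: floor_def|exact: floor_itv].
split=> [h|e j] /=; last by rewrite H e mxE.
by apply/colP => j; rewrite mxE; apply/eqP; rewrite -H; exact: h.
Qed.

Lemma measurable_cell k (c0 : 'I_k -> R) N c : measurable (cell c0 N c).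
Proof. exact: measurable_box. Qed.

Lemma measure_cell k (c0 : 'I_k -> R) N c : (0 < N)%N ->
  mu k (cell c0 N c) = ((N%:R ^+ k)^-1)%:E.
Proof.
move=> N0; have N0' : 0 < N%:R :> R by rewrite ltr0n.
rewrite measure_box; last first.
  by move=> j; rewrite lerD2r ler_pM2r ?invr_gt0 // ler_int lerDl.
under eq_bigr => j _.
  have -> : (c j 0 + 1)%:~R / N%:R - c0 j - ((c j 0)%:~R / N%:R - c0 j) = N%:R^-1 :> R.
    by rewrite rmorphD /= mulrDl mul1r; ring.
  over.
by rewrite prodr_const card_ord exprVn.
Qed.

(** The Riemann sum is the integral of a step function, which converges to f and
    is dominated by a multiple of the indicator of a box. *)
Lemma riemann_sum_cvg k (c0 : 'I_k -> R) (F : nat -> 'cV[int]_k -> R)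
    (S : nat -> seq 'cV[int]_k) (f : E k -> R) (W B : R) :
  (forall N, (0 < N)%N -> uniq (S N)) ->
  (forall N c, (0 < N)%N -> F N c != 0 -> c \in S N) ->
  measurable_fun setT f -> 0 <= B ->
  (forall N c, (0 < N)%N -> `|F N c| <= W) ->
  (forall N c j, (0 < N)%N -> F N c != 0 -> `|(c j 0)%:~R : R| <= N%:R * B) ->
  {ae mu k, forall t, \forall N \near \oo, F N.+1 (cell_index c0 N.+1 t) = f t} ->
  (fun N => (\sum_(c <- S N.+1) F N.+1 c) / N.+1%:R ^+ k) @ \oo --> (\int[mu k]_t f t : R).
Proof.
move=> Su SF mf B0 FW FB Ff.
pose h N (t : E k) : R := \sum_(c <- S N.+1) F N.+1 c * \1_(cell c0 N.+1 c) t.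
have hE N t : h N t = F N.+1 (cell_index c0 N.+1 t).
  rewrite /h; set c1 := cell_index _ _ _.
  have E c : \1_(cell c0 N.+1 c) t = (c == c1)%:R :> R.
    rewrite indicE; congr ((nat_of_bool _)%:R); apply/idP/eqP => [/set_mem/cellP ->//|->].
    by apply/mem_set/cellP.
  under eq_bigr do rewrite E.
  have [c1S|c1S] := boolP (c1 \in S N.+1).
    rewrite (bigD1_seq c1) ?Su //= eqxx mulr1 big1 ?addr0 // => c /negPf ->.
    by rewrite mulr0.
  rewrite big_seq big1; last first.
    move=> c cS; have [e|] := eqVneq c c1; last by rewrite mulr0.
    by move: c1S; rewrite -e cS.
  by apply/esym/eqP/negPn/negP => /SF; rewrite (negPf c1S) => /(_ isT).
have mh N : measurable_fun setT (h N).
  apply: measurable_sum => c; apply: measurable_funM; first exact: measurable_cst.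
  exact/measurable_indic/measurable_cell.
have ih N : (\int[mu k]_t (h N t)%:E)%E
    = ((\sum_(c <- S N.+1) F N.+1 c) / N.+1%:R ^+ k)%:E.
  under eq_integral do rewrite /h -sumEFin.
  have i1 c : (mu k).-integrable setT (fun t => (\1_(cell c0 N.+1 c) t : R)%:E).
    apply: euclid_integrable_indic; first exact: measurable_cell.
    by rewrite measure_cell // ltry.
  rewrite integral_sum //; last by move=> c; under eq_fun do rewrite EFinM; exact: integrableZl.
  rewrite mulr_suml -sumEFin; apply: eq_bigr => c _.
  under eq_integral do rewrite EFinM.
  rewrite integralZl // integral_indic //; last exact: measurable_cell.
  rewrite setIT; transitivity ((F N.+1 c)%:E * mu k (cell c0 N.+1 c))%E => //.
  by rewrite measure_cell.
pose Bx : set (E k) := box (fun j => - B - c0 j) (fun j => B + 1 - c0 j).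
have mBx : measurable Bx by exact: measurable_box.
have W0 : 0 <= W by apply: le_trans (FW 1%N 0 isT).
have := @dominated_convergence _ _ R (mu k) setT measurableT
  (fun N t => (h N t)%:E) (fun t => (f t)%:E) (fun t => (W * \1_Bx t)%:E).
case.
- by move=> N; apply/measurable_EFinP.
- exact/measurable_EFinP.
- apply: filterS Ff => t Ht _; apply: cvg_near_cst.
  by apply: filterS Ht => N; rewrite hE => ->.
- under eq_fun do rewrite EFinM.
  apply: integrableZl => //; apply: euclid_integrable_indic => //.
  rewrite measure_box ?ltry // => j.
  by rewrite lerD2r; move: B0; lra.
- apply: aeW => t N _; rewrite /= lee_fin hE.
  have [->|nz] := eqVneq (F N.+1 (cell_index c0 N.+1 t)) 0.
    by rewrite normr0 mulr_ge0.
  rewrite indicE mem_set ?mulr1; first exact: FW.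
  have := (cellP c0 (cell_index c0 N.+1 t) t (ltn0Sn N)).2 erefl => H j.
  have /andP[lo hi] := H j.
  have N0' : 0 < N.+1%:R :> R by rewrite ltr0n.
  have := FB _ _ j (ltn0Sn N) nz; rewrite mulrC ler_norml => /andP[].
  rewrite -mulNr -(ler_pdivlMr _ _ N0') -(ler_pdivrMr _ _ N0').
  move: lo hi; rewrite rmorphD /= mulrDl mul1r.
  have : N.+1%:R^-1 <= 1 :> R by rewrite invf_le1 // ler1n.
  move: (cs_vec t j 0) (_%:~R / _) => tj x; move: (_^-1) (c0 j) => y z; lra.
move=> fi _ H; have {}H : ((\sum_(c <- S N.+1) F N.+1 c) / N.+1%:R ^+ k)%:E @[N --> \oo]
     --> (\int[mu k]_t (f t)%:E)%E.
  by move: H; rewrite /=; under eq_fun do rewrite ih.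
have fin : (\int[mu k]_t (f t)%:E)%E \is a fin_num by exact: integrable_fin_num.
rewrite -(fineK fin) in H; exact: (fine_cvg H).
Qed.

End Euclid.

(** * The volume as a leading coefficient *)

Lemma filter_forall_fin (T : Type) (I : finType) (F : set_system T) (P : I -> T -> Prop) :
  Filter F -> (forall i, F (P i)) -> F (fun x => forall i, P i x).
Proof.
move=> FF H.
have {}H (s : seq I) : F (fun x => forall i, i \in s -> P i x).
  elim: s => [|i s IH]; first by apply: filterS filterT.
  apply: filterS2 (H i) IH => x Pi Ps j.
  by rewrite inE => /orP[/eqP ->|/Ps].
by apply: filterS (H (enum I)) => x Hx i; apply: Hx; rewrite mem_enum.
Qed.

Lemma poly_values_eq0 (F : numDomainType) (M : nat) (x : nat -> F) :
  (forall N, (0 < N)%N -> \sum_(l < M) N%:R ^+ l * x l = 0) ->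
  forall l, (l < M)%N -> x l = 0.
Proof.
move=> H l lM; pose p := \poly_(l < M) x l.
have -> : x l = p`_l by rewrite coef_poly lM.
suff -> : p = 0 by rewrite coef0.
pose rs := [seq (N.+1)%:R : F | N <- iota 0 M].
apply: (@roots_geq_poly_eq0 _ _ rs).
- apply/allP => y /mapP [N _ ->]; apply/rootP; rewrite horner_poly -[RHS](H N.+1) //.
  by apply: eq_bigr => i _; rewrite mulrC.
- rewrite map_inj_uniq ?iota_uniq // => a c /eqP; rewrite eqr_nat => /eqP; exact: succn_inj.
by rewrite size_map size_iota; exact: size_poly.
Qed.

Lemma poly_sum_parts (R : realType) (M N : nat) (x : nat -> R[i]) :
  \sum_(l < M) N%:R ^+ l * x l
  = ((\sum_(l < M) N%:R ^+ l * complex.Re (x l)) +i* (\sum_(l < M) N%:R ^+ l * complex.Im (x l)))%C.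
Proof.
have E (l : nat) : N%:R ^+ l * x l
    = ((N%:R ^+ l * complex.Re (x l)) +i* (N%:R ^+ l * complex.Im (x l)))%C.
  have -> : N%:R ^+ l = ((N%:R ^+ l : R)%:C)%C by rewrite rmorphXn rmorph_nat.
  by case: (x l) => a c; apply/eqP; rewrite eq_complex /= !mul0r subr0 addr0 !eqxx.
under eq_bigr do rewrite E.
by elim/big_rec3: _ => [//|i a c e _ ->]; apply/eqP; rewrite eq_complex /= !eqxx.
Qed.

Lemma poly_lead_cvg (R : realType) (k : nat) (x : nat -> R) :
  (fun N => (\sum_(l < k.+1) N.+1%:R ^+ l * x l) / N.+1%:R ^+ k) @ \oo --> x k.
Proof.
pose p : {poly R} := \poly_(l < k.+1) x (k - l)%N.
have -> : x k = p.[0] by rewrite horner_coef0 coef_poly /= subn0.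
rewrite (_ : (fun N => _) = horner p \o @harmonic R).
  by apply: continuous_cvg; [exact: continuous_horner|exact: cvg_harmonic].
apply/funext => N /=; rewrite horner_poly mulr_suml.
rewrite [RHS](reindex_inj rev_ord_inj) /=; apply: eq_bigr => l _.
have lk : (l <= k)%N by rewrite -ltnS.
have e : N.+1%:R ^+ k = N.+1%:R ^+ (k - l) * N.+1%:R ^+ l :> R by rewrite -exprD subnK.
have n0 j : N.+1%:R ^+ j != 0 :> R by rewrite expf_neq0 // pnatr_eq0.
rewrite subSS subKn // e exprVn; move: (n0 l) (n0 (k - l)%N).
by move: (_ ^+ l) (_ ^+ (k - l)) => y z y0 z0; field; rewrite ?y0 ?z0.
Qed.

Section Volume.
Variables (R : realType) (n : nat) (V : finType) (D : multifan R n V).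
Variables (v : V -> 'rV[int]_n).
Hypotheses (Dv : edge_vectors D v) (cD : complete_multifan D).
Variable m : nat.
Hypothesis dm : forall I i, denom_dvd m (dual v I i).
Implicit Types (I J K : {set V}).

Lemma annMP K u : K \in simplices D ->
  annM D K u <-> forall i, i \in K -> pairing u (v i) = 0.
Proof.
move=> KS; split=> [H i iK|H x]; first by apply: H; exact: edge_in_latN.
have [I [IS In KI]] := simplices_pure KS.
have ISn : I \in skel D n by apply/skelP.
move=> /(latNP Dv ISn KI) xK.
apply/eqP; rewrite -(intr_eq0 rat) -pairing_ofZ.
rewrite (expand_edgesQ Dv (ofZ rat x) ISn) pairing_sumr big1 // => i iI.
rewrite pairingZr pairing_ofZ; have [iK|iK] := boolP (i \in K).
  by rewrite H // mulr0.
by rewrite xK ?mul0r // finset.in_setD iK.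
Qed.

Lemma scaled_dual I i : exists w : 'cV[int]_n, ofZ rat w = m.+2%:R *: dual v I i.
Proof.
have /choice [w Hw] : forall l, exists c : int, m.+2%:R * dual v I i l 0 = c%:~R.
  move=> l; have := dm I i (delta_mx 0 l).
  rewrite ofZZ pairingZr.
  have -> : ofZ rat (delta_mx 0 l : 'rV_n) = delta_mx 0 l.
    by apply/matrixP => a c; rewrite !mxE; case: (_ && _).
  by rewrite pairing_delta => /intrP.
by exists (\col_l w l); apply/matrixP => l c; rewrite ord1 !mxE Hw.
Qed.

Variables (K : {set V}) (k : nat) (b : 'M[int]_(n, k)).
Hypotheses (KS : K \in simplices D) (hb : lattice_basis (annM D K) b).

Lemma basis_inj (c c' : 'cV[int]_k) : b *m c = b *m c' -> c = c'.
Proof.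
move=> e; have /hb [c1 [_ Hc1]] : annM D K 0 by move=> x _; rewrite pairing0l.
apply/eqP; rewrite -subr_eq0; apply/eqP.
rewrite -(Hc1 0) ?mulmx0 //; apply/esym/Hc1.
by rewrite mulmxBr e subrr.
Qed.

(** The multiple is integral and vanishes on the edges of K, hence lies in the
    lattice spanned by b. *)
Lemma scaled_dual_basis I i : I \in facets D K -> i \in I :\: K ->
  exists c : 'cV[int]_k, ofZ rat (b *m c) = m.+2%:R *: dual v I i.
Proof.
move=> /facetsP [IS In KI] /finset.setDP [iI iK]; have [w Hw] := scaled_dual I i.
have /hb [c [e _]] : annM D K w.
  apply/(annMP _ KS) => j jK; apply/eqP; rewrite -(intr_eq0 rat) -pairing_ofZ Hw pairingZl.
  rewrite (dualP Dv i IS) ?(fintype.subsetP KI) //.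
  by rewrite (_ : i == j = false) ?mulr0 //; apply/eqP => e; rewrite e jK in iK.
by exists c; rewrite -e.
Qed.

Lemma pairing_basis (F : comPzRingType) (c : 'cV[F]_k) i :
  pairing (ofZ F b *m c) (ofZ F (v i)) = \sum_j ((v i *m b) 0 j)%:~R * c j 0.
Proof. by rewrite /pairing mulmxA -map_mxM mxE; under eq_bigr do rewrite mxE. Qed.

(** The scaled dual vector is a direction of the face along which the i-th
    coordinate varies. *)
Lemma edge_nonconstant I i : I \in facets D K -> i \in I :\: K ->
  exists j, (v i *m b) 0 j != 0.
Proof.
move=> IF iIK; have [c Hc] := scaled_dual_basis IF iIK.
apply: contrapT => /forallNP H.
have /eqP : pairing (ofZ rat (b *m c)) (ofZ rat (v i)) = 0.
  rewrite /ofZ map_mxM -/(ofZ rat b) pairing_basis big1 // => j _.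
  by have /negP/negPn/eqP -> := H j; rewrite mul0r.
rewrite Hc pairingZl (dualP Dv) ?eqxx ?mulr1 ?pnatr_eq0 //.
  by case/facetsP: IF.
by case/finset.setDP: iIK.
Qed.

(** The dual vectors off K span the annihilator of K over the reals, and their
    multiples are combinations of b. *)
Lemma real_combination (w : 'cV[R]_n) :
  (forall i, i \in K -> pairing w (ofZ R (v i)) = 0) ->
  exists c : 'cV[R]_k, w = ofZ R b *m c.
Proof.
move=> wK; have [I [IS In KI]] := simplices_pure KS.
have IF : I \in facets D K by apply/facetsP.
have /choice [c Hc] : forall i, exists c : 'cV[int]_k, i \in I :\: K ->
    ofZ rat (b *m c) = m.+2%:R *: dual v I i.
  move=> i; have [iIK|] := boolP (i \in I :\: K); last by exists 0.
  by have [c Hc] := scaled_dual_basis IF iIK; exists c.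
exists (\sum_(i in I) (pairing w (ofZ R (v i)) / m.+2%:R) *: ofZ R (c i)).
rewrite {1}(expand_dualR Dv w (facets_skel IF)) mulmx_sumr; apply: eq_bigr => i iI.
rewrite -scalemxAr; have [iK|iK] := boolP (i \in K).
  by rewrite wK // mul0r !scale0r.
rewrite -[ofZ R b *m _]map_mxM -scalerA -/(ofZ R (b *m c i)); congr (_ *: _).
rewrite -ofZ_ratr Hc ?finset.in_setD ?iK // map_mxZ rmorph_nat scalerA mulVf ?scale1r //.
Qed.

Lemma latticeP (u0 : 'cV[int]_n) (d : V -> int) u : (forall i, i \in K -> pairing u0 (v i) = d i) ->
  lattice_slice v K d u <-> exists c, u = u0 + b *m c.
Proof.
move=> u0K; split.
  move=> uK; have /hb [c [e _]] : annM D K (u - u0).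
    by apply/(annMP _ KS) => i iK; rewrite pairingBl u0K // uK // subrr.
  by exists c; rewrite -e addrC subrK.
move=> [c ->] i iK; rewrite pairingDl u0K //.
have /(annMP _ KS) -> // : annM D K (b *m c).
  by apply/hb; exists c; split=> // c' /basis_inj.
exact: addr0.
Qed.

(** A rational relation between the columns has an integral multiple, which is
    excluded by the uniqueness of coordinates. *)
Lemma basis_left_inverse : exists L : 'M[R]_(k, n), L *m ofZ R b = 1%:M.
Proof.
suff : row_full (ofZ rat b).
  move=> /row_fullP [L HL]; exists (map_mx ratr L).
  by rewrite -ofZ_ratr -map_mxM HL map_scalar_mx rmorph1.
rewrite /row_full -mxrank_tr -[_ == _]/(row_free (ofZ rat b)^T) -kermx_eq0.
apply/negPn/negP => /rowV0Pn [w /sub_kermxP wb w0].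
have [q q0 Hq] := common_denom (fun j : 'I_k => w 0 j).
have [c Hc] := choice Hq.
have cE : ofZ rat (\col_j c j) = q%:R *: w^T.
  by apply/colP => j; rewrite !mxE Hc.
have : \col_j c j = 0 :> 'cV[int]_k.
  apply: basis_inj; rewrite mulmx0; apply: (@ofZ_inj rat).
  rewrite /ofZ map_mxM -!/(ofZ rat _) cE -scalemxAr -[ofZ rat b]trmxK -trmx_mul wb.
  by rewrite trmx0 scaler0; apply/matrixP => i j; rewrite !mxE.
move=> c0; move: cE; rewrite c0 => /esym/eqP.
rewrite (_ : ofZ rat 0 = 0); last by apply/matrixP => i j; rewrite !mxE.
rewrite scaler_eq0 pnatr_eq0 -[q == 0%N]negbK -lt0n q0 /= => /eqP wT.
by move: w0; rewrite -[w]trmxK wT trmx0 eqxx.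
Qed.

Lemma signed_DH_ext (h : 'rV[R]_n) (s s' : V -> bool) :
  (forall I i, I \in facets D K -> i \in I :\: K -> s i = s' i) ->
  signed_DH D v h K s = signed_DH D v h K s'.
Proof.
move=> H; apply: eq_bigr => I IF; congr (_ * _).
by apply: eq_bigr => i iIK; rewrite (H I i).
Qed.

Lemma signed_DH_bounded (h : 'rV[R]_n) (s : V -> bool) :
  `|signed_DH D v h K s| <= \sum_(I in facets D K) `|(weight D I)%:~R|.
Proof.
apply: le_trans (ler_norm_sum _ _ _) _; apply: ler_sum => I IF.
rewrite normrM ler_piMr // normr_prod.
apply: prodr_ile1 => i _; rewrite normr_ge0 /= /is_pos.
by case: (s i); rewrite ?normrN; case: (_ < _); rewrite ?normr0 ?normr1.
Qed.

Lemma measurable_cond_ler (k' : nat) (f : cs_sort (euclid R k') -> R) (a : R) :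
  measurable_fun setT f -> measurable_fun setT (fun t => (a <= f t)%R%:R : R).
Proof.
move=> mf.
have -> : (fun t => (a <= f t)%R%:R : R) = \1_(setT `&` f @^-1` `[a, +oo[%classic).
  apply/funext => t; rewrite setTI indicE; congr ((nat_of_bool _)%:R).
  apply/idP/idP => [h|/set_mem /=]; first by apply/mem_set; rewrite /= in_itv /= h.
  by rewrite in_itv /= andbT.
by apply: measurable_indic; apply: mf => //; exact: measurable_itv.
Qed.

Lemma measurable_cond_ger (k' : nat) (f : cs_sort (euclid R k') -> R) (a : R) :
  measurable_fun setT f -> measurable_fun setT (fun t => (f t <= a)%R%:R : R).
Proof.
move=> mf.
have -> : (fun t => (f t <= a)%R%:R : R) = \1_(setT `&` f @^-1` `]-oo, a]%classic).
  apply/funext => t; rewrite setTI indicE; congr ((nat_of_bool _)%:R).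
  apply/idP/idP => [h|/set_mem /=]; first by apply/mem_set; rewrite /= in_itv /= h.
  by rewrite in_itv.
by apply: measurable_indic; apply: mf => //; exact: measurable_itv.
Qed.

Lemma same_sign (x y M : R) : `|x - y| <= M -> M < `|x| -> (0 < y) = (0 < x).
Proof.
rewrite ler_norml => /andP[h1 h2]; case: (ler0P x) => x0 h.
  by apply: negbTE; rewrite -leNgt; lra.
by lra.
Qed.


Section Limit.
Variables (h : 'rV[R]_n) (d : V -> int) (uI : {set V} -> 'cV[int]_n).
Hypothesis dh : DH_direction D v K h.
Hypothesis uIE : forall I, I \in skel D n ->
  ofZ rat (uI I) = \sum_(i in I) (d i)%:~R *: dual v I i.

Local Notation dR := (fun i => (d i)%:~R : R).
Local Notation F u0 := (fun N c => slice_term D v h K (fun i => N%:Z * d i) (N%:Z *: u0 + b *m c)).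

Lemma vertex_in_slice I i : I \in facets D K -> i \in K -> pairing (uI I) (v i) = d i.
Proof.
move=> IF iK; have [IS In KI] := facetsP _ _ _ IF.
have iI := fintype.subsetP KI _ iK.
apply: (@intr_inj rat); rewrite -pairing_ofZ uIE ?(facets_skel IF) // pairing_suml (bigD1 i) //=.
rewrite pairingZl (dualP Dv) // eqxx mulr1 big1 ?addr0 // => j /andP[_ ji].
by rewrite pairingZl (dualP Dv) // (negPf ji) mulr0.
Qed.

Lemma slice_count_coords (u0 : 'cV[int]_n) (N : nat) : (forall i, i \in K -> pairing u0 (v i) = d i) ->
  exists S : seq 'cV[int]_k, [/\ uniq S, (forall c, F u0 N c != 0 -> c \in S) &
    slice_count D v h K (fun i => N%:Z * d i) = \sum_(c <- S) F u0 N c].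
Proof.
move=> u0K; have Nu0 i : i \in K -> pairing (N%:Z *: u0) (v i) = N%:Z * d i.
  by move=> iK; rewrite pairingZl u0K.
have [S [Su Sl SP SE]] := slice_countE Dv cD (fun i => N%:Z * d i) dh.
have /choice [phi Hphi] : forall u, exists c : 'cV[int]_k, u \in S -> u = N%:Z *: u0 + b *m c.
  move=> u; have [/Sl /(latticeP _ Nu0) [c e]|] := boolP (u \in S); last by exists 0.
  by exists c.
exists (map phi S); split.
- rewrite map_inj_in_uniq // => u u' uS u'S e.
  by rewrite (Hphi u uS) (Hphi u' u'S) e.
- move=> c cn; have uS : N%:Z *: u0 + b *m c \in S.
    by apply: SP => //; apply/(latticeP _ Nu0); exists c.
  apply/mapP; exists (N%:Z *: u0 + b *m c) => //.
  by apply: basis_inj; apply: (addrI (N%:Z *: u0)); exact: Hphi.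
by rewrite SE big_map; apply: eq_big_seq => u uS; rewrite -Hphi.
Qed.

(** Coordinates on b are recovered from the point by a left inverse of b. *)
Lemma slice_term_range (u0 : 'cV[int]_n) : (forall i, i \in K -> pairing u0 (v i) = d i) ->
  exists2 B : R, 0 <= B & forall N c j, F u0 N c != 0 -> `|(c j 0)%:~R : R| <= N%:R * B.
Proof.
move=> u0K; have [C C0 HC] := support_bounded Dv cD dh.
have [L HL] := basis_left_inverse.
pose A : R := \sum_i `|(d i)%:~R|; have A0 : 0 <= A by apply: sumr_ge0.
have dA i : `|(d i)%:~R| <= A by rewrite /A (bigD1 i) //= lerDl sumr_ge0.
pose B : R := \sum_j \sum_l `|L j l| * (A * C + `|(u0 l 0)%:~R|).
exists B; first by do 2!apply: sumr_ge0 => ? _; rewrite mulr_ge0 // addr_ge0 // mulr_ge0.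
move=> N c j Fn; set u := N%:Z *: u0 + b *m c.
have uK : lattice_slice v K (fun i => N%:Z * d i) u.
  by apply/(latticeP (u0 := N%:Z *: u0)); [move=> i iK; rewrite pairingZl u0K|exists c].
have Hu l : `|(u l 0)%:~R : R| <= (N%:R * A) * C.
  have := HC _ _ (N%:R * A) (slice_affA R uK); rewrite mulr_ge0 // => /(_ isT).
  rewrite -slice_term_real => H; have := H _ Fn l; rewrite mxE; apply.
  by move=> i; rewrite rmorphM normrM /= -pmulrn normr_nat ler_wpM2l.
have cE : ofZ R c = L *m (ofZ R u - N%:R *: ofZ R u0).
  have -> : ofZ R u - N%:R *: ofZ R u0 = ofZ R b *m ofZ R c.
    rewrite -[RHS]map_mxM; apply/matrixP => x y; rewrite !mxE /= rmorphD rmorphM /=; ring.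
  by rewrite mulmxA HL mul1mx.
have -> : (c j 0)%:~R = (ofZ R c) j 0 by rewrite mxE.
rewrite cE mxE; apply: le_trans (ler_norm_sum _ _ _) _.
rewrite /B (bigD1 j) //= mulrDr ler_wpDr //.
  rewrite mulr_ge0 //; do 2!apply: sumr_ge0 => ? _.
  by rewrite mulr_ge0 // addr_ge0 // mulr_ge0.
rewrite mulr_sumr; apply: ler_sum => l _; rewrite normrM mulrCA ler_wpM2l //.
rewrite !mxE; apply: le_trans (ler_normB _ _) _; rewrite mulrDr mulrA; apply: lerD.
  by have := Hu l; rewrite !mxE.
by rewrite normrM normr_nat.
Qed.

Lemma basis_kills i j : i \in K -> (v i *m b) 0 j = 0.
Proof.
move=> iK; have /(annMP _ KS)/(_ i iK) : annM D K (b *m delta_mx j 0).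
  by apply/hb; exists (delta_mx j 0); split=> // c' /basis_inj.
by rewrite /pairing mulmxA -colE mxE.
Qed.

Lemma affA_translate (w : 'cV[R]_n) c : affA v dR K w -> affA v dR K (w + ofZ R b *m c).
Proof.
move=> wK i iK; rewrite pairingDl wK // pairing_basis big1 ?addr0 // => j _.
by rewrite basis_kills // mul0r.
Qed.

Local Notation E := (cs_sort (euclid R k)).

Lemma measurable_DH (w : 'cV[R]_n) : affA v dR K w ->
  measurable_fun setT (fun t : E => DH D v h dR K (w + ofZ R b *m cs_vec t)).
Proof.
move=> wK; under eq_fun do rewrite (DH_prod Dv _ (affA_translate _ wK)) big_mkcond /=.
have mp i : measurable_fun setT (fun t : E => pairing (w + ofZ R b *m cs_vec t) (ofZ R (v i))).
  by under eq_fun do rewrite pairingDl pairing_basis; exact: measurable_affine.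
apply: measurable_sum => I; case: (I \in facets D K); last exact: measurable_cst.
apply: measurable_funM; first exact: measurable_cst.
under eq_fun do rewrite big_mkcond /=.
apply: measurable_prod => i _; case: (i \in I :\: K); last exact: measurable_cst.
case: (0 < _).
  by apply: measurable_funN; exact: measurable_cond_ler.
exact: measurable_cond_ger.
Qed.

(** Away from the walls, the side of a wall on which a point lies is eventually
    that of the lattice points that approximate it, since the error is bounded
    while the distance is multiplied by N. *)
Lemma volume_limit : (fun N => slice_count D v h K (fun i => N.+1%:Z * d i) / N.+1%:R ^+ k)
  @ \oo --> vol D v h dR b K.
Proof.
have [I0 [I0S I0n KI0]] := simplices_pure KS.
have IF0 : I0 \in facets D K by apply/facetsP.
set u0 := uI I0; have u0K i : i \in K -> pairing u0 (v i) = d i by exact: vertex_in_slice.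
have u0A : affA v dR K (ofZ R u0) by move=> i iK; rewrite pairing_ofZ u0K.
rewrite /vol; set w := xget 0 _.
have wA : affA v dR K w by rewrite /w; exact: (xgetPex 0 (ex_intro _ _ u0A)).
have [c0 Hc0] : exists c : 'cV[R]_k, w - ofZ R u0 = ofZ R b *m c.
  by apply: real_combination => i iK; rewrite pairingBl wA // u0A // subrr.
have /choice [S HS] := fun N => slice_count_coords N u0K.
have [B B0 HB] := slice_term_range u0K.
rewrite (_ : (fun N => _) = fun N => (\sum_(c <- S N.+1) F u0 N.+1 c) / N.+1%:R ^+ k); last first.
  by apply/funext => N; have [_ _ ->] := HS N.+1.
apply: (@riemann_sum_cvg R k (fun j => c0 j 0) (F u0) S _ (\sum_(I in facets D K) `|(weight D I)%:~R|) B).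
- by move=> N _; have [] := HS N.
- by move=> N c _; have [_ + _] := HS N; apply.
- exact: measurable_DH.
- exact: B0.
- by move=> N c _; exact: signed_DH_bounded.
- by move=> N c j _; exact: HB.
pose de i (t : E) := pairing w (ofZ R (v i)) - dR i + \sum_j ((v i *m b) 0 j)%:~R * (cs_vec t) j 0.
have deE i t : pairing (w + ofZ R b *m cs_vec t) (ofZ R (v i)) - dR i = de i t.
  by rewrite pairingDl pairing_basis addrAC.
(* The walls are null sets since no coordinate off K is constant on the face. *)
have ae1 : {ae cs_measure (euclid R k), forall t, forall p : {set V} * V,
     p.1 \in facets D K -> p.2 \in p.1 :\: K -> de p.2 t != 0}.
  apply: filter_forall_fin => -[I i] /=.
  have [IF|IF] := boolP (I \in facets D K); last by apply: aeW => t.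
  have [iIK|iIK] := boolP (i \in I :\: K); last by apply: aeW => t.
  exists [set t | de i t = 0]; split; first exact: measurable_hyperplane.
    apply: hyperplane_null; have [j Hj] := edge_nonconstant IF iIK.
    by exists j; rewrite intr_eq0.
  by move=> t /= Ht; apply: contrapT => /eqP nz; apply: Ht.
apply: filterS ae1 => t Ht.
have off I i : I \in facets D K -> i \in I :\: K ->
    pairing (w + ofZ R b *m cs_vec t) (ofZ R (v i)) != dR i.
  by move=> IF iIK; rewrite -subr_eq0 deE; exact: (Ht (I, i)).
have near1 : \forall N \near \oo, forall p : {set V} * V,
   p.1 \in facets D K -> p.2 \in p.1 :\: K ->
   (\sum_j `|((v p.2 *m b) 0 j)%:~R : R|) / `|de p.2 t| < N%:R.
  by apply: filter_forall_fin => p; apply: filterS (nbhs_infty_gtr _) => N H _ _; exact: H.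
apply: filterS near1 => N HN.
rewrite DH_signed //; last exact: affA_translate.
rewrite slice_term_real; apply: signed_DH_ext => I i IF iIK.
have de0 := Ht (I, i) IF iIK; have N0 : 0 < N.+1%:R :> R by rewrite ltr0n.
rewrite -subr_gt0 -[RHS]subr_gt0 deE -[RHS](pmulr_rgt0 _ N0).
apply: (@same_sign _ _ (\sum_j `|((v i *m b) 0 j)%:~R : R|)); last first.
  rewrite normrM normr_nat -ltr_pdivrMr ?normr_gt0 //.
  apply: lt_trans (_ : N%:R < _); last by rewrite ltr_nat.
  exact: (HN (I, i)).
set c := cell_index _ _ _.
have -> : N.+1%:R * de i t - (pairing (ofZ R (N.+1%:Z *: u0 + b *m c)) (ofZ R (v i)) - (N.+1%:Z * d i)%:~R)
   = \sum_j ((v i *m b) 0 j)%:~R * (N.+1%:R * ((cs_vec t) j 0 + c0 j 0) - (c j 0)%:~R).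
  have -> : ofZ R (N.+1%:Z *: u0 + b *m c) = N.+1%:R *: ofZ R u0 + ofZ R b *m ofZ R c.
    by rewrite -[ofZ R b *m _]map_mxM; apply/matrixP => x y; rewrite !mxE /= rmorphD rmorphM.
  have wE : pairing w (ofZ R (v i)) = pairing (ofZ R u0) (ofZ R (v i))
      + \sum_j ((v i *m b) 0 j)%:~R * c0 j 0.
    by rewrite -pairing_basis -pairingDl -Hc0 addrC subrK.
  rewrite pairingDl pairingZl pairing_basis /de wE rmorphM /=.
  have -> : \sum_j ((v i *m b) 0 j)%:~R * (ofZ R c) j 0 = \sum_j ((v i *m b) 0 j)%:~R * (c j 0)%:~R :> R.
    by apply: eq_bigr => j _; congr (_ * _); rewrite mxE.
  have -> : \sum_j ((v i *m b) 0 j)%:~R * (N.+1%:R * (cs_vec t j 0 + c0 j 0) - (c j 0)%:~R)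
     = N.+1%:R * (\sum_j ((v i *m b) 0 j)%:~R * cs_vec t j 0)
       + N.+1%:R * (\sum_j ((v i *m b) 0 j)%:~R * c0 j 0)
       - \sum_j ((v i *m b) 0 j)%:~R * (c j 0)%:~R :> R.
    rewrite !mulr_sumr -big_split /= -sumrB; apply: eq_bigr => j _; ring.
  move: (pairing _ _) (\sum_j _ * cs_vec t j 0) (\sum_j _ * c0 j 0) (\sum_j _ * (c j 0)%:~R) (d i)%:~R.
  by move=> x1 x2 x3 x4 x5; ring.
apply: le_trans (ler_norm_sum _ _ _) _; apply: ler_sum => j _.
rewrite normrM ler_piMr // /c mxE.
have /andP[] := floor_itv (N.+1%:R * (cs_vec t j 0 + c0 j 0)).
rewrite rmorphD /= => h1 h2; rewrite ger0_norm ?subr_ge0 //; lra.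
Qed.

(** The count divided by the k-th power of the dilation factor tends to the
    volume, and also to its coefficient of degree k. The count being real, so is
    this coefficient. *)
Lemma volumeE g : k = (n - #|K|)%N -> good_direction D v g ->
  ((vol D v h dR b K)%:C)%C = slice_coef D v m g K uI k.
Proof.
move=> kE gg; pose x l := slice_coef D v m g K uI l.
have H N : ((slice_count D v h K (fun i => N%:Z * d i))%:C)%C
    = \sum_(l < k.+1) N%:R ^+ l * x l.
  by rewrite kE (slice_count_expansion Dv cD dm N dh gg uIE).
have ReIm N : slice_count D v h K (fun i => N%:Z * d i)
      = \sum_(l < k.+1) N%:R ^+ l * complex.Re (x l)
    /\ \sum_(l < k.+1) N%:R ^+ l * complex.Im (x l) = 0.
  by have := poly_sum_parts k.+1 N x; rewrite -H => -[-> <-].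
have Im0 : complex.Im (x k) = 0.
  apply: (@poly_values_eq0 R k.+1 (fun l => complex.Im (x l))) => // N _.
  by have [] := ReIm N.
have Re1 : vol D v h dR b K = complex.Re (x k).
  apply: (cvg_unique (@Rhausdorff R) volume_limit).
  rewrite (_ : (fun N => _) = (fun N => (\sum_(l < k.+1) N.+1%:R ^+ l * complex.Re (x l)) / N.+1%:R ^+ k)).
    exact: (@poly_lead_cvg R k (fun l => complex.Re (x l))).
  by apply/funext => N; have [-> _] := ReIm N.+1.
by rewrite Re1 -[RHS]/(x k); case: (x k) Im0 => a c /= ->.
Qed.

End Limit.
End Volume.

(** * The local identity at a facet *)

Section FacetIdentity.
Variables (R : realType) (n : nat) (V : finType) (D : multifan R n V).
Variables (v : V -> 'rV[int]_n).
Hypotheses (Dv : edge_vectors D v).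
Variable m : nat.
Hypothesis dm : forall I i, denom_dvd m (dual v I i).
Implicit Types (I J : {set V}).
Local Notation C := R[i].

Lemma degree0_partE k J (c : V -> C) (y : V -> C) : #|J| = k ->
  degree0_part idfun J c y = \sum_(e : {ffun V -> 'I_k.+1} |
       [forall i, (i \notin J) ==> (e i == 0%N :> nat)] && (\sum_(j in J) e j == k)%N)
    \prod_(j in J) (laurent_coef (c j) (e j) * y j ^ ((e j)%:Z - 1)).
Proof. by move=> <-. Qed.

Lemma off_integral_prod I J (xi : 'rV['I_m.+2]_n) : (off_integral v I J xi)%:R
  = \prod_(i in I :\: J) laurent_coef (vertex_root R v I i xi) 0 :> C.
Proof.
have -> : \prod_(i in I :\: J) laurent_coef (vertex_root R v I i xi) 0
    = \prod_(i in I :\: J) (coord (dual v I i) xi \is a Num.int)%:R :> C.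
  by apply: eq_bigr => i _; rewrite laurent_coef0 /vertex_root ex_eq1.
have [H|] := boolP (off_integral v I J xi).
  by rewrite big1 // => i iIJ; rewrite (forall_inP H i iIJ).
rewrite /off_integral negb_forall_in => /exists_inP [i iIJ /negPf Hi].
by rewrite (bigD1 i) //= Hi mul0r.
Qed.

Variable k : nat.
Hypotheses (k1 : (1 <= k)%N) (kn : (k <= n)%N).
Local Notation p := (1 + (n - k))%N.
Variable b : {set V} -> 'M[int]_(n, n - k).
Hypothesis hb : forall J, J \in skel D k -> lattice_basis (annM D J) (b J).
Variable z : 'M[C]_(p, n).

Definition dualC I i : 'cV[C]_n := map_mx ratr (dual v I i).

(** The determinant that represents f^J at z: the linear form on M with value u
    /\ omega_J at the row space of z. *)
Definition minor J (u : 'cV[C]_n) : C := \det (z *m row_mx u (ofZ C (b J))).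

(** The cofactors of the first column give the coordinates, in the rows of z, of
    a vector of the row space that spans, in general position, its intersection
    with N_J. *)
Definition minor_point J : 'rV[C]_p :=
  \row_a cofactor (z *m row_mx 0 (ofZ C (b J)) : 'M[C]_p) a 0.

Lemma minor_point_cofactor J u a :
  minor_point J 0 a = cofactor (z *m row_mx u (ofZ C (b J)) : 'M[C]_p) a 0.
Proof.
rewrite mxE /cofactor; congr (_ * \det _); apply/matrixP => x y.
rewrite !mul_mx_row !mxE; case: fintype.splitP => // j /=.
by rewrite ord1.
Qed.

Lemma minorE J u : minor J u = (minor_point J *m (z *m u)) 0 0.
Proof.
rewrite /minor (expand_det_col _ 0) mxE; apply: eq_bigr => a _.
rewrite (minor_point_cofactor J u); apply: etrans (mulrC _ _) _; congr (_ * _).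
by rewrite mul_mx_row mxE; case: fintype.splitP => // j _; rewrite ord1.
Qed.

Lemma minor_basis J c : minor J (ofZ C (b J) *m c) = 0.
Proof.
rewrite /minor; have -> : row_mx (ofZ C (b J) *m c) (ofZ C (b J)) = ofZ C (b J) *m row_mx c 1%:M.
  by rewrite mul_mx_row mulmx1.
apply/eqP/negPn/negP; rewrite -unitfE -[_ \is a _]/(_ \in unitmx) mulmxA -row_full_unit => /eqP e.
have := mxrankM_maxl (z *m ofZ C (b J)) (row_mx c 1%:M).
rewrite e => /leq_trans/(_ (rank_leq_col _)).
by rewrite add1n ltnn.
Qed.

Lemma minorD J u u' : minor J (u + u') = minor J u + minor J u'.
Proof. by rewrite !minorE !mulmxDr mxE. Qed.

Lemma minorZ J a u : minor J (a *: u) = a * minor J u.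
Proof. by rewrite !minorE -!scalemxAr mxE. Qed.

Lemma minor_sum J (r : seq V) (P : pred V) (u : V -> 'cV[C]_n) :
  minor J (\sum_(i <- r | P i) u i) = \sum_(i <- r | P i) minor J (u i).
Proof.
apply: (big_morph (minor J)); first exact: minorD.
by have := minorZ J 0 0; rewrite scale0r mul0r.
Qed.

Lemma minor_off J I i : J \in skel D k -> I \in facets D J -> i \in I :\: J ->
  minor J (dualC I i) = 0.
Proof.
move=> Jk IF iIJ; have [JS Jn] := skelP _ _ _ Jk.
have [c Hc] := scaled_dual_basis Dv dm JS (hb Jk) IF iIJ.
have nz : m.+2%:R != 0 :> C by rewrite pnatr_eq0.
apply: (mulfI nz); rewrite mulr0 -minorZ -(minor_basis J (ofZ C c)); congr minor.
by rewrite -[RHS]map_mxM /= -/(ofZ C _) -ofZ_ratr Hc map_mxZ rmorph_nat.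
Qed.

(** Two extensions of u_j^J differ by a combination of the basis of M_J, on
    which the minor vanishes. *)
Lemma minor_dual J I I' j : J \in skel D k -> I \in facets D J -> I' \in facets D J -> j \in J ->
  minor J (dualC I j) = minor J (dualC I' j).
Proof.
move=> Jk IF IF' jJ; have [I1 _ JI] := facetsP _ _ _ IF; have [I1' _ JI'] := facetsP _ _ _ IF'.
have -> : dualC I' j = \sum_(i in I) ratr (pairing (dual v I' j) (ofZ rat (v i))) *: dualC I i.
  rewrite /dualC {1}(expand_dual Dv (dual v I' j) (facets_skel IF)) map_mx_sum.
  by apply: eq_bigr => i _; rewrite map_mxZ.
rewrite minor_sum (bigD1 j) ?(fintype.subsetP JI) //= minorZ (dualP Dv) ?(fintype.subsetP JI') //.
rewrite eqxx rmorph1 mul1r big1 ?addr0 // => i /andP[iI ij]; rewrite minorZ.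
have [iJ|iJ] := boolP (i \in J).
  by rewrite (dualP Dv) ?(fintype.subsetP JI') // eq_sym (negPf ij) rmorph0 mul0r.
by rewrite minor_off ?mulr0 // finset.in_setD iJ.
Qed.

(** The value of mu_k(J) at the row space of z. *)
Definition mu_value J : C := (#|` fset_set (quotH D v J)|%fset%:R)^-1 *
  \sum_(h \in quotH D v J) degree0_part idfun J (fun j => chi R v J j h)
     (fun j => minor J (dualC (facet_of D J) j)).

Hypothesis general_z : forall I (s : 'I_p -> V), I \in skel D n -> injective s ->
  (forall t, s t \in I) -> \det (z *m (\matrix_(l, t) dualC I (s t) l 0)) != 0.
Hypothesis edge_z : forall J j, J \in skel D k -> j \in J -> minor J (dualC (facet_of D J) j) != 0.

Lemma facet_ofP J : J \in simplices D -> facet_of D J \in facets D J.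
Proof.
move=> /simplices_pure [I [IS In JI]]; rewrite /facet_of; case: pickP => //= /(_ I).
by have -> : I \in facets D J by apply/facetsP.
Qed.

Variables (y : 'rV[C]_p) (g : 'rV[int]_n).
Hypotheses (yg : y *m z = ofZ C g) (gg : good_direction D v g).

(** The part of degree k of the Todd product is a combination of monomials of
    degree k in the values of the u_i^I at a vector of the row space of z.
    Interpolation replaces each of them by squarefree products, with the
    coefficients that occur in the Laurent expansion in the f^J(x_j). A factor
    off J contributes its constant term, which restricts the average to the
    classes that map to H_{J,V}. *)
Theorem facet_identity I : I \in skel D n ->
  avg (fun xi : 'rV['I_m.+2]_n => (todd_product R v (n - #|@finset.set0 V|) g finset.set0 I xi : {poly C})`_k : C)
  = \sum_(J : {set V} | (J \subset I) && (#|J| == k))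
      mu_value J * off_density R v m I J * \prod_(j in J) (dual_value v g I j)%:~R.
Proof.
move=> ISn; have [IS In] := skelP _ _ _ ISn.
pose w i := z *m dualC I i.
have subI J : J \subset I -> #|J| = k -> J \in skel D k /\ I \in facets D J.
  move=> JI Jk; split; first by apply/skelP; split=> //; exact: mem_simplices_sub IS JI.
  exact/facetsP.
have formy i : i \in I -> form w i y = (dual_value v g I i)%:~R.
  move=> iI; rewrite /form /w mulmxA yg -[LHS]/(pairing (dualC I i) (ofZ C g)) pairing_ratr.
  by rewrite (dual_valueE gg) // ratr_int.
have sz : (k + p = #|I|.+1)%N by rewrite In; lia.
have gen (s : 'I_p -> V) : injective s -> (forall t, s t \in I) ->
    (\matrix_(a, t) w (s t) a 0) \in unitmx.
  move=> si sI; rewrite unitmxE unitfE.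
  rewrite (_ : \matrix_(a, t) _ = z *m (\matrix_(l, t) dualC I (s t) l 0)); first exact: general_z.
  apply/matrixP => a t; rewrite [LHS]mxE /w [LHS]mxE [RHS]mxE.
  by apply: eq_bigr => l _; rewrite [in RHS]mxE.
have formpt i J : form w i (minor_point J) = minor J (dualC I i) by rewrite minorE.
have pt0 J i : J \subset I -> #|J| = k -> i \in I :\: J -> form w i (minor_point J) = 0.
  by move=> JI Jk iIJ; have [JS IF] := subI J JI Jk; rewrite formpt minor_off.
have ptj J i : J \subset I -> #|J| = k -> i \in J ->
    form w i (minor_point J) = minor J (dualC (facet_of D J) i).
  move=> JI Jk iJ; have [JS IF] := subI J JI Jk; rewrite formpt; apply: minor_dual => //.
  by apply: facet_ofP; case/skelP: JS.
have ptn J i : J \subset I -> #|J| = k -> i \in J -> form w i (minor_point J) != 0.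
  by move=> JI Jk iJ; have [JS IF] := subI J JI Jk; rewrite ptj // edge_z.
pose vr i (xi : 'rV['I_m.+2]_n) := vertex_root R v I i xi.
have coefE xi : (todd_product R v (n - #|@finset.set0 V|) g finset.set0 I xi)`_k
   = \sum_(J : {set V} | (J \subset I) && (#|J| == k))
      ((off_integral v I J xi)%:R * degree0_part idfun J (vr ^~ xi)
          (fun j => minor J (dualC (facet_of D J) j)))
      * \prod_(j in J) (dual_value v g I j)%:~R.
  rewrite /todd_product finset.setD0 cards0 subn0 coef_prod_set.
  under eq_bigr => e /andP[_ /eqP ek].
    have -> : \prod_(i in I) (todd (n + n).+2 (@laurent_coef R) (vertex_root R v I i xi)
          (dual_value v g I i)%:~R)`_(e i)
      = \prod_(i in I) laurent_coef (vr i xi) (e i) * \prod_(i in I) form w i y ^+ e i.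
      rewrite -big_split /=; apply: eq_bigr => i iI; rewrite formy // coef_poly.
      by rewrite (_ : (e i < (n + n).+2)%N) //; have := ltn_ord (e i); lia.
    rewrite (squarefree_interpolation sz gen pt0 ptn (e := fun i => e i) y ek) mulr_sumr.
    over.
  rewrite exchange_big /=; apply: eq_bigr => J /andP[JI /eqP Jk].
  under eq_bigr do rewrite mulrA.
  rewrite -mulr_suml; congr (_ * _); last by apply: eq_bigr => j jJ; rewrite formy ?(fintype.subsetP JI).
  rewrite (degree0_partE _ _ Jk) mulr_sumr [LHS]big_mkcond [RHS]big_mkcond /=.
  apply: eq_bigr => e _.
  case: (boolP ([forall i, (i \notin J) ==> (e i == 0 :> nat)] && _)) => [/andP[/forallP eJ /eqP ek]|N].
    have e0 i : i \notin J -> e i = 0 :> nat by move=> iJ; apply/eqP; exact: (implyP (eJ i)).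
    have -> : [forall i, (i \notin I) ==> (e i == 0 :> nat)].
      apply/forallP => i; apply/implyP => iI; rewrite e0 //; apply: contra iI; exact: (fintype.subsetP JI).
    have -> : (\sum_(i in I) e i)%N = k.
      rewrite (big_setID J) /= (finset.setIidPr JI) ek big1 ?addn0 // => i /finset.setDP[_ iJ].
      exact: e0.
    rewrite eqxx /=; have -> : [forall i in I :\: J, e i == 0 :> nat].
      by apply/forall_inP => i /finset.setDP[_ iJ]; rewrite e0.
    rewrite big_split /= mulrA; congr (_ * _).
      rewrite (big_setID J) /= (finset.setIidPr JI) mulrC off_integral_prod; congr (_ * _).
      by apply: eq_bigr => i /finset.setDP[_ iJ]; rewrite e0.
    by apply: eq_bigr => j jJ; rewrite ptj.
  case: ifP => // /andP[/forallP eI /eqP ek]; case: ifP => [/forall_inP eJ|]; last by rewrite mulr0.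
  case/negP: N; apply/andP; split.
    apply/forallP => i; apply/implyP => iJ; have [iI|iI] := boolP (i \in I).
      by apply: eJ; rewrite finset.in_setD iJ.
    exact: (implyP (eI i)).
  apply/eqP; apply: (etrans _ ek); rewrite [RHS](big_setID J) /= (finset.setIidPr JI).
  rewrite [X in _ = (_ + X)%N]big1 ?addn0 //.
  by move=> i iIJ; apply/eqP; exact: eJ.
rewrite -[LHS]/(avg _); under [X in avg X]eq_fun do rewrite coefE.
rewrite avg_sum; apply: eq_bigr => J /andP[JI /eqP Jk].
under [X in avg X]eq_fun do rewrite mulrC.
rewrite avgM mulrC; congr (_ * _).
rewrite (avg_quotH Dv ISn JI (dm I) (G := fun c => degree0_part idfun J c
  (fun j => minor J (dualC (facet_of D J) j)))).
  by rewrite mulrC.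
move=> c c' cc; rewrite /degree0_part; apply: eq_bigr => e _.
by apply: eq_bigr => j jJ; rewrite cc.
Qed.

End FacetIdentity.

(** * Comparison of the coefficients and density *)

Section Assembly.
Variables (R : realType) (n : nat) (V : finType) (D : multifan R n V).
Variables (v : V -> 'rV[int]_n).
Hypotheses (Dv : edge_vectors D v) (cD : complete_multifan D).
Variable m : nat.
Hypothesis dm : forall I i, denom_dvd m (dual v I i).
Implicit Types (I J : {set V}).
Local Notation C := R[i].

(** A lattice point that avoids finitely many hyperplanes is multiplied by a
    common denominator. *)
Lemma exists_good_direction (q : nat) (z : 'M[int]_(q, n)) :
  (forall I i, I \in skel D n -> i \in I -> ofZ rat z *m dual v I i != 0) ->
  exists y : 'rV[int]_q, good_direction D v (y *m z).
Proof.
move=> z0; have [x Hx] := avoid_family (fun t : {set V} * V => ofZ rat z *m dual v t.1 t.2).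
have E (w : 'rV[int]_q) I i : pairing (dual v I i) (ofZ rat (w *m z))
    = pairing (ofZ rat z *m dual v I i) (ofZ rat w).
  by rewrite /pairing /ofZ map_mxM mulmxA.
exists (m.+2%:Z *: x) => I i IS iI; split.
  by rewrite -scalemxAl; exact: dm.
rewrite E ofZZ pairingZr mulf_neq0 ?intr_eq0 //.
by apply: (Hx (I, i)); exact: z0.
Qed.

Lemma exists_good_direction1 : exists g, good_direction D v g.
Proof.
have [|y Hy] := exists_good_direction (z := 1%:M); last by exists (y *m 1%:M).
move=> I i IS iI; rewrite /ofZ map_scalar_mx rmorph1 mul1mx.
apply/eqP => e; have [IS' _] := skelP _ _ _ IS.
by have := dualP Dv i IS' iI; rewrite e pairing0l eqxx => /esym/eqP; rewrite oner_eq0.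
Qed.

Variable k : nat.
Hypotheses (k1 : (1 <= k)%N) (kn : (k <= n)%N).
Local Notation p := (1 + (n - k))%N.
Variable b : {set V} -> 'M[int]_(n, n - k).
Hypothesis hb : forall J, J \in skel D k -> lattice_basis (annM D J) (b J).

Section Point.
Variable z : 'M[C]_(p, n).
Hypothesis general_z : forall I (s : 'I_p -> V), I \in skel D n -> injective s ->
  (forall t, s t \in I) -> \det (z *m (\matrix_(l, t) dualC R v I (s t) l 0)) != 0.
Hypothesis edge_z : forall J j, J \in skel D k -> j \in J ->
  minor b z J (dualC R v (facet_of D J) j) != 0.

Lemma dual_at_point_neq0 I i : I \in skel D n -> i \in I -> z *m dualC R v I i != 0.
Proof.
move=> IS iI; have [_ In] := skelP _ _ _ IS.
pose l := i :: enum (I :\ i).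
have lI : {subset l <= I}.
  by move=> j; rewrite inE mem_enum !inE => /orP[/eqP ->//|/andP[]].
have ul : uniq l by rewrite /= enum_uniq mem_enum !inE eqxx.
have sl : size l = n.
  by rewrite /= -cardE; have := cardsD1 i I; rewrite iI In add1n.
have tl (t : 'I_p) : (t < size l)%N by rewrite sl; apply: leq_trans (ltn_ord t) _; lia.
have := general_z IS (s := fun t => nth i l t).
have H1 : injective (fun t : 'I_p => nth i l t).
  by move=> t t' /eqP; rewrite nth_uniq // => /eqP /ord_inj.
move=> /(_ H1 (fun t => lI _ (mem_nth i (tl t)))).
apply: contra => /eqP z0; apply/eqP.
rewrite (expand_det_col _ 0) big1 // => a _.
have -> : (z *m (\matrix_(l0 < n, t < p) dualC R v I (nth i l t) l0 0)) a 0 = (z *m dualC R v I i) a 0.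
  by rewrite [LHS]mxE [RHS]mxE; apply: eq_bigr => l0 _; rewrite [in LHS]mxE.
by rewrite z0 mxE mul0r.
Qed.

Lemma fJ_linear J j : fJ D v (b J) J j
  = Plucker.linearP (wedge (row_mx (dualC R v (facet_of D J) j) (ofZ C (b J)))).
Proof.
rewrite /fJ; congr Plucker.linearP; apply/ffunP => s; rewrite !ffunE -det_map_mx.
by rewrite map_mxsub map_row_mx ofZ_ratr.
Qed.

Lemma value_mu J : J \in skel D k ->
  GrassmannEval.value (GrassmannEval.matrix_point z) (mu D v (b J) J) (mu_value D v b z J).
Proof.
move=> JS; have [JS' Jk] := skelP _ _ _ JS; have [I [IS In JI]] := simplices_pure JS'.
have ISn : I \in skel D n by apply/skelP.
have fin := quotH_finite Dv ISn JI (dm I).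
apply: GrassmannEval.valueM.
  apply: GrassmannEval.valueV; last exact: GrassmannEval.value_natr.
  rewrite pnatr_eq0 cardfs_eq0; apply/negP => /eqP e.
  have : [set 0 + x | x in latNV v J] \in fset_set (quotH D v J).
    rewrite in_fset_set //; apply/mem_set; exists 0 => //.
    by apply/(latNP Dv ISn JI) => i _; rewrite /ofZ map_mx0 pairing0r.
  by rewrite e inE.
apply: GrassmannEval.value_pullback.
rewrite fsbig_finite /=; last exact: fin.
rewrite fsbig_finite /=; last exact: fin.
apply: GrassmannEval.value_sum => h _; apply: GrassmannEval.value_sum => e _.
apply: GrassmannEval.value_prod => j jJ; apply: GrassmannEval.valueM.
  exact: GrassmannEval.value_const.
apply: GrassmannEval.valueXz; first exact: edge_z.
by rewrite fJ_linear; exact: GrassmannEval.value_linearP.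
Qed.

Variables (y : 'rV[C]_p) (g : 'rV[int]_n).
Hypotheses (yg : y *m z = ofZ C g) (gg : good_direction D v g).

(** Exchange the sums over facets and faces after applying facet_identity: the
    factors <u_j^I, g>, j in J, cancel those of the denominator and leave the
    leading coefficients of the faces. *)
Lemma coef_identity (uI : {set V} -> 'cV[int]_n) :
  slice_coef D v m g finset.set0 uI (n - k)
  = \sum_(J in skel D k) mu_value D v b z J * slice_coef D v m g J uI (n - k).
Proof.
under [RHS]eq_bigr => J /skelP [JS Jk].
  have -> : (n - k = n - #|J|)%N by rewrite Jk.
  rewrite slice_coef_top mulr_sumr Jk.
  over.
rewrite (exchange_big_dep (mem (skel D n))) /=; last by move=> J I _; exact: facets_skel.
rewrite /slice_coef.
have -> : facets D finset.set0 = skel D n.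
  by apply/setP => I; rewrite /facets inE finset.sub0set andbT.
apply: eq_bigr => I ISn; have [IS In] := skelP _ _ _ ISn.
have -> : (n - #|@finset.set0 V| - (n - k) = k)%N by rewrite cards0; lia.
rewrite (facet_identity Dv dm k1 kn hb general_z edge_z yg gg ISn) mulr_sumr.
apply: eq_big => [J|J /andP[JI /eqP Jk]].
  apply/andP/andP => [[JI Jk]|[/skelP [JS Jk] /facetsP [_ _ JI]]]; last by rewrite JI Jk.
  split; first by apply/skelP; split; [exact: mem_simplices_sub IS JI|exact/eqP].
  exact/facetsP.
have a0 (A : {set V}) : A \subset I -> \prod_(i in A) (dual_value v g I i)%:~R != 0 :> C.
  move=> AI; apply/prodf_neq0 => i iA; rewrite intr_eq0.
  by apply: (dual_value_neq0 gg ISn); exact: (fintype.subsetP AI).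
rewrite /facet_weight finset.setD0 (big_setID J (A := I)) /= (finset.setIidPr JI).
have := a0 J JI; have := a0 (I :\: J) (finset.subsetDl _ _).
move: (\prod_(i in J) _) (\prod_(i in I :\: J) _) => A B B0 A0.
move: (mu_value _ _ _ _ _) (off_density _ _ _ _ _) (_ ^+ _) (_`!%:R)  => x1 x2 x3 x4.
by move: (x4^-1) => x5; field; rewrite ?A0 ?B0.
Qed.

End Point.

(** The rows of z are taken to be the edge vectors dual to the chosen forms. *)
Lemma general_nonzero I (s : 'I_p -> V) : I \in skel D n -> injective s -> (forall t, s t \in I) ->
  exists z : 'M[C]_(p, n), \det (z *m (\matrix_(l, t) dualC R v I (s t) l 0)) != 0.
Proof.
move=> ISn si sI; have [IS _] := skelP _ _ _ ISn.
exists (\matrix_(t, l) ofZ C (v (s t)) 0 l).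
rewrite (_ : _ *m _ = 1%:M) ?det1 ?oner_eq0 //; apply/matrixP => t t'; rewrite [LHS]mxE.
transitivity (pairing (dualC R v I (s t')) (ofZ C (v (s t)))).
  rewrite pairingE; apply: eq_bigr => l _.
  by rewrite [X in X * _ = _]mxE [X in _ * X = _]mxE.
by rewrite pairing_ratr (dualP Dv) // rmorph_nat mxE (inj_eq si) eq_sym.
Qed.

(** The matrix (u, b_J) has a left inverse, built from the edge vector v_j and
    from a left inverse of b_J. *)
Lemma edge_nonzero J j : J \in skel D k -> j \in J ->
  exists z : 'M[C]_(p, n), minor b z J (dualC R v (facet_of D J) j) != 0.
Proof.
move=> JS jJ; have [JS' Jk] := skelP _ _ _ JS.
have [IS _ JI] := facetsP _ _ _ (facet_ofP JS').
have [L0 HL0] := basis_left_inverse (hb JS).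
pose L := map_mx (real_complex R) L0.
have HL : L *m ofZ C (b J) = 1%:M.
  have -> : ofZ C (b J) = map_mx (real_complex R) (ofZ R (b J)).
    by apply/matrixP => x y; rewrite !mxE rmorph_int.
  by rewrite -map_mxM HL0 map_scalar_mx rmorph1.
set u := dualC R v (facet_of D J) j.
have uv : ofZ C (v j) *m u = 1%:M.
  apply/matrixP => x y; rewrite !ord1 -[LHS]/(pairing u (ofZ C (v j))) pairing_ratr.
  by rewrite (dualP Dv) ?(fintype.subsetP JI) // eqxx rmorph1 mxE eqxx.
have bv : ofZ C (v j) *m ofZ C (b J) = 0.
  rewrite -map_mxM; apply/matrixP => x y; rewrite ord1 [LHS]mxE (basis_kills Dv JS' (hb JS)) //.
  by rewrite mxE.
exists (col_mx (ofZ C (v j)) (L - (L *m u) *m ofZ C (v j))).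
rewrite /minor mul_col_row !mulmxBl uv bv -!mulmxA uv bv HL mulmx1 !mulmx0 subr0 subrr.
by rewrite -scalar_mx_block det1 oner_eq0.
Qed.

End Assembly.

Theorem corollary3p2 (R : realType) (n : nat) (V : finType)
    (D : multifan R n V) (v : V -> 'rV[int]_n) (d : V -> int)
    (g : {set V} -> 'rV[R]_n) (eps : R) :
  complete_multifan D ->
  edge_vectors D v ->
  T_Cartier D v d ->
  (forall K : {set V}, K \in simplices D -> DH_direction D v K (g K)) ->
  0 < eps < 1 ->
  let expansion (a : nat -> R) := forall nu : nat, (0 < nu)%N ->
    lattice_count D v (g finset.set0) eps d nu
    = \sum_(k < n.+1) a k * nu%:R ^+ (n - k) in
  (exists a : nat -> R, expansion a) /\
  forall a : nat -> R, expansion a ->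
  forall k : nat, (1 <= k <= n)%N ->
  forall b : {set V} -> 'M[int]_(n, n - k),
  (forall J : {set V}, J \in skel D k -> lattice_basis (annM D J) (b J)) ->
  constG (1 + (n - k)) n (a k)%:C%C
  = \sum_(J in skel D k)
      mu D v (b J) J
      * constG (1 + (n - k)) n
          (vol D v (g J) (fun i => (d i)%:~R) (b J) J)%:C%C.
Proof.
move=> cD Dv TC dg e01 expansion.
have [m dm] := exists_denom v.
have /choice [uI uIE] : forall I, exists u : 'cV[int]_n, I \in skel D n ->
    ofZ rat u = \sum_(i in I) (d i)%:~R *: dual v I i.
  move=> I; have [/TC [u Hu]|] := boolP (I \in skel D n); last by exists 0.
  by exists u.
have dg0 := dg _ (simplices0 D).
have count h : good_direction D v h -> forall nu, ((lattice_count D v (g finset.set0) eps d nu)%:C)%C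
    = \sum_(l < n.+1) nu%:R ^+ l * slice_coef D v m h finset.set0 uI l.
  move=> hh nu; rewrite lattice_count_slice // (slice_count_expansion Dv cD dm nu dg0 hh uIE).
  by rewrite cards0 subn0.
split.
  have [h hh] := exists_good_direction1 Dv dm.
  exists (fun k => complex.Re (slice_coef D v m h finset.set0 uI (n - k))) => nu _.
  have := count h hh nu; rewrite (poly_sum_parts n.+1 nu (slice_coef D v m h finset.set0 uI)) => -[-> _].
  rewrite (reindex_inj rev_ord_inj) /=; apply: eq_bigr => l _.
  by rewrite subSS mulrC.
move=> a aE k /andP[k1 kn] b hb.
have coefE h : good_direction D v h -> ((a k)%:C)%C = slice_coef D v m h finset.set0 uI (n - k).
  move=> hh; apply/eqP; rewrite -subr_eq0.
  pose x l := ((a (n - l)%N)%:C)%C - slice_coef D v m h finset.set0 uI l.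
  have -> : ((a k)%:C)%C - slice_coef D v m h finset.set0 uI (n - k) = x (n - k)%N.
    by rewrite /x subKn.
  apply/eqP; apply: (@poly_values_eq0 _ n.+1); last by rewrite ltnS leq_subr.
  move=> N N0; under eq_bigr do rewrite mulrBr.
  rewrite sumrB -count // aE // rmorph_sum /= (reindex_inj rev_ord_inj) /=.
  apply/eqP; rewrite subr_eq0; apply/eqP/eq_bigr => l _.
  rewrite subSS subKn; last by rewrite -ltnS.
  by rewrite mulrC rmorphM rmorphXn rmorph_nat.
pose p := (1 + (n - k))%N.
(* These minors are non-zero when the dual vectors of each facet are in general
   position on the row space and no f^J(x_j) vanishes on it. *)
pose As : seq 'M[R[i]]_(n, p) :=
  [seq \matrix_(l, t) dualC R v q.1 (q.2 t) l 0 | q : {set V} * {ffun 'I_p -> V} <- enum {: {set V} * {ffun 'I_p -> V}} &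
     [&& q.1 \in skel D n, injectiveb q.2 & [forall t, q.2 t \in q.1]]] ++
  [seq row_mx (dualC R v (facet_of D q.1) q.2) (ofZ R[i] (b q.1)) | q <- enum {: {set V} * V} &
     (q.1 \in skel D k) && (q.2 \in q.1)].
apply/eqP; rewrite -subr_eq0; apply/eqP.
apply: (@GrassmannEval.value_generic0 _ _ _ (fun t => t%:R) As).
- by move=> s t /eqP; rewrite eqr_nat => /eqP.
- move=> A; rewrite mem_cat => /orP[] /mapP [[J f]]; rewrite mem_filter /=.
    move=> /andP[/and3P[JS /injectiveP fi /forallP fJ] _] ->; exact: general_nonzero.
  by move=> /andP[/andP[JS fJ] _] ->; exact: (edge_nonzero Dv hb).
move=> z zE zA.
have /choice [z1 Hz1] : forall q : 'I_p * 'I_n, exists c : int, z q.1 q.2 = c%:~R.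
  move=> [s t]; have [x [e ->]] := zE s t; exists (x%:Z ^+ e.+1).
  by rewrite rmorphXn.
pose zZ : 'M[int]_(p, n) := \matrix_(s, t) z1 (s, t).
have zZE : z = ofZ R[i] zZ by apply/matrixP => s t; rewrite !mxE -Hz1.
have gen I (s : 'I_p -> V) : I \in skel D n -> injective s -> (forall t, s t \in I) ->
    \det (z *m (\matrix_(l, t) dualC R v I (s t) l 0)) != 0.
  move=> ISn si sI; apply: zA; rewrite mem_cat; apply/orP; left; apply/mapP.
  pose f : {ffun 'I_p -> V} := [ffun t => s t].
  have fi : injective f by move=> t t'; rewrite !ffunE; exact: si.
  exists (I, f).
    rewrite mem_filter mem_enum andbT /= ISn /=; apply/andP; split; first exact/injectiveP.
    by apply/forallP => t; rewrite ffunE.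
  by apply/matrixP => l t; rewrite [LHS]mxE [RHS]mxE /= ffunE.
have edge J j : J \in skel D k -> j \in J -> minor b z J (dualC R v (facet_of D J) j) != 0.
  move=> JS jJ; apply: zA; rewrite mem_cat; apply/orP; right; apply/mapP.
  by exists (J, j) => //; rewrite mem_filter /= JS jJ mem_enum.
have [y hy] : exists y : 'rV[int]_p, good_direction D v (y *m zZ).
  apply: (exists_good_direction dm) => I i IS iI.
  have := dual_at_point_neq0 k1 kn gen IS iI; apply: contra => /eqP e.
  by rewrite zZE -ofZ_ratr -map_mxM e map_mx0.
have yz : ofZ R[i] y *m z = ofZ R[i] (y *m zZ) by rewrite zZE /ofZ map_mxM.
have -> : 0 = ((a k)%:C)%C - \sum_(J in skel D k)
    mu_value D v b z J * ((vol D v (g J) (fun i => (d i)%:~R) (b J) J)%:C)%C.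
  rewrite (coefE _ hy) (coef_identity Dv dm k1 kn hb gen edge yz hy).
  apply/esym/eqP; rewrite subr_eq0; apply/eqP/eq_bigr => J JS; congr (_ * _).
  have [JS' Jk] := skelP _ _ _ JS.
  by rewrite (volumeE Dv cD dm JS' (hb J JS) (dg J JS') uIE _ hy) // Jk.
apply: GrassmannEval.valueD; first exact: GrassmannEval.value_const.
apply: GrassmannEval.valueN; apply: GrassmannEval.value_sum => J JS.
apply: GrassmannEval.valueM; last exact: GrassmannEval.value_const.
exact: (value_mu Dv dm).
Qed.
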